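(* Let $d\ge 1$ and let $B$ be a homogeneous Banach space on $\mathbb{T}^d$. If $q\in\{1,\infty\}$ and $\alpha>0$, then there is a constant $C$ such that $$\|\sigma_n^{q,\alpha} f\|_B \leq C \|f\|_B \qquad (f\in B,\ n\in\mathbb{N},\ n\ge 1)$$ and $$\lim_{n\to\infty} \sigma_n^{q,\alpha} f=f \quad \text{in the } B\text{-norm for all } f\in B.$$ If $q=2$, then the same holds for $\alpha>(d-1)/2$.
   Context: $\mathbb{T}=[-\pi,\pi]$ is the torus; functions on $\mathbb{T}^d$ are $2\pi$-periodic in each variable. For $f\in L_1(\mathbb{T}^d)$, $\widehat f(k)=(2\pi)^{-d}\int_{\mathbb{T}^d} f(x)e^{-\imath k\cdot x}\,dx$, $k\in\mathbb{Z}^d$ ($\imath=\sqrt{-1}$). $\|k\|_q=(\sum_j|k_j|^q)^{1/q}$ for $q<\infty$ and $\|k\|_\infty=\max_j|k_j|$. Fix a real parameter $1\le\gamma<\infty$; when $q=2$ assume in addition $\gamma\in\mathbb{N}$. The $\ell_q$-Riesz means are $$\sigma_n^{q,\alpha}f(x)=\sum_{k\in\mathbb{Z}^d,\ \|k\|_q\le n}\Big(1-\Big(\frac{\|k\|_q}{n}\Big)^\gamma\Big)^\alpha \widehat f(k)e^{\imath k\cdot x}.$$ A Banach space $B$ consisting of measurable functions on $\mathbb{T}^d$ is a homogeneous Banach space if, with $T_xf(t)=f(t-x)$: (1) for all $f\in B$ and $x\in\mathbb{T}^d$, $T_xf\in B$ and $\|T_xf\|_B=\|f\|_B$; (2) for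 every $f\in B$ the map $x\mapsto T_xf$ from $\mathbb{T}^d$ to $B$ is continuous; (3) there is a constant $C$ with $\|f\|_1\le C\|f\|_B$ for all $f\in B$. *)

(* Defs.v *)
(* Complex numbers are R[i] from mathcomp-real-closed. *)
From HB Require Import structures.
From mathcomp Require Import all_boot all_order all_algebra.
From mathcomp Require Import all_classical all_reals all_analysis.
From mathcomp Require Import complex.

Set Implicit Arguments.
Unset Strict Implicit.
Unset Printing Implicit Defensive.

Import Order.TTheory GRing.Theory Num.Theory.
Import numFieldNormedType.Exports.

Local Open Scope classical_set_scope.
Local Open Scope ring_scope.
Local Open Scope complex_scope.

(* The library has no Lebesgue measure on R^n.  The sigma-algebra on 'rV[R]_n
   is the one generated by the coordinates (the Borel one), in the same way as
   the library does for n.-tuple. *)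
Section measurable_rV.
Context {R : realType} (n : nat).

Let coors : 'I_n -> 'rV[R]_n -> R := fun i x => x ord0 i.

Let rV_set0 : g_sigma_preimage coors set0.
Proof. exact: sigma_algebra0. Qed.

Let rV_setC A : g_sigma_preimage coors A -> g_sigma_preimage coors (~` A).
Proof. exact: sigma_algebraC. Qed.

Let rV_bigcup (F : _^nat) : (forall i, g_sigma_preimage coors (F i)) ->
  g_sigma_preimage coors (\bigcup_i (F i)).
Proof. exact: sigma_algebra_bigcup. Qed.

HB.instance Definition _ := @isMeasurable.Build default_measure_display
  'rV[R]_n (g_sigma_preimage coors) rV_set0 rV_setC rV_bigcup.

End measurable_rV.

Section measurable_rV_lemmas.
Context {R : realType}.

Lemma measurable_coord n (i : 'I_n) :
  measurable_fun [set: 'rV[R]_n] (fun x : 'rV[R]_n => x ord0 i).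
Proof.
move=> _ Y mY; rewrite setTI; apply: sub_sigma_algebra => /=.
rewrite -bigcup_seq/=; exists i => /=; first by rewrite mem_index_enum.
by exists Y => //; rewrite setTI.
Qed.

Lemma measurable_fun_rV d (T : measurableType d) n (f : T -> 'rV[R]_n) :
  (forall i, measurable_fun [set: T] (fun t => f t ord0 i)) ->
  measurable_fun [set: T] f.
Proof.
move=> mf _ A mA; rewrite setTI.
suff : g_sigma_preimage (fun i => (fun x : 'rV[R]_n => x ord0 i) \o f)
    `<=` measurable.
  by apply; rewrite g_sigma_preimage_comp; exists A => //; rewrite setTI.
apply: smallest_sub; first exact: sigma_algebra_measurable.
rewrite -bigcup_seq => B [i _] [C mC <-]; exact: mf.
Qed.

End measurable_rV_lemmas.

Section lebesgue_rV.
Context {R : realType}.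

Definition cons_rV n (p : R * 'rV[R]_n) : 'rV[R]_n.+1 :=
  \row_i oapp (p.2 ord0) p.1 (unlift ord0 i).

Definition uncons_rV n (x : 'rV[R]_n.+1) : R * 'rV[R]_n :=
  (x ord0 ord0, \row_i x ord0 (lift ord0 i)).

Lemma cons_rV0 n (p : R * 'rV[R]_n) : cons_rV p ord0 ord0 = p.1.
Proof. by rewrite mxE unlift_none. Qed.

Lemma cons_rV_lift n (p : R * 'rV[R]_n) i :
  cons_rV p ord0 (lift ord0 i) = p.2 ord0 i.
Proof. by rewrite mxE liftK. Qed.

Lemma cons_rVK n : cancel (@cons_rV n) (@uncons_rV n).
Proof.
move=> [x y]; rewrite /uncons_rV cons_rV0; congr pair.
by apply/rowP => i; rewrite mxE cons_rV_lift.
Qed.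

Lemma measurable_cons_rV n : measurable_fun [set: R * 'rV[R]_n] (@cons_rV n).
Proof.
apply: measurable_fun_rV => i; case: (unliftP ord0 i) => [j|] ->.
  under eq_fun do rewrite cons_rV_lift.
  exact: (measurableT_comp (measurable_coord j)).
under eq_fun do rewrite cons_rV0.
exact: measurable_fst.
Qed.

Lemma measurable_uncons_rV n :
  measurable_fun [set: 'rV[R]_n.+1] (@uncons_rV n).
Proof.
apply: measurable_fun_pair; first exact: measurable_coord.
apply: measurable_fun_rV => i /=; under eq_fun do rewrite mxE.
exact: measurable_coord.
Qed.

Section lebesgue_rV_succ.
Variables (n : nat) (m : {sigma_finite_measure set 'rV[R]_n -> \bar R}).

Definition lebesgue_rV_succ : set 'rV[R]_n.+1 -> \bar R :=
  pushforward (lebesgue_measure \x m)%E (@cons_rV n).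

Let mu0 : lebesgue_rV_succ set0 = 0%E.
Proof. by rewrite /lebesgue_rV_succ /pushforward preimage_set0 measure0. Qed.

Let mu_ge0 A : (0 <= lebesgue_rV_succ A)%E.
Proof. by rewrite /lebesgue_rV_succ /pushforward measure_ge0. Qed.

Let mu_sigma_additive : semi_sigma_additive lebesgue_rV_succ.
Proof.
have mcons := @measurable_cons_rV n.
exact: measure_semi_sigma_additive.
Qed.

HB.instance Definition _ := isMeasure.Build _ _ _
  lebesgue_rV_succ mu0 mu_ge0 mu_sigma_additive.

Let mu_sigma_finite : sigma_finite setT lebesgue_rV_succ.
Proof.
have /sigma_finiteP[F [TF ndF Foo]] := sigma_finiteT (@lebesgue_measure R).
have /sigma_finiteP[G [TG ndG Goo]] := sigma_finiteT m.
exists (fun k => @uncons_rV n @^-1` (F k `*` G k)).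
  rewrite -preimage_bigcup (_ : \bigcup_k _ = setT) ?preimage_setT//.
  rewrite -setXTT TF TG predeqE => -[x y]; split.
    by move=> [k _ []/= ? ?]; split; exists k.
  move=> [/= [k _ Fkx] [l _ Gly]]; exists (maxn k l) => //; split.
  - by move: x Fkx; exact/subsetPset/ndF/leq_maxl.
  - by move: y Gly; exact/subsetPset/ndG/leq_maxr.
move=> k; have [mF Fk] := Foo k; have [mG Gk] := Goo k; split.
  rewrite -[X in measurable X]setTI; apply: measurable_uncons_rV => //.
  exact: measurableX.
rewrite /lebesgue_rV_succ /pushforward -comp_preimage.
rewrite (_ : _ \o _ = id) ?preimage_id; last first.
  by apply/funext => p /=; rewrite cons_rVK.
by rewrite product_measure1E// lte_mul_pinfty// ge0_fin_numE.
Qed.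

HB.instance Definition _ := Measure_isSigmaFinite.Build _ _ _
  lebesgue_rV_succ mu_sigma_finite.

End lebesgue_rV_succ.

Fixpoint lebesgue_rV (n : nat) : {sigma_finite_measure set 'rV[R]_n -> \bar R} :=
  match n with
  | 0%N => \d_(0 : 'rV[R]_0)
  | n.+1 => lebesgue_rV_succ (lebesgue_rV n)
  end.

Lemma lebesgue_rV_box n (A : 'I_n -> set R) : (forall i, measurable (A i)) ->
  lebesgue_rV n [set x | forall i, A i (x ord0 i)] =
  (\prod_(i < n) lebesgue_measure (A i))%E.
Proof.
elim: n A => [|n IHn] A mA.
  rewrite big_ord0 /= diracE mem_set//= => -[]//.
rewrite big_ord_recl -(IHn (fun i => A (lift ord0 i)))//=.
set B := (X in (_ * lebesgue_rV n X)%E).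
have mB : measurable B.
  have -> : B = \bigcap_(i in [set: 'I_n])
      ((fun x : 'rV[R]_n => x ord0 i) @^-1` A (lift ord0 i)).
    by apply/seteqP; split => x /= h i; [move=> _|]; exact: h.
  apply: fin_bigcap_measurable => // i _.
  by rewrite -[X in measurable X]setTI; exact: measurable_coord.
rewrite /lebesgue_rV_succ /pushforward -product_measure1E//; last exact: mA.
congr (product_measure1 _ _ _).
apply/seteqP; split => [[x y] h|[x y] [/= h1 h2] i] /=.
  split => [|i] /=; first by have := h ord0; rewrite cons_rV0.
  by have := h (lift ord0 i); rewrite cons_rV_lift.
by case: (unliftP ord0 i) => [j|] ->; rewrite ?cons_rV_lift ?cons_rV0.
Qed.

End lebesgue_rV.

Section fourier.
Context {R : realType} {d : nat}.
Implicit Types (f g : 'rV[R]_d -> R[i]) (k : 'rV[int]_d) (x t : 'rV[R]_d).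

(* Functions on T^d are functions on R^d that are 2 pi-periodic in each
   variable; [torus] is the period cell over which they are integrated. *)
Definition torus : set 'rV[R]_d :=
  [set x | forall j, - pi <= x ord0 j <= pi].

Definition torus_periodic f :=
  forall x (j : 'I_d), f (x + (2 * pi) *: delta_mx ord0 j) = f x.

Definition cmeasurable f :=
  measurable_fun setT (fun x => complex.Re (f x)) /\
  measurable_fun setT (fun x => complex.Im (f x)).

Definition torus_ae_eq f g := ae_eq (lebesgue_rV d) torus f g.

Definition translation x f : 'rV[R]_d -> R[i] := fun t => f (t - x).

Definition dotZ k x : R := \sum_(j < d) (k ord0 j)%:~R * x ord0 j.

Definition cis (u : R) : R[i] := cos u +i* sin u.

Definition torus_integral f : R[i] :=
  (\int[lebesgue_rV d]_(x in torus) complex.Re (f x)) +i*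
  (\int[lebesgue_rV d]_(x in torus) complex.Im (f x)).

Definition torus_norm1 f : \bar R :=
  (\int[lebesgue_rV d]_(x in torus) (complex.Re `|f x|)%:E)%E.

Definition fourier_coef f k : R[i] :=
  (((2 * pi) ^+ d)^-1)%:C * torus_integral (fun x => f x * cis (- dotZ k x)).

(* q ranges over [1, +oo]; the value at -oo is junk. *)
Definition lq_norm (q : \bar R) (v : 'rV[R]_d) : R :=
  match q with
  | r%:E => (\sum_(j < d) `|v ord0 j| `^ r) `^ r^-1
  | +oo%E => \big[Num.max/0]_(j < d) `|v ord0 j|
  | -oo%E => 0
  end.

Definition lq_normZ (q : \bar R) k : R := lq_norm q (map_mx intr k).

(* The index set is finite for q >= 1, so this [\sum_(k \in _)] is a genuine
   finite sum.  For n > 0, gamma > 0 and alpha > 0 the library's conventions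
   on 0 `^ _ are the usual ones: 0 `^ gamma = 0 `^ alpha = 0. *)
Definition riesz_mean (q : \bar R) (gamma alpha : R) (n : nat) f :
    'rV[R]_d -> R[i] := fun x =>
  \sum_(k \in [set k | lq_normZ q k <= n%:R])
    (((1 - (lq_normZ q k / n%:R) `^ gamma) `^ alpha)%:C
      * fourier_coef f k * cis (dotZ k x)).

End fourier.

(* The norm of a normed space over R[i] takes its values in the nonnegative
   reals of R[i]; [rnorm] is the same number in R. *)
Definition rnorm {R : realType} {V : normedModType R[i]} (v : V) : R :=
  complex.Re `|v|.

(* A complex Banach space whose elements are measurable functions on T^d up to
   a.e. equality: [hb_fun] is the embedding, sending f to a representative. It
   is linear and injective modulo a.e. equality, so the translate T_x f is
   determined in the space by its class. Every Lebesgue measurable class has a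
   Borel representative, so asking for Borel measurability loses nothing. *)
Record homogeneousBanach (R : realType) (d : nat) := HomogeneousBanach {
  hb_space :> completeNormedModType R[i] ;
  hb_fun : hb_space -> 'rV[R]_d -> R[i] ;
  hb_periodic : forall f, torus_periodic (hb_fun f) ;
  hb_measurable : forall f, cmeasurable (hb_fun f) ;
  hb_linear : forall (a : R[i]) f g,
    torus_ae_eq (hb_fun (a *: f + g)) (fun x => a * hb_fun f x + hb_fun g x) ;
  hb_inj : forall f g, torus_ae_eq (hb_fun f) (hb_fun g) -> f = g ;
  hb_trans : 'rV[R]_d -> hb_space -> hb_space ;
  hb_transE : forall x f,
    torus_ae_eq (hb_fun (hb_trans x f)) (translation x (hb_fun f)) ;
  hb_trans_norm : forall x f, rnorm (hb_trans x f) = rnorm f ;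
  hb_trans_continuous : forall f, continuous (hb_trans ^~ f) ;
  hb_norm1 : exists C : R, forall f,
    (torus_norm1 (hb_fun f) <= (C * rnorm f)%:E)%E
}.

(* Main.v *)
Require Import Defs.
From HB Require Import structures.
From mathcomp Require Import all_boot all_order all_algebra.
From mathcomp Require Import all_classical all_reals all_analysis.
From mathcomp Require Import complex measurable_realfun.
From mathcomp Require Import ring lra zify.

(** Write the weight of a Riesz mean as [Phi (|k|_q / n)], where
    [Phi t = (1 - t^gamma)_+^alpha]. The proof has two independent halves, which
    meet in [mass_bound]: for every finite set [F] of frequencies there is a
    discrete measure on the torus, of total mass bounded independently of [n] and
    [F], whose Fourier transform agrees with the weight on [F].

    Such measures give everything that is claimed. If the measure has the masses
    [c_j] at the points [x_j] and [f] is a trigonometric polynomial with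
    frequencies in [F], then the Riesz mean of [f] is the sum of the
    [c_j T_(x_j) f], of norm at most the total mass times the norm of [f], because
    translations are isometries. Trigonometric polynomials are dense and the
    weight tends to one at each frequency, so the bound extends to the whole space
    and implies convergence ([multiplier_op_bound], [multiplier_op_cvg]).

    The space half makes sense of this without integrals in [B]. By strong
    continuity the averages of [e^(i k.x) T_x f] over finer and finer grids
    converge, to the component [P_k f] of [f] at frequency [k] ([cvg_avg],
    [freq_proj]). The function of [P_k f] is an eigenvector of all translations,
    so its quotient by the character is translation invariant almost everywhere,
    hence constant by Fubini ([torus_invariant_cst]); by continuity of the Fourier
    coefficients the constant is that of [f] ([hb_fun_freq_proj]). Thus the Riesz
    mean of [f] is a finite combination of the [P_k f], an element of [B]. Density
    is proved with Fejer kernels on the grids ([fejer_approx]), which concentrate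
    at the origin because a geometric sum telescopes ([fejer_second_moment]).

    The kernel half takes the measure on a fine grid, as the inverse discrete
    Fourier transform of the weight ([mass_bound_gdft]), so that its mass is an
    l^1 norm. The grid is cut into dyadic pieces. On a piece at distance about
    [2^(-l)] from the origin the transform of a function is comparable with that
    of its difference with step [2^l], and Cauchy-Schwarz with the Plancherel
    identity bounds the mass of the piece by the square sum of this difference
    ([gdft_box]). It remains to see that differences are small enough for the
    pieces to be summable.

    For [q = oo] the weight is a profile of the largest coordinate, and for
    [q = 1] of the largest of the forms [+-k_1 +- ... +- k_d], so both are
    restrictions of a profile of the largest coordinate on some [Z^I]. The largest
    coordinate ignores the others where it is strictly largest, so a difference
    taken in all directions lives where all coordinates agree in modulus up to
    their steps. This set is so thin that every Hoelder profile will do, that is,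
    every [alpha > 0] ([mixed_diff_max_profile], [l1_gdft_max_profile]).

    For [q = 2] differences of high order in a single direction are used. With
    step [h] they are of the order of [(h/n)^alpha] in the annulus of width [h]
    around the sphere of radius [n], which has about [n^(d-1) h] lattice points;
    the square sum is of the order of [n^d (h/n)^(1 + 2 alpha)], and beats [h^d]
    by a power of [h/n] when [alpha > (d - 1)/2]. Inside the ball the derivatives
    of the profile are only singular at the sphere and at the origin, and their
    contributions are of the same or of smaller order ([radial_derive_bound],
    [sum_sqr_radial_diff]). *)

Set Implicit Arguments.
Unset Strict Implicit.
Unset Printing Implicit Defensive.

Import Order.TTheory GRing.Theory Num.Theory.
Import numFieldNormedType.Exports.

Local Open Scope classical_set_scope.
Local Open Scope ring_scope.
Local Open Scope complex_scope.

(** * The modulus of complex numbers and the characters of a finite torus *)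

Section complex_modulus.
Context {R : realType}.
Implicit Types (z : R[i]) (u v : R).

(** The norm of [R[i]] is complex valued; [cabs] is the same number in [R]. *)
Definition cabs z : R := complex.Re `|z|.

Lemma cabsE z : `|z| = (cabs z)%:C.
Proof. by rewrite /cabs normc_def. Qed.

Lemma cabs_ge0 z : 0 <= cabs z.
Proof. by rewrite -ler0c -cabsE. Qed.

Lemma cabs0 : cabs 0 = 0.
Proof. by rewrite /cabs normr0. Qed.

Lemma cabsM z1 z2 : cabs (z1 * z2) = cabs z1 * cabs z2.
Proof. by apply: complexI; rewrite -cabsE normrM !cabsE rmorphM. Qed.

Lemma cabsN z : cabs (- z) = cabs z.
Proof. by rewrite /cabs normrN. Qed.

Lemma ler_cabsD z1 z2 : cabs (z1 + z2) <= cabs z1 + cabs z2.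
Proof. by rewrite -lecR rmorphD /= -!cabsE ler_normD. Qed.

Lemma cabs_real u : cabs u%:C = `|u|.
Proof. by rewrite /cabs normc_def /= expr0n addr0 sqrtr_sqr. Qed.

Lemma cabs_prod (J : Type) (r : seq J) (P : pred J) (F : J -> R[i]) :
  cabs (\prod_(i <- r | P i) F i) = \prod_(i <- r | P i) cabs (F i).
Proof.
apply: complexI; rewrite -cabsE normr_prod rmorph_prod /=.
by apply: eq_bigr => i _; rewrite cabsE.
Qed.

Lemma cabsX z k : cabs (z ^+ k) = cabs z ^+ k.
Proof. by apply: complexI; rewrite -cabsE normrX cabsE rmorphXn. Qed.

Lemma sqr_cabs z : ((cabs z) ^+ 2)%:C = z * z^*.
Proof. by rewrite rmorphXn /= -cabsE sqr_normc. Qed.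

Lemma sqr_cabsE z : (cabs z) ^+ 2 = complex.Re z ^+ 2 + complex.Im z ^+ 2.
Proof. by apply: complexI; rewrite add_Re2_Im2 rmorphXn /= -cabsE. Qed.

Lemma cisD u v : cis (u + v) = cis u * cis v.
Proof. by rewrite /cis cosD sinD; simpc; congr (_ +i* _); ring. Qed.

Lemma cis0 : cis (0 : R) = 1.
Proof. by rewrite /cis cos0 sin0. Qed.

Lemma conj_cis u : (cis u)^* = cis (- u).
Proof. by rewrite /cis /= cosN sinN. Qed.

Lemma cabs_cis u : cabs (cis u) = 1.
Proof.
by rewrite /cabs normc_def /= cos2Dsin2 sqrtr1.
Qed.

Lemma cis2pi : cis (2 * pi : R) = 1.
Proof. by rewrite /cis mulr_natl cos2pi sin2pi. Qed.

Lemma cis_sum (J : Type) (r : seq J) (P : pred J) (F : J -> R) :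
  cis (\sum_(i <- r | P i) F i) = \prod_(i <- r | P i) cis (F i).
Proof. by apply: (big_morph (@cis R) cisD cis0). Qed.

Lemma cis2pin n : cis (2 * pi * n%:R : R) = 1.
Proof.
elim: n => [|n IH]; first by rewrite mulr0 cis0.
rewrite -addn1 natrD (_ : _ * _ = 2 * pi * n%:R + 2 * pi); last by ring.
by rewrite cisD IH cis2pi mulr1.
Qed.

Lemma cis2piz (z : int) : cis (2 * pi * z%:~R : R) = 1.
Proof.
case: z => n; first exact: cis2pin.
rewrite NegzE mulrNz mulrN -conj_cis.
by rewrite [X in cis X](_ : _ = 2 * pi * n.+1%:R) // cis2pin conjc1.
Qed.

Lemma sqr_cabs_cisB1 u : cabs (cis u - 1) ^+ 2 = 2 - 2 * cos u.
Proof.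
rewrite sqr_cabsE /cis /= subr0.
have := cos2Dsin2 u; nra.
Qed.

End complex_modulus.

Section cyclic_characters.
Context {R : realType}.
Variable N : nat.
Hypothesis N1 : (1 < N)%N.
Local Notation ZN := 'Z_N.

Definition zchar (a : ZN) : R[i] := cis (2 * pi * (a : nat)%:R / N%:R).

Let N0 : N%:R != 0 :> R.
Proof. by rewrite pnatr_eq0 -lt0n; exact: ltnW. Qed.

Lemma zchar_nat (n : nat) : zchar n%:R = cis (2 * pi * n%:R / N%:R).
Proof.
rewrite /zchar val_Zp_nat // [in RHS](divn_eq n N) natrD natrM.
rewrite [X in _ = cis X](_ : _ = 2 * pi * (n %/ N)%:R +
  2 * pi * (n %% N)%:R / N%:R); last by field.
by rewrite cisD cis2pin mul1r.
Qed.

Lemma zcharD (a b : ZN) : zchar (a + b) = zchar a * zchar b.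
Proof.
rewrite -[a in LHS]natr_Zp -[b in LHS]natr_Zp -natrD zchar_nat natrD.
by rewrite /zchar -cisD; congr cis; field.
Qed.

Lemma zchar0 : zchar 0 = 1.
Proof. by rewrite /zchar /= mulr0 mul0r cis0. Qed.

Lemma cabs_zchar (a : ZN) : cabs (zchar a) = 1.
Proof. exact: cabs_cis. Qed.

Lemma zcharN (a : ZN) : zchar (- a) = (zchar a)^*.
Proof.
have h : zchar a * zchar (- a) = 1 by rewrite -zcharD subrr zchar0.
have h2 : zchar a * (zchar a)^* = 1.
  by rewrite -sqr_cabs cabs_zchar expr1n.
have n0 : zchar a != 0.
  by apply/eqP => e; move: h; rewrite e mul0r => /eqP; rewrite eq_sym oner_eq0.
by apply: (mulfI n0); rewrite h h2.
Qed.

Lemma zchar_int (z : int) : zchar z%:~R = cis (2 * pi * z%:~R / N%:R).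
Proof.
case: z => n; first exact: zchar_nat.
rewrite NegzE !mulrNz zcharN mulrN mulNr -conj_cis.
by congr (_^*); exact: zchar_nat.
Qed.

(** [|zchar b - 1|] is a chord of the unit circle and [sin] does not vanish
    inside the half period. *)
Lemma zchar_neq1 (b : ZN) : b != 0 -> zchar b != 1.
Proof.
move=> b0; apply/eqP => h.
have bn0 : (0 < (b : nat))%N by rewrite lt0n.
have bN : ((b : nat) < N)%N by rewrite -[X in (_ < X)%N](Zp_cast N1) ltn_ord.
have : cabs (zchar b - 1) ^+ 2 = 0 by rewrite h subrr cabs0 expr0n.
rewrite sqr_cabs_cisB1 => h2.
have c1 : cos (2 * pi * (b : nat)%:R / N%:R : R) = 1 by lra.
set t := (pi * (b : nat)%:R / N%:R : R).
have te : 2 * pi * (b : nat)%:R / N%:R = t + t :> R by rewrite /t; lra.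
have Npos : (0 < N%:R :> R) by rewrite ltr0n ltnW.
have t0 : 0 < t by rewrite /t divr_gt0 // mulr_gt0 ?pi_gt0 ?ltr0n.
have tpi : t < pi.
  by rewrite /t ltr_pdivrMr // ltr_pM2l ?pi_gt0 // ltr_nat.
have := sin_gt0_pi _ => /(_ R t); rewrite t0 tpi => /(_ isT).
move: c1; rewrite te cosD => c1.
have := cos2Dsin2 t; nra.
Qed.

(** Multiplication by [zchar b] permutes the summands. *)
Lemma zchar_sum (b : ZN) : \sum_(a : ZN) zchar (a * b) = if b == 0 then N%:R else 0.
Proof.
case: eqP => [->|/eqP b0].
  under eq_bigr do rewrite mulr0 zchar0.
  by rewrite sumr_const card_ord /= Zp_cast.
set S := \sum_a _.
have hS : S * zchar b = S.
  rewrite /S mulr_suml [RHS](reindex_inj (addrI 1)).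
  by apply: eq_bigr => a _; rewrite mulrDl mul1r zcharD mulrC.
have : S * (zchar b - 1) = 0 by rewrite mulrBr mulr1 hS subrr.
by move/eqP; rewrite mulf_eq0 subr_eq0 (negbTE (zchar_neq1 b0)) orbF => /eqP.
Qed.

Variable I : finType.
Local Notation G := {ffun I -> ZN}.

Definition gchar (m y : G) : R[i] := \prod_i zchar (m i * y i).

Lemma gcharDl m m' y : gchar (m + m') y = gchar m y * gchar m' y.
Proof.
by rewrite -big_split /=; apply: eq_bigr => i _; rewrite ffunE mulrDl zcharD.
Qed.

Lemma gcharNl m y : gchar (- m) y = (gchar m y)^*.
Proof.
rewrite [RHS]rmorph_prod /=; apply: eq_bigr => i _.
by rewrite ffunE mulNr zcharN.
Qed.

Lemma gchar_sum m : \sum_y gchar m y = if m == 0 then (N ^ #|I|)%:R else 0.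
Proof.
rewrite /gchar -(bigA_distr_bigA (fun i a => zchar (m i * a))) /=.
under eq_bigr do under eq_bigr do rewrite mulrC.
under eq_bigr do rewrite zchar_sum.
case: eqP => [->|/eqP m0].
  by under eq_bigr do rewrite ffunE eqxx; rewrite prodr_const natrX.
have [i mi] : exists i, m i != 0.
  apply/existsP; apply: contraNT m0 => /existsPn h.
  by apply/eqP/ffunP => i; rewrite ffunE; apply/eqP; have := h i; rewrite negbK.
by rewrite (bigD1 i) //= (negbTE mi) mul0r.
Qed.

(** The discrete Fourier transform of [(Z/N)^I]. *)
Definition gdft (M : G -> R[i]) (y : G) : R[i] := \sum_m M m * gchar m y.

Lemma gdft_shift (M : G -> R[i]) a y :
  gdft (fun m => M (m - a)) y = gchar a y * gdft M y.
Proof.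
rewrite /gdft (reindex_inj (addrI a)) /= mulr_sumr; apply: eq_bigr => m _.
by rewrite [a + m]addrC addrK gcharDl; ring.
Qed.

Lemma gdft_inv (M : G -> R[i]) m :
  \sum_y gdft M y * gchar (- m) y = (N ^ #|I|)%:R * M m.
Proof.
rewrite /gdft; under eq_bigr do rewrite mulr_suml.
rewrite exchange_big /= (bigD1 m) //= [X in _ + X]big1 ?addr0.
  under eq_bigr do rewrite -mulrA -gcharDl subrr.
  by rewrite -mulr_sumr gchar_sum eqxx mulrC.
move=> m' m'm; under eq_bigr do rewrite -mulrA -gcharDl.
by rewrite -mulr_sumr gchar_sum subr_eq0 (negbTE m'm) mulr0.
Qed.

Lemma gdft_parseval (M : G -> R[i]) :
  \sum_y cabs (gdft M y) ^+ 2 = (N ^ #|I|)%:R * \sum_m cabs (M m) ^+ 2.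
Proof.
apply: complexI; rewrite rmorphM rmorph_nat !rmorph_sum /=.
under eq_bigr do rewrite sqr_cabs {2}/gdft rmorph_sum mulr_sumr.
rewrite exchange_big /= mulr_sumr; apply: eq_bigr => m _.
have e y : gdft M y * (M m * gchar m y)^* = (M m)^* * (gdft M y * gchar (- m) y).
  by rewrite gcharNl rmorphM /=; ring.
under eq_bigr do rewrite e.
by rewrite -mulr_sumr gdft_inv sqr_cabs; ring.
Qed.

(** Where a multiplier [W] of the transform has modulus at least one, the [L^1]
    size of the transform is controlled by Cauchy-Schwarz and Plancherel. *)
Lemma gdft_box (M M' : G -> R[i]) (W : G -> R[i]) (P : pred G) :
  (forall y, gdft M' y = W y * gdft M y) -> (forall y, P y -> 1 <= cabs (W y)) ->
  (\sum_(y | P y) cabs (gdft M y)) ^+ 2 <=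
    #|P|%:R * ((N ^ #|I|)%:R * \sum_m cabs (M' m) ^+ 2).
Proof.
move=> hW W1.
(* Cauchy-Schwarz, from the square sum of the deviations from the mean *)
have CS (A : pred G) (a : G -> R) : (\sum_(y | A y) a y) ^+ 2 <= #|A|%:R * \sum_(y | A y) a y ^+ 2.
  set S := \sum_(y | A y) a y.
  have [A0|A0] := posnP #|A|.
    by rewrite /S !big_pred0 ?expr0n ?mulr0 // => y; exact: (card0_eq A0 y).
  have A0' : (0 < #|A|%:R :> R) by rewrite ltr0n.
  have : 0 <= \sum_(y | A y) (#|A|%:R * a y - S) ^+ 2 by apply: sumr_ge0 => y _; exact: sqr_ge0.
  have -> : \sum_(y | A y) (#|A|%:R * a y - S) ^+ 2 =
      #|A|%:R * (#|A|%:R * \sum_(y | A y) a y ^+ 2 - S ^+ 2).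
    under eq_bigr do rewrite sqrrB.
    rewrite big_split /= sumrB sumr_const /=.
    under eq_bigr do rewrite exprMn.
    rewrite -mulr_sumr.
    under [X in _ - X + _]eq_bigr do rewrite -mulrnAr.
    have -> : \sum_(i | A i) #|A|%:R * a i * (S *+ 2) = #|A|%:R * S * (S *+ 2).
      by rewrite -mulr_suml -mulr_sumr.
    by ring.
  by rewrite pmulr_rge0 // subr_ge0.
apply: le_trans (CS P _) _; rewrite ler_wpM2l //.
rewrite -gdft_parseval [leRHS](bigID P) /=.
rewrite -[leLHS]addr0 lerD //; last by apply: sumr_ge0 => y _; exact: sqr_ge0.
apply: ler_sum => y Py; rewrite hW cabsM exprMn.
by rewrite ler_peMl ?sqr_ge0 // exprn_ege1 // W1.
Qed.

End cyclic_characters.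

(** * Distance to the origin on a cycle and dyadic shells *)

Section geometric_sums.
Context {R : realType}.
Variable s : R.
Hypothesis s01 : 0 < s < 1.

Lemma geometric_sum_le J : \sum_(j < J) s ^+ j <= (1 - s)^-1.
Proof.
have /andP[s0 s1] := s01; have h := subrX1 s J.
rewrite -[leRHS]mul1r ler_pdivlMr ?subr_gt0 //.
have : 0 <= s ^+ J by rewrite exprn_ge0 // ltW.
by move: h; move: (\sum_(i < J) _) => S; lra.
Qed.

Lemma geometric_sum_rev_le L : \sum_(k < L.+1) s ^+ (L - k) <= (1 - s)^-1.
Proof.
rewrite (reindex_inj rev_ord_inj) /= (eq_bigr (fun k : 'I_L.+1 => s ^+ k)).
  exact: geometric_sum_le.
by move=> k _; rewrite subSS subKn // -ltnS.
Qed.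

End geometric_sums.

Section cyclic_distance.
Context {R : realType}.
Variable N : nat.
Hypothesis N1 : (1 < N)%N.
Local Notation ZN := 'Z_N.

(** The absolute value of [a] as a residue modulo [N]. *)
Definition zrho (a : ZN) : nat := minn a (N - a).

Let ltN (a : ZN) : (a < N)%N.
Proof. by rewrite -[X in (_ < X)%N](Zp_cast N1) ltn_ord. Qed.

Lemma zrhoN (a : ZN) : zrho (- a) = zrho a.
Proof.
rewrite /zrho /=; have := ltN a; move: (a : nat) => {}a; rewrite Zp_cast //.
case: (posnP a) => [->|a0] aN; first by rewrite subn0 modnn; lia.
by rewrite modn_small; lia.
Qed.

Lemma zrhoD (a b : ZN) : (zrho (a + b)%R <= zrho a + zrho b)%N.
Proof.
rewrite /zrho /=; have := ltN a; have := ltN b.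
move: (a : nat) (b : nat) => {}a {}b; rewrite Zp_cast // => bN aN.
have [h|h] := ltnP (a + b) N; first by rewrite modn_small; lia.
by rewrite -(subnK h) modnDr modn_small; lia.
Qed.

Lemma zrhoB (a b : ZN) :
  (zrho (a - b)%R <= zrho a + zrho b)%N /\ (zrho a <= zrho (a - b)%R + zrho b)%N.
Proof. by split; [rewrite -(zrhoN b)|rewrite -{1}(subrK b a)]; exact: zrhoD. Qed.

Lemma zrho_nat n : (n.*2 <= N)%N -> zrho n%:R = n.
Proof. by move=> h; rewrite /zrho val_Zp_nat // modn_small; lia. Qed.

Lemma zrho_int (z : int) : (`|z|.*2 <= N)%N -> zrho z%:~R = `|z|%N.
Proof.
case: z => n h; first exact: zrho_nat.
by rewrite NegzE mulrNz zrhoN; apply: zrho_nat.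
Qed.

Lemma zrho_le_nat n : (zrho n%:R <= n)%N.
Proof. by rewrite /zrho val_Zp_nat // geq_min leq_mod. Qed.

Lemma zrho_shift (a : ZN) h :
  (zrho (a - h%:R)%R <= zrho a + h)%N /\ (zrho a <= zrho (a - h%:R)%R + h)%N.
Proof.
have [h1 h2] := zrhoB a h%:R; have h3 := zrho_le_nat h.
by split; [apply: leq_trans h1 _|apply: leq_trans h2 _]; rewrite leq_add2l.
Qed.

Lemma zrho_half (a : ZN) : ((zrho a).*2 <= N)%N.
Proof. by rewrite /zrho; have := ltN a; lia. Qed.

Lemma zrho_repr (a : ZN) : exists e : bool, a = (-1) ^+ e * (zrho a)%:R.
Proof.
have aN := ltN a; rewrite /zrho; have [h|h] := leqP a (N - a).
  by exists false; rewrite expr0 mul1r natr_Zp.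
exists true; rewrite expr1 mulN1r natrB 1?ltnW // pchar_Zp //.
by rewrite sub0r opprK natr_Zp.
Qed.

(** A residue is determined by its absolute value and a sign. *)
Lemma card_zrho_near c r :
  (#|[pred a : ZN | (zrho a <= c + r) && (c <= zrho a + r)]| <= 2 * (2 * r + 1))%N.
Proof.
pose f (x : bool * 'I_(2 * r + 1)) : ZN := (-1) ^+ x.1 * (x.2 + c - r)%:R.
have -> : (2 * (2 * r + 1) = #|{: bool * 'I_(2 * r + 1)}|)%N.
  by rewrite card_prod card_bool card_ord.
apply: leq_trans (leq_image_card f _).
apply: subset_leq_card; apply/fintype.subsetP => a; rewrite inE => /andP[h1 h2].
have [e ae] := zrho_repr a.
have hlt : (zrho a + r - c < 2 * r + 1)%N by lia.
apply/fintype.imageP; exists (e, Ordinal hlt) => //.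
rewrite /f /= ae; congr (_ * _%:R).
have [e' ae'] := zrho_repr a; rewrite -ae; lia.
Qed.

Lemma cos_zrho (k : nat) (a : ZN) :
  complex.Re (zchar (k%:R * a)) = cos (2 * pi * (k * zrho a)%:R / N%:R) :> R.
Proof.
have [e ae] := zrho_repr a; rewrite {1}ae.
have -> : k%:R * ((-1) ^+ e * (zrho a)%:R) = (-1) ^+ e * (k * zrho a)%:R :> ZN.
  by rewrite natrM; ring.
case: e {ae}; rewrite ?expr1 ?expr0 ?mul1r ?mulN1r.
  by rewrite zcharN // zchar_nat.
by rewrite zchar_nat.
Qed.

End cyclic_distance.

Section dyadic_shells.
Context {R : realType}.
Variables (p L : nat).
Hypothesis Lp : (L + 2 <= p)%N.
Local Notation N := (2 ^ p)%N.
Local Notation ZN := 'Z_N.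

Lemma expn2_gt1 : (1 < N)%N.
Proof. by rewrite -{1}(expn0 2) ltn_exp2l //; lia. Qed.

(** Shell [l < L] holds the points at distance about [2^(-l)] times the
    period; a shift of the frequency by [2^l] then turns by at least a quarter
    of a circle.  Shell [L] is the remaining core. *)
Definition shell (l : nat) (a : ZN) : bool :=
  (zrho a <= 2 ^ (p - l - 1))%N && ((l < L)%N ==> (2 ^ (p - l - 2) < zrho a)%N).

Lemma shell_ex (a : ZN) : exists l : 'I_L.+1, shell l a.
Proof.
have h0 : (zrho a <= 2 ^ (p - 0 - 1))%N.
  have := zrho_half expn2_gt1 a.
  have : (2 ^ (p - 0 - 1) * 2 = N)%N by rewrite -expnSr; congr (2 ^ _)%N; lia.
  by move: (zrho a) => r <-; lia.
suff : forall k l, (l + k = L)%N -> (zrho a <= 2 ^ (p - l - 1))%N ->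
    exists l : 'I_L.+1, shell l a.
  by move=> /(_ L 0%N); rewrite add0n => /(_ erefl h0).
elim=> [|k IH] l.
  rewrite addn0 => -> h; exists ord_max; rewrite /shell /= h ltnn //.
move=> lk h; case: (leqP (zrho a) (2 ^ (p - l - 2))) => h2.
  apply: (IH l.+1); first by lia.
  by rewrite (_ : p - l.+1 - 1 = p - l - 2)%N //; lia.
have lL : (l < L.+1)%N by lia.
by exists (Ordinal lL); rewrite /shell /= h h2 implybT.
Qed.

(** On the shell the angle [2^l a] lies in the half circle of nonpositive
    cosine, so the chord is even at least [sqrt 2]. *)
Lemma shell_weight l (a : ZN) : (l < L)%N -> shell l a ->
  1 <= cabs (zchar ((2 ^ l)%:R * a) - 1 : R[i]).
Proof.
move=> lL /andP[h1]; rewrite lL /= => h2.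
have c0 : cos (2 * pi * (2 ^ l * zrho a)%:R / N%:R) <= 0 :> R.
  have e1 : (2 ^ l * 2 ^ (p - l - 1) * 2 = N)%N.
    by rewrite -expnD -expnSr; congr (2 ^ _)%N; lia.
  have e2 : (2 ^ l * 2 ^ (p - l - 2) * 4 = N)%N.
    by rewrite -expnD (_ : 4 = 2 ^ 2)%N // -expnD; congr (2 ^ _)%N; lia.
  move: (zrho a) h1 h2 => r h1 h2.
  have u1 : (2 ^ l * r * 2 <= N)%N by rewrite -e1 leq_pmul2r // leq_pmul2l ?expn_gt0.
  have u2 : (N <= 2 ^ l * r * 4)%N by rewrite -e2 leq_pmul2r // leq_pmul2l ?expn_gt0 // ltnW.
  move: u1 u2; move: (2 ^ l * r)%N => m u1 u2.
  have Np : 0 < N%:R :> R by rewrite ltr0n expn_gt0.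
  have v1 : m%:R / N%:R <= 2^-1 :> R.
    by rewrite ler_pdivrMr // mulrC ler_pdivlMr // -natrM ler_nat.
  have v2 : 4^-1 <= m%:R / N%:R :> R.
    by rewrite ler_pdivlMr // mulrC ler_pdivrMr // -natrM ler_nat.
  rewrite -mulrA; move: v1 v2; set t := _ / _ => v1 v2.
  have pp := @pi_gt0 R.
  have -> : 2 * pi * t = (2 * pi * t - pi / 2) + pi / 2 by ring.
  rewrite cosDpihalf oppr_le0; apply: sin_ge0_pi; nra.
have sq : 1 <= cabs (zchar ((2 ^ l)%:R * a) - 1 : R[i]) ^+ 2.
  have := @cos_zrho R _ expn2_gt1 (2 ^ l) a; rewrite /zchar sqr_cabs_cisB1 /= => ->.
  lra.
have := cabs_ge0 (zchar ((2 ^ l)%:R * a) - 1 : R[i]); nra.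
Qed.

Lemma card_zrho_le l : (l <= L)%N ->
  (#|[pred a : ZN | zrho a <= 2 ^ (p - l - 1)]| <= 2 ^ (p - l + 2))%N.
Proof.
move=> lL; apply: leq_trans (_ : _ <= 2 * (2 * 2 ^ (p - l - 1) + 1))%N _.
  apply: leq_trans (card_zrho_near expn2_gt1 0 (2 ^ (p - l - 1))).
  by apply: subset_leq_card; apply/fintype.subsetP => a; rewrite !inE add0n leq0n andbT.
have h : (0 < 2 ^ (p - l - 1))%N by rewrite expn_gt0.
rewrite (_ : p - l + 2 = (p - l - 1) + 3)%N; last by lia.
by rewrite expnD; lia.
Qed.

Lemma card_shell l : (l <= L)%N -> (#|[pred a : ZN | shell l a]| <= 2 ^ (p - l + 2))%N.
Proof.
move=> lL; apply: leq_trans (card_zrho_le lL).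
by apply: subset_leq_card; apply/fintype.subsetP => a; rewrite !inE => /andP[].
Qed.

End dyadic_shells.

(** * Kernels of profiles of the largest coordinate *)

(** If [x] stays below [c] and [a] above [b] up to errors that do not close the
    gap between them, the maximum forgets [x]. *)
Lemma maxn_absorb x a b b' c P Q : (c + 2 * Q < b)%N -> (b <= b' + Q)%N ->
  (x <= c + P)%N -> (P <= Q)%N -> (b' <= a)%N -> maxn x a = a.
Proof. lia. Qed.

Section max_profile.
Context {R : realType}.
Variables (p L : nat).
Hypothesis Lp : (L + 2 <= p)%N.
Local Notation N := (2 ^ p)%N.
Local Notation ZN := 'Z_N.
Variable I : finType.
Local Notation G := {ffun I -> ZN}.
Let N1 : (1 < N)%N := expn2_gt1 Lp.

Variables (u : nat -> R) (A s : R).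
Hypothesis u_mono : forall a b, (a <= b)%N -> u b <= u a.
Hypothesis u_ge0 : forall a, 0 <= u a.
Hypothesis u_le1 : forall a, u a <= 1.
Hypothesis u_supp : forall a, (2 ^ L <= a)%N -> u a = 0.
Hypothesis A0 : 0 <= A.
Hypothesis s01 : 0 < s < 1.
Local Notation r := (s ^+ #|I|).
Hypothesis u_hoelder : forall a l, (l <= L)%N ->
  u a - u (a + 2 ^ l)%N <= A * r ^+ (2 * (L - l)).

Let s0 : 0 < s. Proof. by case/andP: s01. Qed.
Let r0 : 0 < r. Proof. exact: exprn_gt0. Qed.

Lemma u_dist a b l : (l <= L)%N -> (a <= b + 2 ^ l)%N -> (b <= a + 2 ^ l)%N ->
  `|u a - u b| <= A * r ^+ (2 * (L - l)).
Proof.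
wlog ab : a b / (a <= b)%N => [H lL h1 h2|lL h1 h2].
  have [ab|ab] := leqP a b; first exact: H.
  by rewrite distrC; apply: H => //; exact: ltnW.
rewrite ger0_norm ?subr_ge0 ?u_mono //.
apply: le_trans (u_hoelder a lL); rewrite lerB // u_mono //.
Qed.

Local Notation v := (fun a : ZN => u (zrho a)).

Let w k := u k - u k.+1.
Let w0 k : 0 <= w k. Proof. by rewrite subr_ge0 u_mono. Qed.

(** The steps of a monotone function telescope on each half of the cycle. *)
Lemma sum_profile_steps : \sum_(a : ZN) w (zrho a) <= 2.
Proof.
have tele (m : nat) : \sum_(k < m) w k = u 0%N - u m.
  elim: m => [|m IH]; first by rewrite big_ord0 subrr.
  by rewrite big_ord_recr /= IH /w addrA subrK.
have lew (m : nat) : \sum_(k < m) w k <= 1.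
  by rewrite tele; have := u_ge0 m; have := u_le1 0%N; lra.
apply: le_trans (_ : \sum_(a : ZN) (w a + w (N - a)%N) <= _).
  apply: ler_sum => a _; rewrite /zrho; case: (leqP a (N - a)) => _.
    by rewrite lerDl.
  by rewrite lerDr.
rewrite big_split /= [X in _ <= X](_ : 2 = 1 + 1 :> R) //.
apply: lerD; first exact: lew.
apply: le_trans (lew N.+1); rewrite (reindex_inj rev_ord_inj) /=.
have e : (Zp_trunc N).+2 = N by rewrite Zp_cast.
rewrite [leLHS](_ : _ = \sum_(k < N) w k.+1).
  by rewrite [leRHS]big_ord_recl /= lerDr.
rewrite -[in RHS]e; apply: eq_bigr => i _; congr w.
have := ltn_ord i; rewrite [X in (_ < X)%N -> _]e => h.
rewrite -{1}e; lia.
Qed.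

Lemma profile_variation h : \sum_(a : ZN) `|v (a - h%:R) - v a| <= 4 * h%:R.
Proof.
have one : \sum_(a : ZN) `|v (a - 1) - v a| <= 4.
  apply: le_trans (_ : \sum_(a : ZN) (w (zrho (a - 1)) + w (zrho a)) <= _).
    apply: ler_sum => a _.
    have [] := zrho_shift N1 a 1; move: (zrho a) (zrho (a - 1)) => x y e1 e2.
    have [xy|xy] := leqP x y.
      rewrite distrC ger0_norm ?subr_ge0 ?u_mono //.
      apply: le_trans (_ : w x <= _); last by rewrite lerDr.
      by rewrite /w lerB // u_mono //; lia.
    rewrite ger0_norm ?subr_ge0 ?u_mono // 1?ltnW //.
    apply: le_trans (_ : w y <= _); last by rewrite lerDl.
    by rewrite /w lerB // u_mono //; lia.
  rewrite big_split /= -(reindex_inj (addIr (-1)) (P := predT) (F := fun a => w (zrho a))) /=.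
  by have := sum_profile_steps; lra.
elim: h => [|h IH].
  by rewrite big1 ?mulr0 // => a _; rewrite subr0 subrr normr0.
apply: le_trans (_ : \sum_(a : ZN) (`|v (a - h%:R - 1) - v (a - h%:R)| + `|v (a - h%:R) - v a|) <= _).
  apply: ler_sum => a _; rewrite -natr1 opprD addrA.
  exact: ler_distD.
rewrite big_split /= -(reindex_inj (addIr (- h%:R)) (P := predT) (F := fun a => `|v (a - 1) - v a|)) /=.
rewrite [X in 4 * X](_ : _ = h%:R + 1); last by rewrite natr1.
by rewrite mulrDr mulr1 addrC lerD.
Qed.

Definition max_profile (m : G) : R := u (\max_i zrho (m i)).

Section mixed.
Variable l : {ffun I -> 'I_L.+1}.

Definition dshift (e : {ffun I -> bool}) : G :=
  [ffun i => if e i then (2 ^ l i)%:R else 0].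
Definition dsign (i : I) (b : bool) : R :=
  if b then (if (l i < L)%N then -1 else 0) else 1.
(** The composition over the directions [i] outside the core of the differences
    [M m - M (m - 2^(l i) e_i)], expanded; [dsign i true = 0] switches the
    shift off in the core directions. *)
Definition mixed_diff (M : G -> R) (m : G) : R :=
  \sum_(e : {ffun I -> bool}) (\prod_i dsign i (e i)) * M (m - dshift e).

Definition mixed_weight (y : G) : R[i] :=
  \prod_i (if (l i < L)%N then 1 - zchar ((2 ^ l i)%:R * y i) else 1).

Lemma gdft_mixed_diff M y :
  gdft (fun m => (mixed_diff M m)%:C) y = mixed_weight y * gdft (fun m => (M m)%:C) y.
Proof.
rewrite {1}/gdft; under eq_bigr do rewrite rmorph_sum mulr_suml.
rewrite exchange_big /=.
have -> : mixed_weight y = \prod_i \sum_(b : bool) (dsign i b)%:C *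
   (if b then zchar ((2 ^ l i)%:R * y i) else 1).
  apply: eq_bigr => i _; rewrite big_bool /dsign /=.
  case: ifP => _; rewrite ?rmorphN ?rmorph1 ?rmorph0 ?mul0r ?add0r ?mulr1 //.
  by rewrite mulN1r addrC.
rewrite bigA_distr_bigA /= mulr_suml; apply: eq_bigr => e _.
under eq_bigr do rewrite rmorphM /= -mulrA.
rewrite -mulr_sumr -/(gdft (fun m => (M (m - dshift e))%:C) y).
rewrite (gdft_shift N1 (fun m => (M m)%:C)) mulrA; congr (_ * _).
rewrite big_split /= rmorph_prod /=; congr (_ * _).
apply: eq_bigr => i _; rewrite ffunE; case: ifP => // _.
by rewrite mul0r zchar0.
Qed.

Lemma mixed_weight_ge1 (y : G) : (forall i, shell L (l i) (y i)) -> 1 <= cabs (mixed_weight y).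
Proof.
move=> h; rewrite cabs_prod.
elim/big_ind : _ => // [x z x1 z1|i _]; first by nra.
case: ifP => [li|_]; last by rewrite cabs_real normr1.
by rewrite -cabsN opprB; apply: (shell_weight Lp).
Qed.

Definition flip (i : I) (e : {ffun I -> bool}) : {ffun I -> bool} :=
  [ffun j => if j == i then ~~ e j else e j].

Lemma flipK i : involutive (flip i).
Proof. by move=> e; apply/ffunP => j; rewrite !ffunE; case: eqP; rewrite ?negbK. Qed.

Lemma dsign_le1 e : `|\prod_i dsign i (e i)| <= 1.
Proof.
rewrite normr_prod; apply: prodr_ile1 => i _; rewrite normr_ge0 /=.
by rewrite /dsign; case: (e i); case: (ltnP (l i) L) => _; rewrite ?normrN ?normr1 ?normr0.
Qed.

(** Pairing the terms that differ only in direction [i] reduces the mixed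
    difference to first differences in that direction. *)
Lemma mixed_diff_le M m i b : (l i < L)%N ->
  (forall e, `|M (m - dshift e) - M (m - dshift (flip i e))| <= b) ->
  `|mixed_diff M m| <= 2 ^+ #|I| * b.
Proof.
move=> li hb.
set F := fun e : {ffun I -> bool} => (\prod_i dsign i (e i)) * M (m - dshift e).
have e2 : mixed_diff M m *+ 2 = \sum_e (F e + F (flip i e)).
  by rewrite big_split /= -(reindex_inj (inv_inj (flipK i)) (P := predT) (F := F)) mulr2n.
have hF e : `|F e + F (flip i e)| <= b.
  rewrite /F [X in _ + X * _](_ : _ = - \prod_i dsign i (e i)).
    rewrite mulNr -mulrBr normrM.
    rewrite -[leRHS]mul1r ler_pM //; exact: dsign_le1.
  rewrite (bigD1 i) //= [in RHS](bigD1 i) //= -mulNr; congr (_ * _).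
    by rewrite ffunE eqxx /dsign li; case: (e i); rewrite //= opprK.
  by apply: eq_bigr => j ji; rewrite ffunE (negbTE ji).
have b0 : 0 <= b by apply: le_trans (hF [ffun => false]); exact: normr_ge0.
have : `|mixed_diff M m *+ 2| <= 2 ^+ #|I| * b.
  rewrite e2; apply: le_trans (ler_norm_sum _ _ _) _.
  apply: le_trans (ler_sum _ (fun e _ => hF e)) _.
  by rewrite sumr_const card_ffun card_bool -[leLHS]mulr_natl natrX.
rewrite normrMn; have := normr_ge0 (mixed_diff M m); lra.
Qed.

Lemma mixed_diff_trivial M m : (forall e, `|M (m - dshift e)| <= 1) ->
  `|mixed_diff M m| <= 2 ^+ #|I|.
Proof.
move=> hM; apply: le_trans (ler_norm_sum _ _ _) _.
apply: le_trans (_ : \sum_(e : {ffun I -> bool}) 1 <= _).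
  apply: ler_sum => e _; rewrite normrM.
  by rewrite -[leRHS]mul1r ler_pM //; exact: dsign_le1.
by rewrite sumr_const card_ffun card_bool natrX.
Qed.

Lemma zrho_dshift m e j :
  (zrho ((m - dshift e) j)%R <= zrho (m j) + 2 ^ l j)%N /\
  (zrho (m j) <= zrho ((m - dshift e) j)%R + 2 ^ l j)%N.
Proof.
have hd : (zrho (dshift e j) <= 2 ^ l j)%N.
  by rewrite ffunE; case: ifP => _; [exact: (zrho_le_nat N1)|rewrite /zrho /= min0n].
have -> : (m - dshift e) j = m j - dshift e j by rewrite !ffunE.
have [h1 h2] := zrhoB N1 (m j) (dshift e j).
by split; [apply: leq_trans h1 _|apply: leq_trans h2 _]; rewrite leq_add2l.
Qed.

Lemma max_profile_flip (i : I) (m : G) (e : {ffun I -> bool}) :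
  let x := zrho ((m - dshift e) i) in let x' := zrho ((m - dshift (flip i e)) i) in
  exists2 a, a = (\max_(j | j != i) zrho ((m - dshift e)%R j))%N &
   max_profile (m - dshift e) = u (maxn x a) /\
   max_profile (m - dshift (flip i e)) = u (maxn x' a).
Proof.
move=> x x'; exists (\max_(j | j != i) zrho ((m - dshift e)%R j))%N => //.
rewrite /max_profile (bigD1 i) //= [in X in _ /\ X](bigD1 i) //=; split => //.
congr (u (maxn _ _)); apply: eq_bigr => j ji.
by rewrite !ffunE (negbTE ji).
Qed.

Variable i0 : I.
Hypothesis i0min : forall j, (l i0 <= l j)%N.

Definition near (a : ZN) (j : I) (b : ZN) : bool :=
  (zrho b <= zrho a + 2 * 2 ^ l j)%N && (zrho a <= zrho b + 2 * 2 ^ l j)%N.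

(** In the core there is no difference to exploit and the support is kept. *)
Definition first_diff (a : ZN) : R :=
  if (l i0 < L)%N then `|v (a - (2 ^ l i0)%:R) - v a| else (zrho a <= 2 * 2 ^ L)%N%:R.

Lemma first_diff_ge0 a : 0 <= first_diff a.
Proof. by rewrite /first_diff; case: ifP. Qed.

(** The maximum depends on direction [j] only where [m j] is about the largest
    coordinate, so the mixed difference lives where all coordinates agree in
    modulus up to their steps; there the finest difference bounds it, since
    taking a maximum is a contraction. *)
Lemma mixed_diff_max_profile m :
  `|mixed_diff max_profile m| <=
    2 ^+ #|I| * ([forall j, near (m i0) j (m j)]%:R * first_diff (m i0)).
Proof.
have hp (j : I) : (2 ^ l i0 <= 2 ^ l j)%N by rewrite leq_exp2l.
have hP (j : I) : (2 ^ l j <= 2 ^ L)%N by rewrite leq_exp2l // -ltnS.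
have M0 (m' : G) i : (2 ^ L <= zrho (m' i))%N -> max_profile m' = 0.
  move=> h; apply: u_supp; apply: leq_trans h _; exact: leq_bigmax.
have M1 (m' : G) : `|max_profile m'| <= 1 by rewrite ger0_norm ?u_ge0 ?u_le1.
have D0 : (forall e, max_profile (m - dshift e) = 0) -> mixed_diff max_profile m = 0.
  by move=> h; rewrite /mixed_diff big1 // => e _; rewrite h mulr0.
have hbig j e : (2 * 2 ^ L < zrho (m j))%N -> (2 ^ L <= zrho ((m - dshift e)%R j))%N.
  move=> h; have [_ h2] := zrho_dshift m e j.
  rewrite -(leq_add2r (2 ^ L)) addnn -mul2n; apply: leq_trans (ltnW h) _.
  by apply: leq_trans h2 _; rewrite leq_add2l.
case: (boolP [forall j, near (m i0) j (m j)]) => [_|].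
  rewrite mul1r /first_diff; case: ifP => li0.
    apply: (@mixed_diff_le _ _ i0) => // e.
    have [a _ [-> ->]] := max_profile_flip i0 m e.
    have lip x y : `|u (maxn x a) - u (maxn y a)| <= `|u x - u y|.
      wlog xy : x y / (x <= y)%N.
        move=> H; case: (leqP x y) => [|/ltnW] h; first exact: H.
        by rewrite distrC [leRHS]distrC; exact: H.
      rewrite !ger0_norm ?subr_ge0 ?u_mono //; last by lia.
      case: (leqP a x) => h1.
        by rewrite !(elimT maxn_idPl) //; lia.
      case: (leqP a y) => h2; first by rewrite lerB // u_mono // ltnW.
      by rewrite subrr subr_ge0 u_mono.
    apply: le_trans (lip _ _) _; rewrite !ffunE eqxx.
    by case: (e i0); rewrite /= subr0 // distrC.
  have e0 : l i0 = L :> nat by have := ltn_ord (l i0); move/negbT: li0; lia.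
  case: (leqP (zrho (m i0)) (2 * 2 ^ L)) => h /=.
    by rewrite mulr1; apply: mixed_diff_trivial.
  rewrite mulr0 D0 ?normr0 // => e; apply: (M0 _ i0).
  exact: hbig.
rewrite negb_forall => /existsP[j]; rewrite negb_and -!ltnNge => nj.
rewrite mul0r mulr0.
suff -> : mixed_diff max_profile m = 0 by rewrite normr0.
case: (ltnP (l i0) L) => li0; last first.
  have e0 : l i0 = L :> nat by have := ltn_ord (l i0); lia.
  have ej : l j = L :> nat by have := ltn_ord (l j); have := i0min j; lia.
  rewrite ej in nj; apply: D0 => e; case/orP: nj => h.
    by apply: (M0 _ j); apply: hbig; apply: leq_ltn_trans h; exact: leq_addl.
  by apply: (M0 _ i0); apply: hbig; apply: leq_ltn_trans h; exact: leq_addl.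
have ji0 : j != i0 by apply/eqP => e; move: nj; rewrite e; lia.
case/orP: nj => h.
  apply/eqP; rewrite -normr_le0 -[leRHS](mulr0 (2 ^+ #|I|)).
  apply: (@mixed_diff_le _ _ i0) => // e.
  have [a ae [-> ->]] := max_profile_flip i0 m e.
  have aj : (zrho ((m - dshift e)%R j) <= a)%N.
    by rewrite ae (bigD1 j) //= leq_maxl.
  have [_ h1] := zrho_dshift m e j; have [h2 _] := zrho_dshift m e i0.
  have [h3 _] := zrho_dshift m (flip i0 e) i0; have := hp j => h4.
  rewrite (maxn_absorb h h1 h2 h4 aj) (maxn_absorb h h1 h3 h4 aj).
  by rewrite subrr normr0.
case: (ltnP (l j) L) => lj.
  apply/eqP; rewrite -normr_le0 -[leRHS](mulr0 (2 ^+ #|I|)).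
  apply: (@mixed_diff_le _ _ j) => // e.
  have [a ae [-> ->]] := max_profile_flip j m e.
  have aj : (zrho ((m - dshift e)%R i0) <= a)%N.
    by rewrite ae (bigD1 i0) ?leq_maxl // eq_sym.
  have [h1 _] := zrho_dshift m e j; have [_ h2] := zrho_dshift m e i0.
  have [h3 _] := zrho_dshift m (flip j e) j; have h4 := leqnn (2 ^ l j).
  have {}h2 := leq_trans h2 (leq_add (leqnn _) (hp j)).
  rewrite (maxn_absorb h h2 h1 h4 aj) (maxn_absorb h h2 h3 h4 aj).
  by rewrite subrr normr0.
have ej : l j = L :> nat by have := ltn_ord (l j); lia.
rewrite ej in h; apply: D0 => e; apply: (M0 _ i0).
by apply: hbig; apply: leq_ltn_trans h; exact: leq_addl.
Qed.

(** One factor of the square is bounded by the modulus of continuity, the other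
    one sums to a total variation. *)
Lemma sum_sqr_first_diff :
  \sum_a first_diff a ^+ 2 <= (4 * A + 10) * (2 ^ l i0)%:R * r ^+ (2 * (L - l i0)).
Proof.
have lL : (l i0 <= L)%N by rewrite -ltnS.
have rk : 0 <= r ^+ (2 * (L - l i0)) by rewrite exprn_ge0 // ltW.
rewrite /first_diff; case: (ltnP (l i0) L) => li0.
  apply: le_trans (_ : \sum_(a : ZN) A * r ^+ (2 * (L - l i0)) * `|v (a - (2 ^ l i0)%:R) - v a| <= _).
    apply: ler_sum => a _; rewrite expr2 ler_wpM2r //.
    by have [h1 h2] := zrho_shift N1 a (2 ^ l i0); exact: u_dist.
  rewrite -mulr_sumr; have := profile_variation (2 ^ l i0).
  move: (\sum_(a : ZN) _) => S; move: (2 ^ l i0)%N => h hS.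
  apply: le_trans (_ : A * r ^+ (2 * (L - l i0)) * (4 * h%:R) <= _).
    by rewrite ler_wpM2l // mulr_ge0.
  have h0 : 0 <= h%:R :> R by [].
  have : 0 <= h%:R * r ^+ (2 * (L - l i0)) by rewrite mulr_ge0.
  lra.
have e0 : l i0 = L :> nat by have := ltn_ord (l i0); lia.
rewrite e0 subnn muln0 expr0 mulr1.
apply: le_trans (_ : (10 * 2 ^ L)%:R <= _); last first.
  by rewrite natrM ler_wpM2r // lerDr mulr_ge0.
under eq_bigr do rewrite expr2 -natrM mulnb andbb.
rewrite -natr_sum ler_nat.
apply: leq_trans (_ : _ <= #|[pred a : ZN | zrho a <= 2 * 2 ^ L]|)%N _.
  rewrite -sum1_card [leqRHS]big_mkcond /=; apply: leq_sum => a _.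
  by rewrite inE; case: ifP.
apply: leq_trans (_ : _ <= 2 * (2 * (2 * 2 ^ L) + 1))%N _; last first.
  by have : (0 < 2 ^ L)%N; [rewrite expn_gt0|lia].
apply: leq_trans (card_zrho_near N1 0 (2 * 2 ^ L)).
by apply: subset_leq_card; apply/fintype.subsetP => a; rewrite !inE add0n leq0n andbT.
Qed.

(** Given the coordinate [i0] of finest step, each other coordinate [j] is
    confined to about [2^(l j)] values. *)
Lemma sum_sqr_mixed_diff :
  \sum_m mixed_diff max_profile m ^+ 2 <=
   (4 * A + 10) * 40 ^+ #|I| * (\prod_i (2 ^ l i)%:R) * r ^+ (2 * (L - l i0)).
Proof.
apply: le_trans (_ : \sum_(m : G) 4 ^+ #|I| *
   ([forall j, near (m i0) j (m j)]%:R * first_diff (m i0) ^+ 2) <= _).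
  apply: ler_sum => m _; rewrite -real_normK ?num_real //.
  have := mixed_diff_max_profile m => h.
  apply: le_trans (_ : (2 ^+ #|I| * ([forall j, near (m i0) j (m j)]%:R * first_diff (m i0))) ^+ 2 <= _).
    by rewrite ler_sqr // nnegrE // !mulr_ge0 // ?exprn_ge0 // first_diff_ge0.
  rewrite !exprMn -exprM mulnC exprM; rewrite (_ : 2 ^+ 2 = 4 :> R); last by ring.
  by rewrite [X in _ * (X * _)]expr2 -natrM mulnb andbb.
rewrite -mulr_sumr (partition_big (fun m : G => m i0) predT) //=.
have cnt a : \sum_(m : G | m i0 == a) [forall j, near (m i0) j (m j)]%:R * first_diff (m i0) ^+ 2
   <= (\prod_(j | j != i0) (10 * 2 ^ l j)%:R) * first_diff a ^+ 2.
  rewrite (eq_bigr (fun m : G => [forall j, near (m i0) j (m j)]%:R * first_diff a ^+ 2)); last by move=> m /eqP ->.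
  rewrite -mulr_suml ler_wpM2r ?sqr_ge0 //.
  pose F (j : I) : {pred ZN} := [pred b | near a j b && ((j == i0) ==> (b == a))].
  rewrite [leLHS](_ : _ = #|family F|%:R); last first.
    rewrite -natr_sum; congr _%:R; rewrite -sum1_card big_mkcond /= [RHS]big_mkcond /=.
    apply: eq_bigr => m _; case: eqP => ma.
      congr nat_of_bool; apply/forallP/familyP => h j; have := h j; rewrite inE.
        by rewrite ma => ->; case: eqP => //= ->; rewrite ma eqxx.
      by case/andP; rewrite ma.
    case: ifP => // /familyP /(_ i0); rewrite inE eqxx /= => /andP[_ /eqP e].
    by case: ma.
  rewrite card_family foldrE big_map big_enum /= (bigD1 i0) //= natrM.
  have -> : \prod_(j | j != i0) (10 * 2 ^ l j)%:R = 1 * (\prod_(j | j != i0) (10 * 2 ^ l j))%N%:R :> R.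
    by rewrite mul1r natr_prod.
  rewrite ler_pM ?ler_nat // ?ler1n.
    rewrite (ler_nat _ _ 1) -[X in (_ <= X)%N](card1 a).
    by apply: subset_leq_card; apply/fintype.subsetP => b; rewrite !inE eqxx /= => /andP[_].
  apply: leq_prod => j _.
  apply: leq_trans (_ : _ <= 2 * (2 * (2 * 2 ^ l j) + 1))%N _; last first.
    by have : (0 < 2 ^ l j)%N; [rewrite expn_gt0|lia].
  apply: leq_trans (card_zrho_near N1 (zrho a) (2 * 2 ^ l j)).
  by apply: subset_leq_card; apply/fintype.subsetP => b; rewrite !inE => /andP[].
have P0 : 0 <= \prod_(j | j != i0) (10 * 2 ^ l j)%:R :> R by apply: prodr_ge0.
apply: le_trans (_ : 4 ^+ #|I| * ((\prod_(j | j != i0) (10 * 2 ^ l j)%:R) *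
    ((4 * A + 10) * (2 ^ l i0)%:R * r ^+ (2 * (L - l i0)))) <= _).
  rewrite ler_wpM2l ?exprn_ge0 //.
  apply: le_trans (ler_sum _ (fun a _ => cnt a)) _.
  rewrite -mulr_sumr ler_wpM2l //; exact: sum_sqr_first_diff.
have e40 : (40 : R) ^+ #|I| = 4 ^+ #|I| * 10 ^+ #|I| by rewrite -exprMn; congr (_ ^+ _); ring.
have ep : (10 : R) ^+ #|I| * (\prod_i (2 ^ l i)%:R) = \prod_i (10 * 2 ^ l i)%:R.
  rewrite -prodr_const -big_split /=; apply: eq_bigr => i _; by rewrite natrM.
rewrite e40.
rewrite [leRHS](_ : _ = 4 ^+ #|I| * ((10 ^+ #|I| * (\prod_i (2 ^ l i)%:R)) * ((4 * A + 10) * r ^+ (2 * (L - l i0))))); last by ring.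
rewrite ler_wpM2l ?exprn_ge0 // ep [X in _ <= X * _](bigD1 i0) //=.
rewrite natrM.
move: P0; set Q := \prod_(j | j != i0) _; move=> Q0.
have : 0 <= (4 * A + 10) * (2 ^ l i0)%:R * r ^+ (2 * (L - l i0)).
  by rewrite !mulr_ge0 // ?addr_ge0 ?mulr_ge0 // exprn_ge0 // ltW.
set X := _ * _ * _ => X0.
rewrite [leRHS](_ : _ = 10 * (Q * X)); last by rewrite /X; ring.
by rewrite ler_peMl ?ler1n // mulr_ge0.
Qed.

End mixed.

(** Summing the boxes: the loss [r ^+ (L - min l)] beats the number of boxes
    because it is at most a product of geometric weights. *)
Lemma l1_gdft_max_profile : (0 < #|I|)%N ->
  \sum_y cabs (gdft (fun m => (max_profile m)%:C) y) <=
    (160 ^+ #|I| * (4 * A + 10)) * ((1 - s)^-1) ^+ #|I| * (N ^ #|I|)%:R.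
Proof.
move=> I0; set K := gdft _; set C := 160 ^+ #|I| * (4 * A + 10).
have C1 : 1 <= C.
  have h1 : 1 <= 160 ^+ #|I| :> R by rewrite exprn_ege1 // ler1n.
  by rewrite /C; have := A0; nra.
have C0 : 0 <= C by apply: le_trans C1.
pose Lg := {ffun I -> 'I_L.+1}.
have /card_gt0P[i1 _] := I0.
pose i0 (l : Lg) := [arg min_(i < i1) l i]%N.
have i0min (l : Lg) j : (l (i0 l) <= l j)%N.
  by rewrite /i0; case: arg_minnP => // i _; apply.
pose box (l : Lg) := [pred y : G | [forall i, shell L (l i) (y i)]].
have cover y : exists l : Lg, box l y.
  have h i := shell_ex Lp (y i).
  exists [ffun i => xchoose (h i)]; apply/forallP => i; rewrite ffunE.
  exact: (xchooseP (h i)).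
have boxb (l : Lg) : \sum_(y | box l y) cabs (K y) <= (N ^ #|I|)%:R * (C * r ^+ (L - l (i0 l))).
  have rn0 : 0 <= r ^+ (L - l (i0 l)) by rewrite exprn_ge0 // ltW.
  rewrite -(@ler_pXn2r _ 2) ?nnegrE //; last 2 first.
  - by apply: sumr_ge0 => y _; exact: cabs_ge0.
  - by apply: mulr_ge0 => //; exact: mulr_ge0.
  apply: le_trans (gdft_box N1 (gdft_mixed_diff l max_profile) _) _.
    by move=> y /forallP; exact: mixed_weight_ge1.
  have -> : \sum_m cabs (mixed_diff l max_profile m)%:C ^+ 2 = \sum_m mixed_diff l max_profile m ^+ 2.
    by apply: eq_bigr => m _; rewrite cabs_real real_normK ?num_real.
  have cb : #|[pred y | box l y]|%:R <= \prod_i (2 ^ (p - l i + 2))%N%:R :> R.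
    rewrite -natr_prod ler_nat.
    have -> : #|[pred y | box l y]| = #|family (fun i => [pred a : ZN | shell L (l i) a])|.
      apply: eq_card => y; rewrite [LHS]inE; apply/forallP/familyP => h i; by have := h i; rewrite inE.
    rewrite card_family foldrE big_map big_enum /=; apply: leq_prod => i _.
    by apply: (card_shell Lp); rewrite -ltnS.
  have Q0 : 0 <= \prod_i (2 ^ l i)%:R :> R by apply: prodr_ge0.
  apply: le_trans (_ : (\prod_i (2 ^ (p - l i + 2))%N%:R) * ((N ^ #|I|)%:R *
     ((4 * A + 10) * 40 ^+ #|I| * (\prod_i (2 ^ l i)%:R) * r ^+ (2 * (L - l (i0 l))))) <= _).
    rewrite ler_pM ?mulr_ge0 // ?sumr_ge0 //; first by move=> m _; exact: sqr_ge0.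
    by rewrite ler_wpM2l //; exact: sum_sqr_mixed_diff.
  have e : (\prod_i (2 ^ (p - l i + 2))%N%:R) * (\prod_i (2 ^ l i)%:R) = 4 ^+ #|I| * (N ^ #|I|)%:R :> R.
    rewrite -big_split /= natrX -exprMn -prodr_const; apply: eq_bigr => i _.
    rewrite -natrM -expnD -[4]/(4%:R) -natrM; congr _%:R.
    have lip : (l i <= p)%N.
      by apply: leq_trans (leq_trans (leq_addr 2 L) Lp); rewrite -ltnS.
    rewrite (_ : (p - l i + 2 + l i = 2 + p)%N); last by rewrite addnAC subnK // addnC.
    by rewrite expnD.
  rewrite [leLHS](_ : _ = ((\prod_i (2 ^ (p - l i + 2))%N%:R) * (\prod_i (2 ^ l i)%:R)) *
     ((N ^ #|I|)%:R * ((4 * A + 10) * 40 ^+ #|I| * r ^+ (2 * (L - l (i0 l)))))); last by ring.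
  rewrite e mulnC exprM.
  rewrite [leLHS](_ : _ = ((N ^ #|I|)%:R * r ^+ (L - l (i0 l))) ^+ 2 * (4 ^+ #|I| * 40 ^+ #|I| * (4 * A + 10))); last by ring.
  rewrite [leRHS](_ : _ = ((N ^ #|I|)%:R * r ^+ (L - l (i0 l))) ^+ 2 * C ^+ 2); last by ring.
  rewrite ler_wpM2l ?sqr_ge0 // -exprMn (_ : 4 * 40 = 160 :> R); last by ring.
  by rewrite -/C expr2 ler_peMl.
have geo : \sum_(l : Lg) r ^+ (L - l (i0 l)) <= ((1 - s)^-1) ^+ #|I|.
  apply: le_trans (_ : \sum_(l : Lg) \prod_i s ^+ (L - l i) <= _).
    apply: ler_sum => l _; rewrite -exprM mulnC exprM -prodr_const.
    apply: ler_prod => i _; rewrite (exprn_ge0 _ (ltW s0)) /=.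
    have /andP[_ s1] := s01.
    by rewrite ler_wiXn2l ?(ltW s0) ?(ltW s1) // leq_sub2l.
  rewrite -(bigA_distr_bigA (fun (i : I) (k : 'I_L.+1) => s ^+ (L - k))) /= prodr_const.
  have /andP[_ s1] := s01; have hs := geometric_sum_rev_le s01 L.
  rewrite lerXn2r // nnegrE; first by apply: sumr_ge0 => k _; rewrite exprn_ge0 // ltW.
  by rewrite invr_ge0 subr_ge0 ltW.
apply: le_trans (_ : \sum_(l : Lg) \sum_(y | box l y) cabs (K y) <= _).
  rewrite (exchange_big_dep predT) //=; apply: ler_sum => y _.
  have [l yl] := cover y; rewrite (bigD1 l) //= lerDl.
  by apply: sumr_ge0 => ? _; exact: cabs_ge0.
apply: le_trans (ler_sum _ (fun l _ => boxb l)) _.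
rewrite -mulr_sumr -mulr_sumr [leRHS]mulrC ler_wpM2l // ler_wpM2l //.
Qed.

End max_profile.

(** * Profiles of the Riesz means and discrete measures with a given transform *)

Lemma expn_up n : (0 < n)%N -> exists2 L, (n <= 2 ^ L)%N & (2 ^ L <= 2 * n)%N.
Proof.
move=> n0; have [n1|n1] := leqP n 1.
  by exists 0%N; rewrite expn0; lia.
have /andP[h1 h2] := up_log_bounds (isT : (1 < 2)%N) n1.
exists (up_log 2 n) => //.
have : (0 < up_log 2 n)%N by rewrite up_log_gt0.
by case: (up_log 2 n) h1 => // m /= h _; rewrite expnS leq_pmul2l // ltnW.
Qed.

Lemma nat_above_both (R : realType) (x y : R) : 0 <= x -> 0 <= y ->
  exists k : nat, x <= k%:R /\ y <= k%:R.
Proof.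
move=> x0 y0; have /andP[_ h] := truncn_itv (addr_ge0 x0 y0).
by exists (Num.truncn (x + y)).+1; split; apply: le_trans (ltW h); rewrite ?lerDl ?lerDr.
Qed.

Section power_moduli.
Context {R : realType}.
Implicit Types (y z t a : R).

Lemma one_sub_expr_le t (k : nat) : 0 <= t <= 1 -> 1 - t ^+ k <= k%:R * (1 - t).
Proof.
move=> /andP[t0 t1]; elim: k => [|k IH]; first by rewrite expr0 mul0r subrr.
rewrite exprS [X in X * (1 - t)](_ : _ = k%:R + 1); last by rewrite natr1.
have : 0 <= t ^+ k <= 1 by rewrite exprn_ge0 // exprn_ile1.
nra.
Qed.

Lemma one_powR a : 1 `^ a = 1 :> R.
Proof. by rewrite powR1. Qed.

Lemma powR_exprAC y a (k : nat) : 0 <= y -> (y `^ a) ^+ k = (y ^+ k) `^ a.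
Proof. by move=> y0; rewrite -(powR_mulrn k y0) -(powR_mulrn k (powR_ge0 y a)) powRAC. Qed.

Lemma powR_le1 t a : 0 <= t <= 1 -> 0 <= a -> t `^ a <= 1.
Proof.
move=> /andP[t0 t1] a0; rewrite -(one_powR a).
by apply: ge0_ler_powR; rewrite ?nnegrE ?ler01.
Qed.

(** Homogeneity reduces the claim to [1 - r^a <= 1 - r^k <= k (1 - r)]. *)
Lemma powR_lipschitz y z a (k : nat) : 0 <= z <= y -> y <= 1 -> 1 <= a <= k%:R ->
  y `^ a - z `^ a <= k%:R * (y - z).
Proof.
move=> /andP[z0 zy] y1 /andP[a1 ak].
have a0 : 0 < a by exact: lt_le_trans a1.
have [y0|yp] := leP y 0.
  have -> : y = z by apply/le_anti; rewrite zy (le_trans y0).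
  by rewrite !subrr mulr0.
set r := z / y.
have r01 : 0 <= r <= 1 by rewrite /r divr_ge0 ?(ltW yp) //= ler_pdivrMr // mul1r.
have zE : z = r * y by rewrite /r divfK // gt_eqF.
have /andP[r0 r1] := r01.
have h1 : 1 - r `^ a <= k%:R * (1 - r).
  apply: le_trans (one_sub_expr_le k r01).
  rewrite lerB // -powR_mulrn //.
  move: r0; rewrite le_eqVlt => /orP[/eqP <-|rp].
    rewrite !powR0 ?gt_eqF //; exact: lt_le_trans a0 ak.
  by apply: ger_powR => //; rewrite rp r1.
rewrite zE powRM //; last exact: ltW.
have ya : y `^ a <= y by apply: ge1r_powR => //; rewrite yp y1.
have -> : y `^ a - r `^ a * y `^ a = y `^ a * (1 - r `^ a) by ring.
have -> : k%:R * (y - r * y) = y * (k%:R * (1 - r)) by ring.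
have : r `^ a <= 1 by apply: powR_le1 => //; exact: ltW.
by move=> h; apply: ler_pM => //; rewrite ?powR_ge0 ?subr_ge0.
Qed.

(** For [a < 1] the power is subadditive. *)
Lemma powR_hoelder y z a (k : nat) : 0 <= z <= y -> y <= 1 -> 0 < a <= k%:R -> (0 < k)%N ->
  y `^ a - z `^ a <= k%:R * (y - z) `^ Num.min a 1.
Proof.
move=> zy y1 /andP[a0 ak] k0; have /andP[z0 zy'] := zy.
have [a1|a1] := leP 1 a.
  by rewrite powRr1 ?subr_ge0 //; apply: powR_lipschitz; rewrite ?a1.
apply: le_trans (_ : (y - z) `^ a <= _); last first.
  by rewrite ler_peMl ?powR_ge0 // ler1n.
have [y0|yp] := leP y 0.
  have -> : y = z by apply/le_anti; rewrite zy' (le_trans y0).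
  by rewrite !subrr powR0 ?gt_eqF.
have [r r0 [r1 zE]] : exists2 r, 0 <= r & r <= 1 /\ z = r * y.
  exists (z / y); first by rewrite divr_ge0 ?(ltW yp).
  by rewrite ler_pdivrMr // mul1r divfK // gt_eqF.
have sub t : 0 <= t <= 1 -> t <= t `^ a.
  move=> /andP[]; rewrite le_eqVlt => /orP[/eqP <- _|tp t1]; first exact: powR_ge0.
  by apply: ger1_powR; rewrite ?tp // ltW.
have -> : y - z = (1 - r) * y by rewrite zE; ring.
rewrite zE !powRM ?subr_ge0 ?(ltW yp) //.
have h1 := sub _ (introT andP (conj r0 r1)).
have h2 : 1 - r <= (1 - r) `^ a by apply: sub; rewrite subr_ge0 r1 /= gerBl.
have : 0 <= y `^ a by exact: powR_ge0.
nra.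
Qed.

End power_moduli.

Section riesz_profile.
Context {R : realType}.
Variables (gamma alpha : R).
Hypothesis gamma1 : 1 <= gamma.
Hypothesis alpha0 : 0 < alpha.
Implicit Types (t : R).

(** The weight of the means is [riesz_profile (|k|_q / n)]: truncating at zero
    extends it to all frequencies. *)
Definition riesz_gap t : R := Num.max 0 (1 - t `^ gamma).
Definition riesz_profile t : R := riesz_gap t `^ alpha.

Let gamma0 : 0 < gamma. Proof. exact: lt_le_trans gamma1. Qed.

Lemma riesz_gap_ge0 t : 0 <= riesz_gap t.
Proof. by rewrite le_max lexx. Qed.

Lemma riesz_gap_le1 t : riesz_gap t <= 1.
Proof. by rewrite ge_max ler01 gerBl powR_ge0. Qed.

Lemma riesz_gap_eq0 t : 1 <= t -> riesz_gap t = 0.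
Proof.
move=> t1; apply/eqP; rewrite eq_le riesz_gap_ge0 andbT ge_max lexx /= subr_le0.
by rewrite -(one_powR gamma); apply: ge0_ler_powR; rewrite ?nnegrE ?ler01 ?(ltW gamma0) ?(le_trans ler01).
Qed.

Lemma riesz_gapE t : 0 <= t <= 1 -> riesz_gap t = 1 - t `^ gamma.
Proof.
by move=> t01; rewrite /riesz_gap max_r // subr_ge0 powR_le1 // ltW.
Qed.

Lemma riesz_gap_mono t t' : 0 <= t <= t' -> riesz_gap t' <= riesz_gap t.
Proof.
move=> /andP[t0 tt']; rewrite /riesz_gap ge_max riesz_gap_ge0 /= le_max.
apply/orP; right; rewrite lerB //.
by apply: ge0_ler_powR; rewrite ?nnegrE ?(ltW gamma0) // (le_trans t0).
Qed.

Lemma riesz_gap_lipschitz t t' (k : nat) : 0 <= t <= t' -> gamma <= k%:R ->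
  riesz_gap t - riesz_gap t' <= k%:R * (t' - t).
Proof.
move=> /andP[t0 tt'] gk.
have R0 : 0 <= k%:R * (t' - t) by rewrite mulr_ge0 // subr_ge0.
have [t1|t1] := leP 1 t.
  by rewrite !riesz_gap_eq0 ?subrr // (le_trans t1).
have [t'1|t'1] := leP t' 1.
  rewrite !riesz_gapE ?t0 ?(ltW t1) ?t'1 ?(le_trans t0) //.
  rewrite [leLHS](_ : _ = t' `^ gamma - t `^ gamma); last by ring.
  by apply: powR_lipschitz; rewrite ?t0 ?gamma1.
rewrite (riesz_gap_eq0 (ltW t'1)) subr0 riesz_gapE ?t0 ?(ltW t1) //.
rewrite -[X in X - _](one_powR gamma); apply: le_trans (powR_lipschitz _ _ (k:=k) _) _.
- by rewrite t0 ltW.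
- exact: lexx.
- by rewrite gamma1.
by rewrite ler_wpM2l // lerB // ltW.
Qed.

Lemma riesz_profile_ge0 t : 0 <= riesz_profile t.
Proof. exact: powR_ge0. Qed.

Lemma riesz_profile_le1 t : riesz_profile t <= 1.
Proof. by apply: powR_le1; rewrite ?riesz_gap_ge0 ?riesz_gap_le1 // ltW. Qed.

Lemma riesz_profile_eq0 t : 1 <= t -> riesz_profile t = 0.
Proof. by move=> t1; rewrite /riesz_profile riesz_gap_eq0 // powR0 // gt_eqF. Qed.

Lemma riesz_profile_mono t t' : 0 <= t <= t' -> riesz_profile t' <= riesz_profile t.
Proof.
move=> tt'; apply: ge0_ler_powR; rewrite ?nnegrE ?riesz_gap_ge0 ?(ltW alpha0) //.
exact: riesz_gap_mono.
Qed.

(** The gap is Lipschitz, and the power [alpha] costs at most the Hoelder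
    exponent [min alpha 1]. *)
Lemma riesz_profile_hoelder : exists2 A, 0 <= A & forall t t', 0 <= t <= t' ->
  riesz_profile t - riesz_profile t' <= A * (t' - t) `^ Num.min alpha 1.
Proof.
have [k [gk ak]] := nat_above_both (ltW gamma0) (ltW alpha0).
have k0 : (0 < k)%N by rewrite -(ltr0n R) (lt_le_trans gamma0).
exists (k%:R * k%:R) => [|t t' tt']; first by rewrite mulr_ge0.
have h0 : 0 <= t' - t by rewrite subr_ge0; case/andP: tt'.
have m0 : 0 <= Num.min alpha 1 by rewrite le_min (ltW alpha0) ler01.
apply: le_trans (powR_hoelder (k:=k) _ _ _ _) _ => //.
- by rewrite riesz_gap_ge0 riesz_gap_mono.
- exact: riesz_gap_le1.
- by rewrite alpha0.
rewrite -mulrA ler_wpM2l //.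
apply: le_trans (_ : (k%:R * (t' - t)) `^ Num.min alpha 1 <= _).
  apply: ge0_ler_powR; rewrite ?nnegrE ?subr_ge0 ?riesz_gap_mono ?mulr_ge0 //.
  exact: riesz_gap_lipschitz.
rewrite powRM // ler_wpM2r ?powR_ge0 //.
by apply: ler1_powR; rewrite ?ler1n // ge_min lexx orbT.
Qed.

End riesz_profile.

Section exponential_sums.
Context {R : realType} {d : nat}.
Implicit Types (k : 'rV[int]_d) (F : seq 'rV[int]_d) (M : 'rV[int]_d -> R).

(** [M] agrees on [F] with the Fourier transform of a discrete measure of total
    mass at most [C]. *)
Definition mass_bound (C : R) F M : Prop :=
  exists2 s : seq (R[i] * 'rV[R]_d), \sum_(cx <- s) cabs cx.1 <= C &
    forall k, k \in F -> \sum_(cx <- s) cx.1 * cis (- dotZ k cx.2) = (M k)%:C.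

Lemma mass_bound_ext C F M M' : M =1 M' -> mass_bound C F M -> mass_bound C F M'.
Proof. by move=> MM' [s s1 s2]; exists s => // k kF; rewrite s2 // MM'. Qed.

Definition idot (a k : 'rV[int]_d) : int := \sum_j a ord0 j * k ord0 j.

(** Restricting a multiplier of [(Z/N)^I] along a linear map pushes its kernel
    forward under the dual map, which does not increase the mass. *)
Lemma mass_bound_gdft (N : nat) (I : finType) (a : I -> 'rV[int]_d)
    (Mg : {ffun I -> 'Z_N} -> R) (C : R) F M : (1 < N)%N ->
  \sum_y cabs (gdft (fun m => (Mg m)%:C) y) <= C * (N ^ #|I|)%:R ->
  (forall k, k \in F -> Mg [ffun i => (idot (a i) k)%:~R] = M k) ->
  mass_bound C F M.
Proof.
move=> N1 hC hM.
set W : R := (N ^ #|I|)%:R.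
have W0 : 0 < W by rewrite ltr0n expn_gt0 ltnW.
have N0 : N%:R != 0 :> R by rewrite pnatr_eq0 -lt0n ltnW.
pose x (y : {ffun I -> 'Z_N}) : 'rV[R]_d :=
  \row_j (2 * pi / N%:R * \sum_i (y i : nat)%:R * (a i ord0 j)%:~R).
exists [seq ((W^-1)%:C * gdft (fun m => (Mg m)%:C) y, x y) | y <- index_enum {ffun I -> 'Z_N}].
  rewrite big_map /=; under eq_bigr do rewrite cabsM cabs_real ger0_norm ?invr_ge0 ?(ltW W0) //.
  by rewrite -mulr_sumr mulrC ler_pdivrMr.
move=> k kF; rewrite big_map /=.
have e y : cis (- dotZ k (x y)) = gchar (- [ffun i => (idot (a i) k)%:~R]) y :> R[i].
  rewrite /gchar; under eq_bigr => i _.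
    rewrite !ffunE -[y i]natr_Zp -mulrNz -[(nat_of_ord (y i))%:R]/((Posz (y i))%:~R).
    rewrite -intrM zchar_int //.
    over.
  rewrite -cis_sum; congr cis; rewrite /dotZ.
  rewrite -sumrN; under eq_bigr do rewrite mxE mulrCA mulr_sumr -mulrN -sumrN mulr_sumr.
  rewrite exchange_big /=; apply: eq_bigr => i _.
  rewrite -mulr_sumr mulrAC; congr (_ * _ ).
  rewrite mulNr mulrNz intrM /idot rmorph_sum /= mulr_suml -sumrN; congr (_ * _); apply: eq_bigr => j _.
  have hz (m : nat) : (Posz m)%:~R = m%:R :> R by [].
  by rewrite intrM hz; ring.
under eq_bigr => y _ do rewrite e -mulrA.
rewrite -mulr_sumr gdft_inv // hM // mulrA -[(N ^ #|I|)%:R](rmorph_nat (real_complex R)).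
by rewrite -rmorphM /= mulVf ?mul1r // gt_eqF.
Qed.

End exponential_sums.

Section max_forms.
Context {R : realType}.
Variables (gamma alpha : R).
Hypothesis gamma1 : 1 <= gamma.
Hypothesis alpha0 : 0 < alpha.

(** Cubes and cross-polytopes are sublevel sets of the largest of finitely many
    integer linear forms, and such a profile is the restriction of a profile of
    the largest coordinate on [Z^I]. *)
Lemma mass_bound_max_forms (d : nat) (I : finType) : (0 < #|I|)%N ->
  exists C : R, forall (n : nat) (F : seq 'rV[int]_d) (a : I -> 'rV[int]_d), (0 < n)%N ->
    mass_bound C F (fun k => riesz_profile gamma alpha
                              ((\max_i `|idot (a i) k|)%N%:R / n%:R)).
Proof.
move=> I0.
have [A1 A10 hA1] := riesz_profile_hoelder gamma1 alpha0.
set b := Num.min alpha 1 in hA1.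
have b0 : 0 < b by rewrite lt_min alpha0 ltr01.
have b1 : b <= 1 by rewrite ge_min lexx orbT.
(* this exponent makes [s ^+ #|I|] the square root of the gain of the modulus
   of continuity per dyadic step *)
set e := b / (2 * #|I|%:R).
have I0' : 0 < #|I|%:R :> R by rewrite ltr0n.
have e0 : 0 < e by rewrite divr_gt0 // mulr_gt0.
set s : R := 2^-1 `^ e.
have h01 : 0 < (2^-1 : R) < 1 by rewrite invr_gt0 ltr0n invf_lt1 ?ltr1n.
have s0 : 0 < s by rewrite powR_gt0; case/andP: h01.
have s1 : s < 1.
  rewrite /s -[ltRHS](one_powR e); apply: gt0_ltr_powR; rewrite ?nnegrE //.
  by case/andP: h01.
set A := 2 * A1.
exists ((160 ^+ #|I| * (4 * A + 10)) * ((1 - s)^-1) ^+ #|I|) => n F a n0.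
have [L nL Ln] := expn_up n0.
(* the modulus [2^p] is so large that the forms on [F] do not wrap around *)
have [p Lp ap] : exists2 p, (L + 2 <= p)%N & (L + 2 + \sum_(k <- F) \sum_i `|idot (a i) k| <= p)%N.
  by exists (L + 2 + \sum_(k <- F) \sum_i `|idot (a i) k|)%N; rewrite ?leq_addr.
have n0' : 0 < n%:R :> R by rewrite ltr0n.
pose u (m : nat) := riesz_profile gamma alpha (m%:R / n%:R).
have hd m m' : (m <= m')%N -> 0 <= (m%:R / n%:R : R) <= m'%:R / n%:R.
  by move=> mm; rewrite divr_ge0 //= ler_pM2r ?invr_gt0 // ler_nat.
apply: (mass_bound_gdft (N := 2 ^ p) (a := a) (Mg := @max_profile R p I u)).
- exact: (expn2_gt1 Lp).
- apply: (@l1_gdft_max_profile _ _ _ Lp _ u A s); last exact: I0.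
  + by move=> m m' mm; apply: riesz_profile_mono => //; exact: hd.
  + by move=> m; exact: riesz_profile_ge0.
  + by move=> m; exact: riesz_profile_le1.
  + move=> m mL; apply: riesz_profile_eq0 => //.
    by rewrite ler_pdivlMr // mul1r ler_nat (leq_trans nL).
  + by rewrite mulr_ge0.
  + by rewrite s0.
  move=> m l lL; apply: le_trans (hA1 _ _ _) _; first by apply: hd; exact: leq_addr.
  rewrite natrD mulrDl addrAC subrr add0r.
  have hs : s ^+ #|I| ^+ 2 = 2^-1 `^ b.
    rewrite -exprM -powR_mulrn ?(ltW s0) // -powRrM; congr (_ `^ _).
    by rewrite /e natrM; field; rewrite gt_eqF.
  have e3 : (2^-1 `^ b) ^+ (L - l) = (2^-1 ^+ (L - l)) `^ b :> R.
    by apply: powR_exprAC; rewrite invr_ge0.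
  rewrite exprM hs e3 [leRHS](_ : _ = A1 * (2 * (2^-1 ^+ (L - l)) `^ b)); last by rewrite /A; ring.
  rewrite ler_wpM2l //.
  apply: le_trans (_ : (2 * 2^-1 ^+ (L - l)) `^ b <= _); last first.
    rewrite powRM ?exprn_ge0 ?invr_ge0 // ler_wpM2r ?powR_ge0 //.
    by apply: ler1_powR; rewrite ?ler1n.
  apply: ge0_ler_powR; rewrite ?nnegrE ?(ltW b0) ?divr_ge0 ?mulr_ge0 ?exprn_ge0 ?invr_ge0 //.
  rewrite ler_pdivrMr // exprVn mulrAC ler_pdivlMr ?exprn_gt0 // -natrX -!natrM ler_nat.
  by rewrite -expnD subnKC.
move=> k kF; rewrite /max_profile /u; congr (riesz_profile _ _ (_%:R / _)).
apply: eq_bigr => i _; rewrite ffunE zrho_int ?(expn2_gt1 Lp) //.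
have h : (`|idot (a i) k| <= \sum_(k <- F) \sum_i `|idot (a i) k|)%N.
  by rewrite (big_rem k) //= (bigD1 i) //= -addnA leq_addr.
have h2 : (`|idot (a i) k| < 2 ^ `|idot (a i) k|)%N by exact: ltn_expl.
have h3 : (2 ^ (`|idot (a i) k|).+1 <= 2 ^ p)%N.
  rewrite leq_exp2l // (leq_trans _ ap) // -addn1 addnC leq_add //.
  by rewrite addn2.
by apply: leq_trans h3; rewrite expnS mul2n leq_double ltnW.
Qed.

Definition riesz_multiplier (d : nat) (q : \bar R) (n : nat) (k : 'rV[int]_d) : R :=
  riesz_profile gamma alpha (lq_normZ q k / n%:R).

Lemma lq_normZ_infty (d : nat) (k : 'rV[int]_d) :
  lq_normZ +oo%E k = (\max_i `|idot (delta_mx ord0 i) k|)%N%:R :> R.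
Proof.
rewrite /lq_normZ /lq_norm.
have hm : {morph (fun m : nat => m%:R : R) : x y / maxn x y >-> Num.max x y}.
  by move=> x y; rewrite natr_max.
rewrite (big_morph _ hm (erefl : 0%:R = 0)).
apply: eq_bigr => i _; rewrite mxE /idot (bigD1 i) //= mxE !eqxx mul1r big1 ?addr0.
  by rewrite natr_absz intr_norm.
by move=> j ji; rewrite mxE (negbTE ji) mul0r.
Qed.

(** The signs of the entries of [k] select the form that attains the norm. *)
Lemma lq_normZ_1 (d : nat) (k : 'rV[int]_d) :
  lq_normZ 1%:E k =
    (\max_(e : {ffun 'I_d -> bool}) `|idot (\row_j (-1) ^+ e j) k|)%N%:R :> R.
Proof.
rewrite /lq_normZ /lq_norm invr1 powRr1; last by apply: sumr_ge0 => j _; exact: powR_ge0.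
rewrite (_ : \max_e _ = \sum_j `|k ord0 j|)%N.
  rewrite natr_sum; apply: eq_bigr => j _; rewrite mxE powRr1 //.
  by rewrite natr_absz intr_norm.
apply/eqP; rewrite eqn_leq; apply/andP; split.
  apply/bigmax_leqP => e _; rewrite /idot.
  elim/big_rec2 : _ => [|j x y _ xy] //.
  rewrite mxE; apply: leq_trans (_ : _ <= `|((-1) ^+ e j * k ord0 j)%R| + `|x|)%N _.
    by rewrite -lez_nat PoszD !abszE ler_normD.
  by rewrite abszMsign leq_add2l.
apply: leq_trans (leq_bigmax [ffun j => (k ord0 j < 0)%R]).
rewrite /idot -lez_nat abszE; apply: le_trans (ler_norm _).
rewrite (big_morph Posz PoszD (erefl : Posz 0 = 0)); apply: ler_sum => j _; rewrite mxE ffunE abszE.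
by rewrite normrEsign.
Qed.

Lemma mass_bound_linfty (d : nat) : (0 < d)%N ->
  exists C : R, forall (n : nat) (F : seq 'rV[int]_d), (0 < n)%N ->
    mass_bound C F (riesz_multiplier +oo%E n).
Proof.
move=> d0; have I0 : (0 < #|'I_d|)%N by rewrite card_ord.
have [C hC] := mass_bound_max_forms d I0; exists C => n F n0.
apply: mass_bound_ext (hC n F (fun i => delta_mx ord0 i) n0) => k.
by rewrite /riesz_multiplier lq_normZ_infty.
Qed.

Lemma mass_bound_l1 (d : nat) :
  exists C : R, forall (n : nat) (F : seq 'rV[int]_d), (0 < n)%N ->
    mass_bound C F (riesz_multiplier 1%:E n).
Proof.
have I0 : (0 < #|{ffun 'I_d -> bool}|)%N by apply/card_gt0P; exists [ffun=> false].
have [C hC] := mass_bound_max_forms d I0; exists C => n F n0.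
apply: mass_bound_ext (hC n F (fun e => \row_j (-1) ^+ e j) n0) => k.
by rewrite /riesz_multiplier lq_normZ_1.
Qed.

End max_forms.

(** * Iterated differences and derivatives of the radial profile *)

Section iterated_differences.
Context {R : realType}.

Definition gdiff (V : zmodType) (a : V) (f : V -> R) (x : V) : R := f (x - a) - f x.

Lemma iter_gdiff_eq (V W : zmodType) (a : V) (b : W) (f : V -> R) (g : W -> R) S x y :
  (forall r, (r <= S)%N -> f (x - a *+ r) = g (y - b *+ r)) ->
  iter S (gdiff a) f x = iter S (gdiff b) g y.
Proof.
elim: S x y => [|S IH] x y h; first by have := h 0%N isT; rewrite !mulr0n !subr0.
rewrite !iterS /gdiff (IH (x - a) (y - b)); last first.
  by move=> r rS; have := h r.+1 rS; rewrite !mulrS !opprD !addrA.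
by rewrite (IH x y) // => r rS; apply: h; exact: leqW.
Qed.

Lemma iter_gdiff_le (V : zmodType) (a : V) (f : V -> R) S x B :
  (forall r, (r <= S)%N -> `|f (x - a *+ r)| <= B) ->
  `|iter S (gdiff a) f x| <= 2 ^+ S * B.
Proof.
elim: S x => [|S IH] x h; first by have := h 0%N isT; rewrite mulr0n subr0 expr0 mul1r.
rewrite iterS /gdiff; apply: le_trans (ler_normB _ _) _.
rewrite exprS -mulrA [leRHS](_ : _ = 2 ^+ S * B + 2 ^+ S * B); last by ring.
apply: lerD; apply: IH => r rS; last by apply: h; exact: leqW.
by have := h r.+1 rS; rewrite mulrS opprD addrA.
Qed.

Lemma iter_gdiff_subc (V : zmodType) (a : V) (f : V -> R) S x c : (0 < S)%N ->
  iter S (gdiff a) (fun y => f y - c) x = iter S (gdiff a) f x.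
Proof.
case: S => // S _; rewrite !iterSr; congr (iter S _ _ x).
by apply/funext => y; rewrite /gdiff; ring.
Qed.

Lemma is_derive_shiftB (f : R -> R) (x h df : R) :
  is_derive (x - h) (1 : R) f df -> is_derive x (1 : R) (fun y => f (y - h)) df.
Proof.
move=> hf; rewrite (_ : (fun y => f (y - h)) = f \o (id - cst h)) //.
apply: (@is_derive_eq _ _ _ _ _ _ _ (df * (1 - 0))); last by rewrite subr0 mulr1.
Qed.

(** Mean value theorem for one difference; the remaining ones commute with the
    derivative. *)
Lemma iter_gdiff_derive (S : nat) (f : nat -> R -> R) (x h B : R) : 0 <= h ->
  (forall j y, (j < S)%N -> x - h *+ S <= y <= x -> is_derive y (1 : R) (f j) (f j.+1 y)) ->
  (forall y, x - h *+ S <= y <= x -> `|f S y| <= B) ->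
  `|iter S (gdiff h) (f 0%N) x| <= h ^+ S * B.
Proof.
move=> h0; elim: S f B => [|S IH] f B df fB.
  by rewrite expr0 mul1r; apply: fB; rewrite mulr0n subr0 lexx.
have sub y : x - h *+ S <= y <= x -> x - h *+ S.+1 <= y <= x.
  by rewrite mulrS; lra.
have sub2 y : x - h *+ S <= y <= x -> x - h *+ S.+1 <= y - h <= x.
  by rewrite mulrS; lra.
rewrite iterSr exprSr -mulrA.
apply: (IH (fun j => gdiff h (f j))).
  move=> j y jS yI; rewrite /gdiff.
  have h1 : is_derive y (1 : R) (f j) (f j.+1 y) by apply: df; [exact: leqW|exact: sub].
  have h2 : is_derive y (1 : R) (fun y => f j (y - h)) (f j.+1 (y - h)).
    by apply: is_derive_shiftB; apply: df; [exact: leqW|exact: sub2].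
  exact: is_deriveB.
move=> y yI; rewrite /gdiff.
have [h00|hp] := leP h 0.
  have -> : h = 0 by apply/le_anti; rewrite h0 h00.
  by rewrite subr0 subrr normr0 mul0r.
have dS z : y - h <= z <= y -> is_derive z (1 : R) (f S) (f S.+1 z).
  by move=> zI; apply: df => //; have := sub2 _ yI; have := sub _ yI; lra.
have yh : y - h < y by rewrite gtrBl.
have [c cI e] : exists2 c, c \in `]y - h, y[%R & f S y - f S (y - h) = f S.+1 c * (y - (y - h)).
  apply: MVT => //.
    by move=> z; rewrite in_itv /= => /andP[z1 z2]; apply: dS; rewrite !ltW.
  apply: derivable_within_continuous => z; rewrite in_itv /= => zI.
  by have := dS z zI; case.
rewrite distrC e normrM opprB addrC subrK (ger0_norm h0) mulrC ler_wpM2l //.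
apply: fB; move: cI; rewrite in_itv /=; have := sub2 _ yI; have := sub _ yI; lra.
Qed.

End iterated_differences.

Section radial_derivatives.
Context {R : realType}.
Variables (gamma alpha : R).

Lemma is_derive_powR_comp (f : R -> R) (x df r : R) : 0 < f x ->
  is_derive x (1 : R) f df ->
  is_derive x (1 : R) (fun y => f y `^ r) (r * f x `^ (r - 1) * df).
Proof.
move=> fx hf; rewrite (_ : (fun y => f y `^ r) = (@powR R ^~ r) \o f) //.
by apply: is_derive1_comp; exact: is_derive1_powR.
Qed.

(** The squared distance to the origin along a line at squared distance [a]
    from it, and the corresponding gap. *)
Definition rad2 (a t : R) := t ^+ 2 + a.
Definition gap2 (a t : R) := 1 - rad2 a t `^ (gamma / 2).

(** A monomial [c t^i w^p v^(alpha - l)] in [t], [w = t^2 + a] and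
    [v = 1 - w^(gamma/2)], recorded as [(c, i, p, l)]; these are closed under
    differentiation in [t]. *)
Notation monomial := (R * nat * R * nat)%type.
Definition monomial_val (a : R) (m : monomial) (t : R) : R :=
  let: (c, i, p, l) := m in
  c * (t ^+ i * rad2 a t `^ p * gap2 a t `^ (alpha - l%:R)).
Definition monomial_derive (m : monomial) : seq monomial :=
  let: (c, i, p, l) := m in
  (if i is i'.+1 then [:: (c * i%:R, i', p, l)] else [::]) ++
  [:: (c * (2 * p), i.+1, p - 1, l);
      (- (c * ((alpha - l%:R) * gamma)), i.+1, p + (gamma / 2 - 1), l.+1)].
Definition poly_val a (s : seq monomial) t := \sum_(m <- s) monomial_val a m t.
Definition poly_derive (s : seq monomial) := flatten (map monomial_derive s).
Definition radial_poly (S : nat) : seq monomial :=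
  iter S poly_derive [:: (- (alpha * gamma), 1%N, gamma / 2 - 1, 1%N)].
(** The successive derivatives of [gap2 a `^ alpha]. *)
Definition radial_derive (a : R) (S : nat) (t : R) : R :=
  if S is S'.+1 then poly_val a (radial_poly S') t else gap2 a t `^ alpha.

Section at_point.
Variables (a t : R).
Hypothesis w0 : 0 < rad2 a t.
Hypothesis v0 : 0 < gap2 a t.

Lemma is_derive_rad2 : is_derive t (1 : R) (rad2 a) (2 * t).
Proof.
rewrite (_ : rad2 a = (id ^+ 2) + cst a); last by apply/funext => y.
apply: is_derive_eq; rewrite addr0 expr1.
by rewrite -[_ *: 1]/(_ * 1) mulr1.
Qed.

Lemma is_derive_gap2 :
  is_derive t (1 : R) (gap2 a) (- (gamma * (t * rad2 a t `^ (gamma / 2 - 1)))).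
Proof.
have h := is_derive_powR_comp (gamma / 2) w0 is_derive_rad2.
rewrite (_ : gap2 a = cst 1 - (fun y => rad2 a y `^ (gamma / 2))) //.
by apply: is_derive_eq; field.
Qed.

Lemma is_derive_monomial m :
  is_derive t (1 : R) (monomial_val a m) (poly_val a (monomial_derive m) t).
Proof.
case: m => [[[c i] p] l].
have hw := is_derive_powR_comp p w0 is_derive_rad2.
have hv := is_derive_powR_comp (alpha - l%:R) v0 is_derive_gap2.
have hx : is_derive t (1 : R) (fun y : R => y ^+ i) (i%:R * t ^+ i.-1).
  rewrite (_ : (fun y : R => y ^+ i) = (id ^+ i)).
    by apply: is_derive_eq; rewrite -[_ *: 1]/(_ * 1) mulr1.
  by apply/funext => y; rewrite fctE.
have h := is_deriveZ c (is_deriveM (is_deriveM hx hw) hv).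
apply: (is_derive_eq (f := monomial_val a (c, i, p, l)) h).
have sc (x y : R) : x *: (y : R^o) = x * y by [].
rewrite !sc mulrfctE.
rewrite /poly_val /monomial_derive big_cat /= !big_cons big_nil /=.
have e1 : rad2 a t `^ (p + (gamma / 2 - 1)) = rad2 a t `^ p * rad2 a t `^ (gamma / 2 - 1).
  by rewrite powRD // (gt_eqF w0) implybT.
have e2 : alpha - l.+1%:R = alpha - l%:R - 1 by rewrite -natr1; ring.
rewrite e1 e2 addr0.
case: i {hx h} => [|i]; rewrite ?big_cons big_nil /= ?exprS; ring.
Qed.

Lemma is_derive_poly s :
  is_derive t (1 : R) (poly_val a s) (poly_val a (poly_derive s) t).
Proof.
elim: s => [|m s IH].
  have e0 : poly_val a [::] = cst 0 by apply/funext => y; rewrite /poly_val big_nil.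
  by rewrite /poly_derive /= e0; exact: is_derive_cst.
rewrite (_ : poly_val a (m :: s) = monomial_val a m + poly_val a s); last first.
  by apply/funext => y; rewrite /poly_val big_cons.
rewrite /poly_derive /= /poly_val big_cat /=.
by apply: is_deriveD => //; exact: is_derive_monomial.
Qed.

Lemma is_derive_radial S :
  is_derive t (1 : R) (radial_derive a S) (radial_derive a S.+1 t).
Proof.
case: S => [|S]; last exact: is_derive_poly.
rewrite /radial_derive /radial_poly /=.
have := is_derive_powR_comp alpha v0 is_derive_gap2.
rewrite /poly_val big_seq1 /= => h; apply: (is_derive_eq h).
by rewrite expr1; ring.
Qed.

End at_point.

(** Each differentiation lowers the degree by one, unless it falls on the power
    of [v], which supplies a factor [w^(gamma/2)]; at least one derivative has
    to fall there. *)
Lemma radial_polyP S m : m \in radial_poly S ->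
  let: (c, i, p, l) := m in
  (1 <= l <= S.+1)%N /\ i%:R + 2 * p = gamma * l%:R - S.+1%:R.
Proof.
elim: S m => [|S IH] m.
  by rewrite inE => /eqP ->; split => //; field.
rewrite /radial_poly iterS => /flattenP[s /mapP[[[[c i] p] l] /IH[lS e] ->]].
rewrite mem_cat => /orP[].
  case: i e => [|i] e //; rewrite inE => /eqP ->; split; first by lia.
  by rewrite -natr1 in e; rewrite -[S.+2%:R]natr1; lra.
rewrite !inE => /orP[/eqP ->|/eqP ->]; (split; first by lia).
  by rewrite -[S.+2%:R]natr1 -[i.+1%:R]natr1; lra.
by rewrite -[S.+2%:R]natr1 -[i.+1%:R]natr1 -[l.+1%:R]natr1; lra.
Qed.

(** The degree count leaves [w^((gamma l - S - 1) / 2)] with [l >= 1], worst for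
    [l = 1] as [w <= 1], while the power of [v] is worst for [l = S + 1]. *)
Lemma radial_derive_bound S : 0 <= gamma -> alpha <= S.+1%:R ->
  exists2 C, 0 <= C & forall a t, 0 <= a -> 0 < rad2 a t <= 1 -> 0 < gap2 a t <= 1 ->
    `|radial_derive a S.+1 t| <=
       C * (rad2 a t `^ ((gamma - S.+1%:R) / 2) * gap2 a t `^ (alpha - S.+1%:R)).
Proof.
move=> g0 aS; exists (\sum_(m <- radial_poly S) `|m.1.1.1|); first exact: sumr_ge0.
move=> a t a0 /andP[w0 w1] /andP[v0 v1].
rewrite /radial_derive /poly_val; apply: le_trans (ler_norm_sum _ _ _) _.
rewrite mulr_suml [leLHS]big_seq [leRHS]big_seq; apply: ler_sum => m /radial_polyP.
case: m => [[[c i] p] l] [/andP[l1 lS] e] /=.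
rewrite normrM ler_wpM2l // !normrM !(ger0_norm (powR_ge0 _ _)) normrX.
apply: ler_pM; rewrite ?mulr_ge0 ?powR_ge0 ?exprn_ge0 //.
  have ti : `|t| ^+ i <= rad2 a t `^ (i%:R / 2).
    rewrite -powR_mulrn // (_ : `|t| = (t ^+ 2) `^ 2^-1); last first.
      by rewrite powR12_sqrt ?sqr_ge0 // sqrtr_sqr.
    rewrite -powRrM mulrC; apply: ge0_ler_powR; rewrite ?nnegrE ?sqr_ge0 ?(ltW w0) //.
    by rewrite /rad2 lerDl.
  apply: le_trans (_ : rad2 a t `^ (i%:R / 2) * rad2 a t `^ p <= _).
    by rewrite ler_wpM2r ?powR_ge0.
  rewrite -powRD ?(gt_eqF w0) ?implybT //; apply: ger_powR; rewrite ?w0 ?w1 //.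
  rewrite [leRHS](_ : _ = (i%:R + 2 * p) / 2); last by field.
  rewrite e ler_pM2r ?invr_gt0 // lerB // ler_peMr // ler1n //.
apply: ger_powR; rewrite ?v0 ?v1 //.
by rewrite lerB // ler_nat.
Qed.

End radial_derivatives.

(** * Kernels from square sums of directional differences *)

Section directional.
Context {R : realType}.
Variables (p L : nat).
Hypothesis Lp : (L + 2 <= p)%N.
Local Notation N := (2 ^ p)%N.
Local Notation ZN := 'Z_N.
Variable I : finType.
Local Notation G := {ffun I -> ZN}.
Let N1 : (1 < N)%N := expn2_gt1 Lp.

Definition dir (i : I) (h : nat) : G := [ffun j => if j == i then h%:R else 0].

Lemma gchar_dir i h (y : G) : gchar (dir i h) y = zchar (h%:R * y i) :> R[i].
Proof.
rewrite /gchar (bigD1 i) //= ffunE eqxx big1 ?mulr1 // => j ji.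
by rewrite ffunE (negbTE ji) mul0r zchar0.
Qed.

Lemma gdft_gdiff (a : G) (M : G -> R) S y :
  gdft (fun m => (iter S (gdiff a) M m)%:C) y =
  (gchar a y - 1) ^+ S * gdft (fun m => (M m)%:C) y :> R[i].
Proof.
elim: S => [|S IH]; first by rewrite expr0 mul1r.
rewrite exprS -mulrA -IH mulrBl mul1r -(gdft_shift N1) /gdft -sumrB.
apply: eq_bigr => m _; rewrite iterS {1}/gdiff rmorphB /= mulrBl //.
Qed.

Variables (M : G -> R) (S : nat) (B t : R).
Hypothesis B1 : 1 <= B.
Hypothesis t01 : 0 < t < 1.
Hypothesis diff_bound : forall i l, (l < L)%N ->
  \sum_m (iter S (gdiff (dir i (2 ^ l))) M m) ^+ 2 <=
    B * (2 ^ l)%:R ^+ #|I| * t ^+ (2 * (L - l)).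
Hypothesis sum_bound : \sum_m M m ^+ 2 <= B * (2 ^ L)%:R ^+ #|I|.

(** Isotropic counterpart of the box decomposition: the torus is cut according
    to its largest coordinate, and in the shell at distance [2^(-l)] the kernel
    is replaced by that of a high difference with step [2^l]. *)
Lemma l1_gdft_directional : (0 < #|I|)%N ->
  \sum_y cabs (gdft (fun m => (M m)%:C) y) <=
    #|I|%:R * (4 ^+ #|I| * B) / (1 - t) * (N ^ #|I|)%:R.
Proof.
move=> I0; have /card_gt0P[i1 _] := I0; have /andP[t0 t1] := t01.
set K := gdft _.
pose region (i : I) (l : 'I_L.+1) :=
  [pred y : G | shell L l (y i) & [forall j, (zrho (y j) <= 2 ^ (p - l - 1))%N]].
have cover y : exists i, exists l, region i l y.
  pose i := [arg max_(i > i1) zrho (y i)]%N; exists i.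
  have [l hl] := shell_ex Lp (y i); exists l; rewrite /= hl /=; apply/forallP => j.
  have /andP[h _] := hl; apply: leq_trans h.
  by rewrite /i; case: arg_maxnP => // i' _; apply.
have regb i l : \sum_(y | region i l y) cabs (K y) <=
    (N ^ #|I|)%:R * (4 ^+ #|I| * B * t ^+ (L - l)).
  have B0 : 0 <= B by apply: le_trans B1.
  have tn0 k : 0 <= t ^+ k by rewrite exprn_ge0 // ltW.
  have f0 : 0 <= 4 ^+ #|I| :> R by exact: exprn_ge0.
  have f1 : 1 <= 4 ^+ #|I| :> R by rewrite exprn_ege1 // ler1n.
  rewrite -(@ler_pXn2r _ 2) ?nnegrE //; last 2 first.
  - by apply: sumr_ge0 => y _; exact: cabs_ge0.
  - by apply: mulr_ge0 => //; rewrite !mulr_ge0.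
  have cb : #|region i l|%:R <= (2 ^ (p - l + 2))%N%:R ^+ #|I| :> R.
    rewrite -natrX ler_nat.
    apply: leq_trans (_ : #|family (fun _ : I => [pred a : ZN | (zrho a <= 2 ^ (p - l - 1))%N])| <= _)%N.
      apply: subset_leq_card; apply/fintype.subsetP => y /andP[_ /forallP h].
      by apply/familyP => j; rewrite inE; exact: h.
    rewrite card_family foldrE big_map big_enum /= prod_nat_const leq_exp2r //.
    by apply: (card_zrho_le Lp); rewrite -ltnS.
  have main : (\sum_(y | region i l y) cabs (K y)) ^+ 2 <=
      #|region i l|%:R * ((N ^ #|I|)%:R * (B * (2 ^ l)%:R ^+ #|I| * t ^+ (2 * (L - l)))).
    have [lL|lL] := ltnP l L.
      apply: le_trans (gdft_box N1 (gdft_gdiff (dir i (2 ^ l)) M S) _) _.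
        move=> y /andP[h _]; rewrite cabsX exprn_ege1 // gchar_dir.
        exact: (shell_weight Lp).
      rewrite ler_wpM2l // ler_wpM2l //; apply: le_trans (diff_bound i lL).
      by apply: ler_sum => m _; rewrite cabs_real real_normK ?num_real.
    have lE : l = L :> nat by have := ltn_ord l; lia.
    have h1 y : K y = 1 * K y by rewrite mul1r.
    apply: le_trans (gdft_box N1 h1 _) _.
      by move=> y _; rewrite cabs_real normr1.
    rewrite ler_wpM2l // ler_wpM2l // lE subnn muln0 expr0 mulr1.
    apply: le_trans sum_bound.
    by apply: ler_sum => m _; rewrite cabs_real real_normK ?num_real.
  apply: le_trans main _.
  apply: le_trans (_ : (2 ^ (p - l + 2))%N%:R ^+ #|I| * ((N ^ #|I|)%:R *
      (B * (2 ^ l)%:R ^+ #|I| * t ^+ (2 * (L - l)))) <= _).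
    apply: ler_wpM2r cb; apply: mulr_ge0 => //; apply: mulr_ge0 => //.
    by apply: mulr_ge0 => //; exact: exprn_ge0.
  have e : (2 ^ (p - l + 2))%N%:R ^+ #|I| * (2 ^ l)%:R ^+ #|I| = 4 ^+ #|I| * (N ^ #|I|)%:R :> R.
    have lp : (l <= p)%N by apply: leq_trans (leq_trans (leq_addr 2 L) Lp); rewrite -ltnS.
    rewrite [(N ^ _)%:R]natrX -!exprMn; congr (_ ^+ _).
    by rewrite -natrM -expnD addnAC subnK // addnC expnD natrM.
  rewrite mulnC exprM.
  rewrite [leLHS](_ : _ = ((2 ^ (p - l + 2))%N%:R ^+ #|I| * (2 ^ l)%:R ^+ #|I|) *
     ((N ^ #|I|)%:R * B * (t ^+ (L - l)) ^+ 2)); last by ring.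
  rewrite e [leLHS](_ : _ = ((N ^ #|I|)%:R * t ^+ (L - l)) ^+ 2 * (4 ^+ #|I| * B)); last by ring.
  rewrite [leRHS](_ : _ = ((N ^ #|I|)%:R * t ^+ (L - l)) ^+ 2 * (4 ^+ #|I| * B) ^+ 2); last by ring.
  rewrite ler_wpM2l ?sqr_ge0 // expr2 ler_peMl // ?mulr_ge0 //.
  by rewrite -[leLHS]mulr1 ler_pM.
apply: le_trans (_ : \sum_i \sum_l \sum_(y | region i l y) cabs (K y) <= _).
  rewrite pair_big /= (exchange_big_dep predT) //=; apply: ler_sum => y _.
  have [i [l yl]] := cover y; rewrite (bigD1 (i, l)) //= lerDl.
  by apply: sumr_ge0 => ? _; exact: cabs_ge0.
apply: le_trans (_ : \sum_(i : I) (4 ^+ #|I| * B) / (1 - t) * (N ^ #|I|)%:R <= _); last first.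
  by rewrite sumr_const -[X in X <= _]mulr_natl !mulrA.
apply: ler_sum => i _.
apply: le_trans (ler_sum _ (fun l _ => regb i l)) _.
have CB0 : 0 <= 4 ^+ #|I| * B by rewrite mulr_ge0 ?exprn_ge0 ?(le_trans ler01 B1).
rewrite -mulr_sumr -mulr_sumr mulrC ler_wpM2r // ler_wpM2l //.
exact: geometric_sum_rev_le.
Qed.

End directional.

Section dyadic_sums.
Context {R : realType}.

(** If the sublevel sets of [kap] grow like [x^e], a sum of inverse powers of
    higher order is carried by the smallest values. *)
Lemma sum_inv_power_le (e q : R) : 0 <= e -> e < q ->
  exists2 C, 0 <= C & forall (T : finType) (P : pred T) (kap : T -> R) (A x0 : R),
    0 < x0 -> 0 <= A ->
    (forall x, x0 <= x <= 2 -> #|[pred m | P m && (kap m <= x)]|%:R <= A * x `^ e) ->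
    \sum_(m | P m && (x0 <= kap m <= 1)) kap m `^ (- q) <= C * A * x0 `^ (e - q).
Proof.
move=> e0 eq; set r : R := 2 `^ (e - q).
have r0 : 0 < r by rewrite powR_gt0.
have r1 : r < 1.
  rewrite /r -opprB powRN invf_lt1 ?powR_gt0 // -[ltLHS](one_powR (q - e)).
  by apply: gt0_ltr_powR; rewrite ?subr_gt0 ?nnegrE ?ler01 ?ltr1n.
exists (2 `^ e / (1 - r)) => [|T P kap A x0 x00 A0 cnt].
  by rewrite divr_ge0 ?powR_ge0 // subr_ge0 ltW.
pose D j := [pred m | P m && (2 ^+ j * x0 <= kap m <= 1) && (kap m <= 2 ^+ j.+1 * x0)].
have [J hJ] : exists J, 1 < 2 ^+ J * x0.
  exists (Num.truncn x0^-1).+1; rewrite -ltr_pdivrMr // div1r.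
  have xi : 0 <= x0^-1 by rewrite invr_ge0 ltW.
  have /andP[_ h] := truncn_itv xi.
  apply: lt_le_trans h _; rewrite -natrX ler_nat; apply: ltnW; exact: ltn_expl.
have cov m : P m && (x0 <= kap m <= 1) -> exists j : 'I_J, D j m.
  move=> /andP[Pm /andP[h1 h2]].
  have : exists j, kap m <= 2 ^+ j.+1 * x0.
    exists J; apply: le_trans h2 _; apply: le_trans (ltW hJ) _.
    by rewrite ler_pM2r // ler_weXn2l // ler1n.
  move=> hex; case: (ex_minnP hex) => j hj jmin.
  have low : 2 ^+ j * x0 <= kap m.
    case: j hj jmin => [|j] hj jmin; first by rewrite expr0 mul1r.
    by rewrite leNgt; apply/negP => /ltW /jmin; rewrite ltnn.
  have jJ : (j < J)%N.
    rewrite ltnNge; apply/negP => Jj.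
    suff : 1 < kap m by rewrite ltNge h2.
    apply: lt_le_trans hJ _; apply: le_trans low.
    by rewrite ler_pM2r // ler_weXn2l // ler1n.
  by exists (Ordinal jJ); rewrite /D /= Pm low h2 hj.
have p2 j : 0 < 2 ^+ j * x0 by rewrite mulr_gt0 // exprn_gt0.
apply: le_trans (_ : \sum_(j < J) \sum_(m | D j m) kap m `^ (- q) <= _).
  rewrite (exchange_big_dep (fun m => P m && (x0 <= kap m <= 1))) /=; last first.
    move=> j m _ /andP[/andP[-> /andP[h1 ->]] _] /=; rewrite andbT.
    by apply: le_trans h1; rewrite ler_peMl ?(ltW x00) // exprn_ege1 // ler1n.
  apply: ler_sum => m /cov[j jm]; rewrite (bigD1 j) //= lerDl.
  by apply: sumr_ge0 => ? _; exact: powR_ge0.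
have q0 : 0 < q by exact: le_lt_trans eq.
have bj (j : 'I_J) : \sum_(m | D j m) kap m `^ (- q) <= 2 `^ e * A * x0 `^ (e - q) * r ^+ j.
  have [big|small] := ltP 1 (2 ^+ j * x0).
    rewrite big_pred0; first by rewrite !mulr_ge0 ?powR_ge0 // exprn_ge0 // ltW.
    move=> m; apply/negbTE/negP => /andP[/andP[_ /andP[h1 h2]] _].
    by have := lt_le_trans big (le_trans h1 h2); rewrite ltxx.
  apply: le_trans (_ : \sum_(m | D j m) (2 ^+ j * x0) `^ (- q) <= _).
    apply: ler_sum => m /andP[/andP[_ /andP[h1 _]] _].
    rewrite !powRN lef_pV2 ?posrE ?powR_gt0 //; last exact: lt_le_trans h1.
    by apply: ge0_ler_powR; rewrite ?nnegrE ?(ltW q0) ?(ltW (p2 _)) // (le_trans _ h1) // ltW.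
  rewrite sumr_const -[leLHS]mulr_natl.
  have cj : #|D j|%:R <= A * (2 ^+ j.+1 * x0) `^ e.
    apply: le_trans (cnt (2 ^+ j.+1 * x0) _); last first.
      rewrite exprS -mulrA; have h : x0 <= 2 ^+ j * x0.
        by rewrite ler_peMl ?(ltW x00) // exprn_ege1 // ler1n.
      by apply/andP; split; lra.
    rewrite ler_nat; apply: subset_leq_card; apply/fintype.subsetP => m.
    by rewrite !inE => /andP[/andP[-> _] ->].
  apply: le_trans (_ : A * (2 ^+ j.+1 * x0) `^ e * (2 ^+ j * x0) `^ (- q) <= _).
    by rewrite ler_wpM2r ?powR_ge0.
  have e1 : (2 ^+ j.+1 * x0) `^ e = 2 `^ e * (2 ^+ j * x0) `^ e.
    by rewrite exprS -mulrA powRM // ltW.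
  rewrite e1 (_ : _ * _ * _ = 2 `^ e * A * ((2 ^+ j * x0) `^ e * (2 ^+ j * x0) `^ (- q))); last by ring.
  rewrite -powRD ?(gt_eqF (p2 _)) ?implybT // powRM ?exprn_ge0 ?(ltW x00) //.
  by rewrite /r powR_exprAC // [X in _ * X]mulrC !mulrA.
apply: le_trans (ler_sum _ (fun j _ => bj j)) _.
rewrite -mulr_sumr.
have hr : \sum_(j < J) r ^+ j <= (1 - r)^-1 by apply: geometric_sum_le; rewrite r0.
rewrite [leRHS](_ : _ = 2 `^ e * A * x0 `^ (e - q) * (1 - r)^-1); last by ring.
by rewrite ler_wpM2l // !mulr_ge0 ?powR_ge0.
Qed.

End dyadic_sums.

(** * Counting lattice points in balls and annuli *)

Section radial_counting.
Context {R : realType}.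

Lemma sqrt_sqrD_lipschitz (x y A : R) : 0 <= A ->
  `|Num.sqrt (x ^+ 2 + A) - Num.sqrt (y ^+ 2 + A)| <= `|x - y|.
Proof.
move=> A0; set s := Num.sqrt _; set t := Num.sqrt (y ^+ 2 + A).
have s2 : s ^+ 2 = x ^+ 2 + A by rewrite sqr_sqrtr // addr_ge0 // sqr_ge0.
have t2 : t ^+ 2 = y ^+ 2 + A by rewrite sqr_sqrtr // addr_ge0 // sqr_ge0.
have s0 : 0 <= s by exact: sqrtr_ge0.
have t0 : 0 <= t by exact: sqrtr_ge0.
have xs : `|x| <= s by rewrite -(sqrtr_sqr x) ler_wsqrtr // lerDl.
have yt : `|y| <= t by rewrite -(sqrtr_sqr y) ler_wsqrtr // lerDl.
have [st|st] := leP (s + t) 0.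
  have -> : s = 0 by lra.
  have -> : t = 0 by lra.
  by rewrite subrr normr0.
rewrite -(ler_pM2r st); apply: le_trans (_ : `|x - y| * `|x + y| <= _).
  rewrite -normrM -[X in _ * X <= _](ger0_norm (ltW st)) -normrM.
  by rewrite -subr_sqr s2 t2 -subr_sqr le_eqVlt; apply/orP; left; apply/eqP; congr `|_|; ring.
rewrite ler_wpM2l //; apply: le_trans (ler_normD _ _) _; exact: lerD.
Qed.

Variables (p n : nat).
Hypothesis p0 : (0 < p)%N.
Hypothesis n0 : (0 < n)%N.
Local Notation N := (2 ^ p)%N.
Local Notation ZN := 'Z_N.
Variable I : finType.
Hypothesis I0 : (0 < #|I|)%N.
Local Notation G := {ffun I -> ZN}.
Local Notation D := #|I|.
Let N1 : (1 < N)%N.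
Proof. by rewrite -{1}(expn0 2) ltn_exp2l. Qed.
Let n0' : 0 < n%:R :> R. Proof. by rewrite ltr0n. Qed.

(** The Euclidean norm of a residue vector, in units of [n]. *)
Definition znorm (m : G) : R := Num.sqrt (\sum_i (zrho (m i))%:R ^+ 2) / n%:R.

Lemma znorm_ge0 (m : G) : 0 <= znorm m.
Proof. by rewrite divr_ge0 // sqrtr_ge0. Qed.

Lemma znorm_sqr (m : G) : \sum_i (zrho (m i))%:R ^+ 2 = (n%:R * znorm m) ^+ 2.
Proof.
rewrite /znorm mulrC divfK ?gt_eqF // sqr_sqrtr //.
by apply: sumr_ge0 => i _; exact: sqr_ge0.
Qed.

Lemma zrho_le_znorm (m : G) i : (zrho (m i))%:R <= n%:R * znorm m.
Proof.
rewrite -(@ler_pXn2r _ 2) ?nnegrE ?mulr_ge0 ?znorm_ge0 // -znorm_sqr.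
by rewrite (bigD1 i) //= lerDl; apply: sumr_ge0 => j _; exact: sqr_ge0.
Qed.

Lemma znormE (m : G) i (z : R) : z ^+ 2 = (zrho (m i))%:R ^+ 2 ->
  znorm m = Num.sqrt (rad2 (\sum_(j | j != i) ((zrho (m j))%:R / n%:R) ^+ 2) (z / n%:R)).
Proof.
move=> hz; rewrite /znorm -[n%:R in LHS]gtr0_norm // -sqrtr_sqr -sqrtrV ?sqr_ge0 //.
rewrite -sqrtrM; last by apply: sumr_ge0 => j _; exact: sqr_ge0.
congr Num.sqrt; rewrite /rad2 (bigD1 i) //= mulrDl -hz exprMn exprVn; congr (_ + _).
by rewrite mulr_suml; apply: eq_bigr => j _; rewrite exprMn exprVn.
Qed.

Lemma mulrn_dir i h r : dir p i h *+ r = dir p i (h * r) :> G.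
Proof.
apply/ffunP => j; rewrite !ffunMnE !ffunE; case: ifP => _; last by rewrite mul0rn.
by rewrite natrM mulr_natr.
Qed.

Lemma znorm_dir m i h : `|znorm (m - dir p i h) - znorm m| <= h%:R / n%:R.
Proof.
rewrite (@znormE (m - dir p i h) i _ erefl) (@znormE m i _ erefl).
rewrite (eq_bigr (fun j => ((zrho (m j))%:R / n%:R) ^+ 2)); last first.
  by move=> j ji; rewrite !ffunE (negbTE ji) subr0.
apply: le_trans (sqrt_sqrD_lipschitz _ _ _) _.
  by apply: sumr_ge0 => j _; exact: sqr_ge0.
rewrite -mulrBl normrM normfV (gtr0_norm n0') ler_pM2r ?invr_gt0 //.
have -> : (m - dir p i h) i = m i - h%:R by rewrite !ffunE eqxx.
have [h1 h2] := zrho_shift N1 (m i) h.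
rewrite -(ler_nat R) natrD in h1; rewrite -(ler_nat R) natrD in h2.
by rewrite ler_norml; apply/andP; split; lra.
Qed.

Lemma card_near_le c (y : R) : 0 <= y ->
  #|[pred b : ZN | `|(zrho b)%:R - c%:R| <= y]|%:R <= 4 * y + 2.
Proof.
move=> y0; have /andP[r1 r2] := truncn_itv y0; set r := Num.truncn y in r1 r2.
apply: le_trans (_ : (2 * (2 * r + 1))%N%:R <= _); last first.
  by rewrite natrM natrD natrM; lra.
rewrite ler_nat; apply: leq_trans (card_zrho_near N1 c r).
apply: subset_leq_card; apply/fintype.subsetP => b; rewrite !inE ler_norml => /andP[h1 h2].
rewrite -natr1 in r2.
apply/andP; split; rewrite -ltnS -(ltr_nat R) -natr1 natrD; lra.
Qed.

Lemma card_ball (x : R) : n%:R^-1 <= x ->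
  #|[pred m | znorm m <= x]|%:R <= (6 * n%:R * x) ^+ D.
Proof.
move=> nx; have nx1 : 1 <= n%:R * x by rewrite -ler_pdivrMl // mulr1.
apply: le_trans (_ : #|family (fun _ : I => [pred b : ZN | `|(zrho b)%:R - 0%N%:R| <= n%:R * x])|%:R <= _).
  rewrite ler_nat; apply: subset_leq_card; apply/fintype.subsetP => m; rewrite inE => mx.
  apply/familyP => i; rewrite inE subr0 ger0_norm //.
  by apply: le_trans (zrho_le_znorm m i) _; rewrite ler_wpM2l.
rewrite card_family foldrE big_map big_enum /= prod_nat_const natrX.
rewrite lerXn2r ?nnegrE //; first by rewrite -mulrA mulr_ge0 //; lra.
by apply: le_trans (card_near_le 0 _) _; lra.
Qed.

(** Two points of the fiber differ in coordinate [i] only; the difference of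
    their squared norms is at most [4 n^2 x], and the coordinates themselves are
    at least of the order of [n]. *)
Lemma card_annulus_fiber i (x : R) (m' : G) : n%:R^-1 <= x <= 1 / 4 ->
  #|[pred m : G | [&& `|znorm m - 1| <= x, (n%:R : R) ^+ 2 <= 4 * D%:R * (zrho (m i))%:R ^+ 2 &
      [ffun j => if j == i then 0 else m j] == m']]|%:R <= 18 * D%:R * (n%:R * x).
Proof.
move=> /andP[nx x4]; have nx1 : 1 <= n%:R * x by rewrite -ler_pdivrMl // mulr1.
have D1 : 1 <= D%:R :> R by rewrite ler1n.
have y0 : 0 <= n%:R * x by lra.
have Dy : 0 <= D%:R * (n%:R * x) by rewrite mulr_ge0.
set A := [pred m | _].
have [->|/card_gt0P[m0 m0A]] := posnP #|A|; first by rewrite mulr0n -mulrA mulr_ge0.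
have Ainj : {in A &, injective (fun m : G => m i)}.
  move=> m1 m2; rewrite !inE => /and3P[_ _ /eqP e1] /and3P[_ _ /eqP e2] e.
  apply/ffunP => j; have [->|ji] := eqVneq j i; first exact: e.
  by have := congr1 (fun f : G => f j) (etrans e1 (esym e2)); rewrite !ffunE (negbTE ji).
rewrite -(card_in_image Ainj).
have key m1 m2 : m1 \in A -> m2 \in A ->
    (zrho (m1 i))%:R - (zrho (m2 i))%:R <= 4 * D%:R * (n%:R * x) :> R.
  rewrite !inE => /and3P[a1 b1 /eqP e1] /and3P[a2 b2 /eqP e2].
  have ediff : (zrho (m1 i))%:R ^+ 2 - (zrho (m2 i))%:R ^+ 2 =
      (n%:R * znorm m1) ^+ 2 - (n%:R * znorm m2) ^+ 2.
    rewrite -!znorm_sqr [\sum_j (zrho (m1 j))%:R ^+ 2](bigD1 i) //= [\sum_j (zrho (m2 j))%:R ^+ 2](bigD1 i) //=.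
    rewrite [X in _ = _ - (_ + X)](eq_bigr (fun j => (zrho (m1 j))%:R ^+ 2)); first by ring.
    move=> j ji; have := congr1 (fun f : G => f j) (etrans e1 (esym e2)).
    by rewrite !ffunE (negbTE ji) => ->.
  move: a1 a2; rewrite !ler_norml => /andP[a1 a1'] /andP[a2 a2'].
  set r1 := (zrho (m1 i))%:R in ediff b1 *; set r2 := (zrho (m2 i))%:R in ediff b2 *.
  have low (r : R) : 0 <= r -> n%:R ^+ 2 <= 4 * D%:R * r ^+ 2 -> n%:R <= 2 * D%:R * r.
    move=> r0 h; rewrite -(@ler_pXn2r _ 2) ?nnegrE ?mulr_ge0 //.
    apply: le_trans h _; rewrite !exprMn (_ : 2 ^+ 2 = 4 :> R); last by ring.
    by rewrite ler_wpM2r ?sqr_ge0 // ler_pM2l // expr2 ler_peMl.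
  have l1 : n%:R <= 2 * D%:R * r1 by apply: low => //; rewrite /r1.
  have l2 : n%:R <= 2 * D%:R * r2 by apply: low => //; rewrite /r2.
  have up : r1 ^+ 2 - r2 ^+ 2 <= n%:R ^+ 2 * (4 * x).
    rewrite ediff; move: (znorm_ge0 m1) (znorm_ge0 m2) a1' a2.
    move: (znorm m1) (znorm m2) => z1 z2 z10 z20 h1 h2.
    rewrite !exprMn -mulrBr ler_wpM2l ?sqr_ge0 //.
    have k1 : z1 ^+ 2 <= (1 + x) ^+ 2 by rewrite lerXn2r ?nnegrE //; lra.
    have k2 : (1 - x) ^+ 2 <= z2 ^+ 2 by rewrite lerXn2r ?nnegrE //; lra.
    lra.
  have [h|h] := leP r1 r2; first by rewrite -mulrA; lra.
  have : (r1 - r2) * n%:R <= 4 * D%:R * (n%:R * x) * n%:R.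
    apply: le_trans (_ : (r1 - r2) * (D%:R * (r1 + r2)) <= _).
      by rewrite ler_wpM2l ?subr_ge0 ?(ltW h) //; lra.
    rewrite (_ : _ * (_ * _) = D%:R * (r1 ^+ 2 - r2 ^+ 2)); last by ring.
    rewrite [leRHS](_ : _ = D%:R * (n%:R ^+ 2 * (4 * x))); last by ring.
    by rewrite ler_wpM2l.
  by rewrite ler_pM2r.
apply: le_trans (_ : 4 * (4 * D%:R * (n%:R * x)) + 2 <= _); last by nra.
apply: le_trans (card_near_le (zrho (m0 i)) _); last by rewrite -mulrA mulr_ge0.
rewrite ler_nat; apply: subset_leq_card; apply/fintype.subsetP => b /fintype.imageP[m mA ->].
rewrite inE ler_norml; have := key _ _ mA m0A; have := key _ _ m0A mA; lra.
Qed.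

(** Lattice points near a sphere: some coordinate is comparable to the radius,
    and along it the annulus has width of the order of [x]. *)
Lemma card_annulus (X x : R) : n%:R^-1 <= x <= X ->
  #|[pred m | `|znorm m - 1| <= x]|%:R <=
    (4 * (6 * (1 + X)) ^+ D + 18 * D%:R ^+ 2 * 10 ^+ D) * (n%:R ^+ D * x).
Proof.
move=> /andP[nx xX]; have nx1 : 1 <= n%:R * x by rewrite -ler_pdivrMl // mulr1.
have x0 : 0 < x by apply: lt_le_trans nx; rewrite invr_gt0.
have D1 : 1 <= D%:R :> R by rewrite ler1n.
have n1 : 1 <= n%:R :> R by rewrite ler1n.
have P1 : 0 <= 4 * (6 * (1 + X)) ^+ D * (n%:R ^+ D * x).
  by rewrite !mulr_ge0 ?exprn_ge0 ?mulr_ge0 //; lra.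
have P2 : 0 <= 18 * D%:R ^+ 2 * 10 ^+ D * (n%:R ^+ D * x).
  by rewrite !mulr_ge0 ?exprn_ge0 //; lra.
rewrite mulrDl; have [x4|x4] := leP (1 / 4) x.
  apply: le_trans (_ : (6 * n%:R * (1 + X)) ^+ D <= _).
    apply: le_trans (card_ball _); last by apply: le_trans nx _; lra.
    rewrite ler_nat; apply: subset_leq_card; apply/fintype.subsetP => m.
    by rewrite !inE ler_norml; lra.
  rewrite -[leLHS]addr0 lerD //.
  rewrite (_ : 6 * n%:R * (1 + X) = (6 * (1 + X)) * n%:R); last by ring.
  rewrite exprMn.
  have Q0 : 0 <= (6 * (1 + X)) ^+ D * n%:R ^+ D by rewrite mulr_ge0 ?exprn_ge0 ?mulr_ge0 //; lra.
  by rewrite (_ : 4 * _ * _ = (6 * (1 + X)) ^+ D * n%:R ^+ D * (4 * x)); [nra|ring].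
rewrite -[leLHS]add0r lerD //.
pose A i := [pred m : G | `|znorm m - 1| <= x & (n%:R : R) ^+ 2 <= 4 * D%:R * (zrho (m i))%:R ^+ 2].
have cov (m : G) : `|znorm m - 1| <= x -> exists i, A i m.
  move=> mx; apply/existsP; rewrite -[X in is_true X]negbK negb_exists; apply/negP => /forallP h.
  have hs i : 4 * D%:R * (zrho (m i))%:R ^+ 2 <= n%:R ^+ 2 :> R.
    by have := h i; rewrite /A /= mx /= -ltNge => /ltW.
  have : \sum_(i : I) 4 * D%:R * (zrho (m i))%:R ^+ 2 <= \sum_(i : I) n%:R ^+ 2 :> R by exact: ler_sum.
  rewrite -mulr_sumr znorm_sqr sumr_const -[X in _ <= X -> _]mulr_natl.
  rewrite -mulrA [X in X <= _ -> _]mulrCA ler_pM2l; last exact: lt_le_trans D1.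
  rewrite exprMn mulrCA -[X in _ <= X -> _]mulr1 ler_pM2l ?exprn_gt0 //.
  by move: mx; rewrite ler_norml; nra.
have cA i : #|A i|%:R <= (10 * n%:R) ^+ D * (18 * D%:R * (n%:R * x)) / (10 * n%:R).
  pose f (m : G) : G := [ffun j => if j == i then 0 else m j].
  pose F (j : I) : {pred ZN} := [pred b : ZN | if j == i then b == 0 else `|(zrho b)%:R - 0%N%:R| <= 2 * n%:R :> R].
  have fF m : A i m -> f m \in family F.
    move=> /andP[mx _]; apply/familyP => j; rewrite inE ffunE; case: eqP => // _.
    rewrite subr0 ger0_norm //; apply: le_trans (zrho_le_znorm m j) _.
    by rewrite mulrC ler_pM2r //; move: mx; rewrite ler_norml; lra.
  have -> : #|A i|%:R = \sum_(m' in family F) #|[pred m : G | [&& `|znorm m - 1| <= x,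
       (n%:R : R) ^+ 2 <= 4 * D%:R * (zrho (m i))%:R ^+ 2 & f m == m']]|%:R :> R.
    rewrite -natr_sum; congr _%:R; rewrite -sum1_card (partition_big f (mem (family F))) //=.
    apply: eq_bigr => m' _; rewrite -[RHS]sum1_card; apply: eq_bigl => m.
    by rewrite !inE andbA.
  apply: le_trans (_ : \sum_(m' in family F) 18 * D%:R * (n%:R * x) <= _).
    by apply: ler_sum => m' _; apply: card_annulus_fiber; rewrite nx ltW.
  rewrite sumr_const -[leLHS]mulr_natl [leRHS]mulrAC.
  apply: ler_wpM2r; first by rewrite mulr_ge0 ?mulr_ge0 //; lra.
  rewrite ler_pdivlMr ?mulr_gt0 // card_family foldrE big_map big_enum /=.
  rewrite (bigD1 i) //= natrM natr_prod -prodr_const [leRHS](bigD1 i) //= mulrC.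
  rewrite ler_wpM2l ?mulr_ge0 // -[leRHS]mul1r ler_pM ?prodr_ge0 //.
    rewrite (ler_nat _ _ 1) -[X in (_ <= X)%N](card1 (0 : ZN)).
    by apply: subset_leq_card; apply/fintype.subsetP => b; rewrite !inE eqxx.
  apply: ler_prod => j ji; rewrite ler0n /=.
  apply: le_trans (_ : 4 * (2 * n%:R) + 2 <= _); last by lra.
  apply: le_trans (card_near_le 0 _); last by rewrite mulr_ge0.
  rewrite ler_nat; apply: subset_leq_card; apply/fintype.subsetP => b.
  by rewrite !inE (negbTE ji).
apply: le_trans (_ : \sum_(i : I) #|A i|%:R <= _).
  rewrite -natr_sum ler_nat -sum1_card.
  under [leqRHS]eq_bigr do rewrite -sum1_card.
  rewrite (exchange_big_dep (fun m => `|znorm m - 1| <= x)) /=; last by move=> i m _ /andP[].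
  apply: leq_sum => m /cov[i im]; rewrite (bigD1 i) //=.
apply: le_trans (ler_sum _ (fun i _ => cA i)) _.
rewrite sumr_const -[leLHS]mulr_natl.
have -> : (10 * n%:R) ^+ D * (18 * D%:R * (n%:R * x)) / (10 * n%:R) =
   (10 ^+ D * n%:R ^+ D) * (18 * D%:R * x) / 10 by rewrite exprMn; field; rewrite gt_eqF.
have Q0 : 0 <= 10 ^+ D * n%:R ^+ D :> R by rewrite mulr_ge0 ?exprn_ge0.
rewrite [leLHS](_ : _ = (18 * D%:R ^+ 2 * 10 ^+ D * (n%:R ^+ D * x)) / 10); last by field.
lra.
Qed.

End radial_counting.

(** * Differences of the radial profile, pointwise *)

Section radial_differences.
Context {R : realType}.
Variables (gamma alpha : R).
Hypothesis gamma1 : 1 <= gamma.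
Hypothesis alpha0 : 0 < alpha.
Variable k : nat.
Hypothesis gk : gamma <= k%:R.
Hypothesis ak : alpha <= k%:R.
Let gamma0 : 0 < gamma. Proof. exact: lt_le_trans gamma1. Qed.
Let k1 : 1 <= k%:R :> R. Proof. exact: le_trans gk. Qed.

Lemma riesz_gap_dist (s t : R) : 0 <= s -> 0 <= t ->
  `|riesz_gap gamma s - riesz_gap gamma t| <= k%:R * `|s - t|.
Proof.
wlog st : s t / s <= t.
  move=> H s0 t0; have [st|/ltW st] := leP s t; first exact: H.
  by rewrite distrC [X in _ * X]distrC; exact: H.
move=> s0 t0; rewrite ger0_norm; last by rewrite subr_ge0 riesz_gap_mono // s0.
rewrite distrC ger0_norm ?subr_ge0 //; apply: riesz_gap_lipschitz => //.
by rewrite s0.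
Qed.

Lemma riesz_profile_near1 (s : R) : 0 <= s ->
  `|riesz_profile gamma alpha s - 1| <= k%:R * s.
Proof.
move=> s0; rewrite distrC ger0_norm; last first.
  by rewrite subr_ge0 riesz_profile_le1.
have h1 : 1 - riesz_gap gamma s <= s.
  have [s1|s1] := leP 1 s; first by rewrite riesz_gap_eq0 // subr0.
  rewrite riesz_gapE ?s0 ?(ltW s1) // opprB addrC subrK.
  have [->|sp] := eqVneq s 0; first by rewrite powR0 // gt_eqF.
  by apply: ge1r_powR => //; rewrite (ltW s1) lt_neqAle eq_sym sp s0.
have h2 : 1 - riesz_gap gamma s `^ alpha <= k%:R * (1 - riesz_gap gamma s).
  have y0 := riesz_gap_ge0 gamma s; have y1 := riesz_gap_le1 gamma s.
  have [a1|a1] := leP 1 alpha.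
    rewrite -[X in X - _](one_powR alpha); apply: powR_lipschitz => //.
      by rewrite y0 y1.
    by rewrite a1 ak.
  apply: le_trans (_ : 1 - riesz_gap gamma s <= _); last first.
    by rewrite ler_peMl // subr_ge0.
  rewrite lerB //; have [->|yp] := eqVneq (riesz_gap gamma s) 0; first exact: powR_ge0.
  by apply: ger1_powR; rewrite ?(ltW a1) // y1 lt_neqAle eq_sym yp y0.
apply: le_trans h2 _; rewrite ler_wpM2l //.
Qed.

Lemma riesz_gap_sqrt (a y : R) : 0 <= a ->
  riesz_gap gamma (Num.sqrt (rad2 a y)) = Num.max 0 (gap2 gamma a y).
Proof.
move=> a0; rewrite /riesz_gap /gap2 -powR12_sqrt; last by rewrite addr_ge0 ?sqr_ge0.
by rewrite -powRrM [2^-1 * _]mulrC.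
Qed.

Variable S : nat.
Hypothesis kS : (k <= S)%N.
Let gS : gamma <= S%:R. Proof. by apply: le_trans gk _; rewrite ler_nat. Qed.
Let aS : alpha <= S%:R. Proof. by apply: le_trans ak _; rewrite ler_nat. Qed.
Let S0 : (0 < S)%N.
Proof. by apply: leq_trans kS; rewrite -(ler_nat R) (le_trans _ k1). Qed.

Section at_frequency.
Variables (p n h : nat) (I : finType).
Hypothesis p0 : (0 < p)%N.
Hypothesis n0 : (0 < n)%N.
Hypothesis pn : (2 * (n + h * S) <= 2 ^ p)%N.
Hypothesis h0 : (0 < h)%N.
Local Notation ZN := 'Z_(2 ^ p).
Local Notation G := {ffun I -> ZN}.
Let N1 : (1 < 2 ^ p)%N.
Proof. by rewrite -{1}(expn0 2) ltn_exp2l. Qed.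
Let n0' : 0 < n%:R :> R. Proof. by rewrite ltr0n. Qed.
Local Notation M := (fun m : G => riesz_profile gamma alpha (znorm n m : R)).
Variable eta : R.
Hypothesis etaE : eta = h%:R / n%:R.
Variables E F : R.
Hypothesis EE : E = S%:R * eta.
Hypothesis FE : F = k%:R * E.
Variables (i : I) (m : G).
Local Notation Delta := (iter S (gdiff (dir p i h)) M m).
Let eta0 : 0 < eta. Proof. by rewrite etaE divr_gt0 // ltr0n. Qed.
Let Se0 : 0 < E. Proof. by rewrite EE mulr_gt0 // ltr0n. Qed.
Let kSe : 0 < F. Proof. by rewrite FE mulr_gt0 // (lt_le_trans _ k1). Qed.

Let shift_znorm r : (r <= S)%N ->
  `|znorm n (m - dir p i h *+ r) - znorm n m| <= E.
Proof.
move=> rS; rewrite mulrn_dir; apply: le_trans; first exact: znorm_dir.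
by rewrite natrM mulrAC -etaE mulrC EE ler_wpM2r ?(ltW eta0) // ler_nat.
Qed.

Let shift_gap r : (r <= S)%N ->
  `|riesz_gap gamma (znorm n (m - dir p i h *+ r)) - riesz_gap gamma (znorm n m : R)|
     <= F.
Proof.
move=> rS; apply: le_trans (riesz_gap_dist _ _) _; rewrite ?znorm_ge0 //.
by rewrite FE ler_wpM2l // shift_znorm.
Qed.

(** Four regimes: outside the ball the difference vanishes; near the sphere the
    profile itself is small; near the origin the profile is close to one, and
    differences of positive order do not see constants; in between the profile
    is smooth along the whole segment. *)
Lemma Delta_outside : 1 + E <= znorm n m -> Delta = 0.
Proof.
move=> h1; apply/eqP; rewrite -normr_le0 -[leRHS](mulr0 (2 ^+ S)).
apply: iter_gdiff_le => r rS; have := shift_znorm rS; rewrite ler_norml => /andP[h2 _].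
by rewrite riesz_profile_eq0 ?normr0 //; lra.
Qed.

Lemma Delta_boundary : riesz_gap gamma (znorm n m : R) <= 2 * F ->
  `|Delta| <= 2 ^+ S * (3 * F) `^ alpha.
Proof.
move=> h1; apply: iter_gdiff_le => r rS; have F0 := kSe.
rewrite ger0_norm ?riesz_profile_ge0 // /riesz_profile.
apply: ge0_ler_powR; rewrite ?nnegrE ?riesz_gap_ge0 ?(ltW alpha0) //; first by lra.
have := shift_gap rS; rewrite ler_norml => /andP[_ h2].
rewrite (_ : 3 * F = 2 * F + F); last by ring.
apply: le_trans (_ : riesz_gap gamma (znorm n m : R) + F <= _).
  by rewrite -lerBlDl.
by rewrite lerD2r.
Qed.

Lemma Delta_origin : znorm n m <= 2 * E ->
  `|Delta| <= 2 ^+ S * (3 * F).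
Proof.
move=> h1; rewrite -(iter_gdiff_subc _ _ _ 1 S0).
apply: iter_gdiff_le => r rS.
apply: le_trans (riesz_profile_near1 _) _; first exact: znorm_ge0.
rewrite FE [leRHS]mulrCA ler_wpM2l //.
by have := shift_znorm rS; rewrite ler_norml => /andP[_ h2]; lra.
Qed.

Lemma Delta_interior (C : R) :
  (forall a t, 0 <= a -> 0 < rad2 a t <= 1 -> 0 < gap2 gamma a t <= 1 ->
    `|radial_derive gamma alpha a S t| <=
       C * (rad2 a t `^ ((gamma - S%:R) / 2) * gap2 gamma a t `^ (alpha - S%:R))) ->
  0 <= C ->
  2 * F < riesz_gap gamma (znorm n m : R) -> 2 * E < znorm n m :> R ->
  [/\ znorm n m <= 1 :> R, 2 * E <= 1 - znorm n m &
  `|Delta| <= eta ^+ S * (C * ((znorm n m / 2) `^ (1 - S%:R) *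
                             ((1 - znorm n m) / 2) `^ (alpha - S%:R)))].
Proof.
move=> hC C0 hgap hnorm; have F0 := kSe; have E0 := Se0.
set zm : R := znorm n m in hgap hnorm *.
have zm0 : 0 <= zm by exact: znorm_ge0.
have kp : 0 < k%:R :> R by exact: lt_le_trans k1.
have zm1 : zm < 1.
  by rewrite ltNge; apply/negP => /(riesz_gap_eq0 gamma1) e; move: hgap; rewrite e; lra.
have gapl : riesz_gap gamma zm <= k%:R * (1 - zm).
  have := @riesz_gap_lipschitz _ gamma gamma1 zm 1 k; rewrite (riesz_gap_eq0 gamma1 (lexx 1)) subr0.
  by apply=> //; rewrite zm0 ltW.
have low1 : 2 * E <= 1 - zm.
  rewrite -(ler_pM2l kp); apply: le_trans gapl; apply: le_trans (ltW hgap).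
  by rewrite FE mulrCA.
split=> //; first exact: ltW.
have gapg : 1 - zm <= riesz_gap gamma zm.
  rewrite riesz_gapE ?zm0 ?(ltW zm1) // lerB //.
  by apply: ge1r_powR => //; rewrite (ltW zm1) andbT; apply: lt_trans hnorm; lra.
pose a : R := \sum_(j | j != i) ((zrho (m j))%:R / n%:R) ^+ 2.
have a0 : 0 <= a by apply: sumr_ge0 => j _; exact: sqr_ge0.
have [e me] := zrho_repr N1 (m i).
pose z : int := (-1) ^+ e * (zrho (m i))%:Z.
have mz : m i = z%:~R by rewrite {1}me rmorphM rmorphXn rmorphN1.
have zabs : `|z|%N = zrho (m i) by rewrite abszMsign.
have rhon : (zrho (m i) <= n)%N.
  rewrite -(ler_nat R); apply: le_trans (zrho_le_znorm n0 m i) _.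
  by rewrite ler_piMr // ltW.
pose tau : R := z%:~R / n%:R.
(* the modulus is so large that the segment does not wrap around, so the
   difference is that of a function on the real line *)
have grid r : (r <= S)%N ->
    znorm n (m - dir p i h *+ r) = Num.sqrt (rad2 a (tau - eta *+ r)) :> R.
  move=> rS; rewrite mulrn_dir.
  have mi : (m - dir p i (h * r)) i = (z - (h * r)%:Z)%:~R.
    by rewrite !ffunE eqxx mz rmorphB.
  have zr : zrho ((m - dir p i (h * r)) i) = `|z - (h * r)%:Z|%N.
    rewrite mi zrho_int //; apply: leq_trans pn; rewrite -mul2n leq_pmul2l //.
    apply: leq_trans (_ : `|z| + h * r <= _)%N; last first.
      by rewrite zabs leq_add // leq_pmul2l.
    by rewrite -lez_nat PoszD !abszE; apply: le_trans (ler_normB _ _) _; rewrite lerD2l ger0_norm.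
  rewrite (@znormE _ _ _ n0 _ _ i ((z - (h * r)%:Z)%:~R)); last first.
    by rewrite zr natr_absz intr_norm real_normK ?num_real.
  congr (Num.sqrt (rad2 _ _)).
    by apply: eq_bigr => j ji; rewrite !ffunE (negbTE ji) subr0.
  rewrite rmorphB /= mulrBl -[eta *+ r]mulr_natr; congr (_ - _).
  by rewrite -pmulrn natrM mulrAC -etaE.
have zmE : zm = Num.sqrt (rad2 a tau).
  by have := grid 0%N isT; rewrite !mulr0n !subr0.
have seg y : tau - eta *+ S <= y <= tau ->
    `|Num.sqrt (rad2 a y) - zm| <= E.
  move=> /andP[y1 y2]; rewrite zmE; apply: le_trans (sqrt_sqrD_lipschitz _ _ a0) _.
  by rewrite distrC ger0_norm ?subr_ge0 // EE mulr_natl; lra.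
(* half of the distance to the origin and half of the gap survive on the
   segment *)
have seg2 y : tau - eta *+ S <= y <= tau ->
    [/\ zm / 2 <= Num.sqrt (rad2 a y), Num.sqrt (rad2 a y) < 1 &
        riesz_gap gamma zm / 2 <= gap2 gamma a y].
  move=> hy; have hs := seg y hy.
  have gd := riesz_gap_dist (sqrtr_ge0 (rad2 a y)) zm0.
  have gd2 : `|riesz_gap gamma (Num.sqrt (rad2 a y)) - riesz_gap gamma zm| <= F.
    by apply: le_trans gd _; rewrite FE ler_wpM2l.
  have gp : riesz_gap gamma zm / 2 <= riesz_gap gamma (Num.sqrt (rad2 a y)).
    by move: gd2; rewrite ler_norml; lra.
  have gpos : 0 < riesz_gap gamma (Num.sqrt (rad2 a y)) by apply: lt_le_trans gp; lra.
  split.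
  - by move: hs; rewrite ler_norml; lra.
  - rewrite ltNge; apply/negP => /(riesz_gap_eq0 gamma1) e0.
    by move: gpos; rewrite e0 ltxx.
  - rewrite (riesz_gap_sqrt _ a0) in gp gpos; move: gpos; rewrite lt_max ltxx /= => g0.
    by rewrite (max_r (ltW g0)) in gp.
have gz : 0 < riesz_gap gamma zm by lra.
have facts y : tau - eta *+ S <= y <= tau -> 0 < rad2 a y <= 1 /\ 0 < gap2 gamma a y <= 1.
  move=> hy; have [y1 y2 y3] := seg2 y hy.
  have sp : 0 < Num.sqrt (rad2 a y) by apply: lt_le_trans y1; lra.
  have rp : 0 < rad2 a y by rewrite -sqrtr_gt0.
  split; apply/andP; split => //.
  - by rewrite -(sqr_sqrtr (ltW rp)) exprn_ile1 // ltW.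
  - by apply: lt_le_trans y3; lra.
  - by rewrite /gap2 gerBl powR_ge0.
have tauS r : (r <= S)%N -> tau - eta *+ S <= tau - eta *+ r <= tau.
  move=> rS; rewrite gerBl mulrn_wge0 ?(ltW eta0) // andbT lerB //.
  by rewrite -[eta *+ S]mulr_natr -[eta *+ r]mulr_natr ler_wpM2l ?(ltW eta0) // ler_nat.
rewrite (@iter_gdiff_eq _ _ _ _ eta M (radial_derive gamma alpha a 0) S m tau); last first.
  move=> r rS; rewrite grid // /radial_derive /riesz_profile riesz_gap_sqrt //.
  have [_ /andP[/ltW h1 _]] := facts _ (tauS _ rS).
  by rewrite max_r.
apply: (@iter_gdiff_derive _ S (radial_derive gamma alpha a) tau eta) => //.
- exact: ltW.
- move=> j y jS hy; have [/andP[w0 _] /andP[v0 _]] := facts y hy.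
  exact: is_derive_radial.
move=> y hy; have [w01 v01] := facts y hy; apply: le_trans (hC _ _ a0 w01 v01) _.
have [y1 y2 y3] := seg2 y hy; have /andP[w0 w1] := w01; have /andP[v0 v1] := v01.
rewrite ler_wpM2l //; apply: ler_pM; rewrite ?powR_ge0 //.
  apply: le_trans (_ : (zm / 2) `^ (gamma - S%:R) <= _); last first.
    by apply: ger_powR; [lra|rewrite lerB].
  rewrite (_ : (gamma - S%:R) / 2 = 2^-1 * (gamma - S%:R)); last by rewrite mulrC.
  rewrite powRrM powR12_sqrt ?(ltW w0) // -opprB !powRN lef_pV2 ?posrE ?powR_gt0 //; last 2 first.
  - by lra.
  - by lra.
  by apply: ge0_ler_powR; rewrite ?nnegrE ?subr_ge0 ?sqrtr_ge0 //; lra.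
rewrite -opprB !powRN lef_pV2 ?posrE ?powR_gt0 //; last by lra.
have d0 : 0 <= (1 - zm) / 2 by lra.
apply: ge0_ler_powR; rewrite ?nnegrE ?d0 ?(ltW v0) ?subr_ge0 //.
by apply: le_trans y3; rewrite ler_pM2r ?invr_gt0.
Qed.

End at_frequency.
End radial_differences.

(** * The radial kernel above the critical index *)

Section radial_kernel.
Context {R : realType}.

(** One of two numbers with sum one is at least one half, so only one of the
    two singularities is felt at a time. *)
Lemma powRN_product_split (z a b s : R) : 0 < z < 1 -> 0 <= a <= s -> 0 <= b <= s ->
  ((z / 2) `^ (- a) * ((1 - z) / 2) `^ (- b)) ^+ 2 <=
    (8 `^ s) ^+ 2 * (z `^ (- (2 * a)) + (1 - z) `^ (- (2 * b))).
Proof.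
move=> /andP[z0 z1] /andP[a0 as_] /andP[b0 bs].
have s0 : 0 <= s by exact: le_trans as_.
have sqE (x c : R) : 0 <= x -> (x `^ (- c)) ^+ 2 = x `^ (- (2 * c)).
  by move=> x0; rewrite -powR_mulrn ?powR_ge0 // -powRrM mulNr mulrC.
have big (x c : R) : 4^-1 <= x -> 0 <= c <= s -> x `^ (- c) <= 4 `^ s.
  move=> x4 /andP[c0 cs]; have xp : 0 < x by apply: lt_le_trans x4; rewrite invr_gt0.
  apply: le_trans (_ : 4 `^ c <= _); last by apply: ler_powR => //; rewrite ler1n.
  rewrite powRN -[leLHS]mul1r ler_pdivrMr ?powR_gt0 // -powRM ?(ltW xp) //.
  rewrite -[leLHS](one_powR c); apply: ge0_ler_powR; rewrite ?nnegrE ?mulr_ge0 ?(ltW xp) //.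
  by rewrite -ler_pdivrMl // mulr1.
have half (x c : R) : 0 < x -> 0 <= c <= s -> (x / 2) `^ (- c) <= 2 `^ s * x `^ (- c).
  move=> x0 /andP[c0 cs]; rewrite powRM ?invr_ge0 ?(ltW x0) // mulrC ler_wpM2r ?powR_ge0 //.
  rewrite -powR_inv1 // -powRrM mulrNN mul1r.
  by apply: ler_powR; rewrite ?ler1n.
have e8 : 8 `^ s = 4 `^ s * 2 `^ s :> R.
  by rewrite -powRM // -natrM.
have p4 : 0 <= 4 `^ s :> R by exact: powR_ge0.
have p2 : 0 <= 2 `^ s :> R by exact: powR_ge0.
have hz : 0 <= z `^ (- (2 * a)) by exact: powR_ge0.
have h1z : 0 <= (1 - z) `^ (- (2 * b)) by exact: powR_ge0.
have z1' : 0 < 1 - z by rewrite subr_gt0.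
rewrite e8; have [h|h] := leP (2^-1) z.
  apply: le_trans (_ : (4 `^ s * (2 `^ s * (1 - z) `^ (- b))) ^+ 2 <= _).
    rewrite lerXn2r ?nnegrE ?mulr_ge0 ?powR_ge0 //.
    apply: ler_pM; rewrite ?powR_ge0 ?big ?half ?a0 ?b0 //.
    by rewrite ler_pdivlMr // (_ : 4^-1 * 2 = 2^-1) //; field.
  rewrite mulrA exprMn sqE ?(ltW z1') // ler_wpM2l ?sqr_ge0 //.
  by rewrite lerDr.
apply: le_trans (_ : ((2 `^ s * z `^ (- a)) * 4 `^ s) ^+ 2 <= _).
  rewrite lerXn2r ?nnegrE ?mulr_ge0 ?powR_ge0 //.
  apply: ler_pM; rewrite ?powR_ge0 ?big ?half ?a0 ?b0 //.
  by rewrite ler_pdivlMr // (_ : 4^-1 * 2 = 2^-1); [lra|field].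
rewrite mulrAC exprMn sqE ?(ltW z0) // [2 `^ s * _]mulrC ler_wpM2l ?sqr_ge0 //.
by rewrite lerDl.
Qed.

Variables (gamma alpha : R).
Hypothesis gamma1 : 1 <= gamma.
Hypothesis alpha0 : 0 < alpha.
Variable I : finType.
Hypothesis I0 : (0 < #|I|)%N.
Local Notation D := #|I|.
Hypothesis alphaD : (D%:R - 1) / 2 < alpha.

Section constants.
Variables (k : nat) (C0 C1 C2 : R).
Hypothesis gk : gamma <= k%:R.
Hypothesis ak : alpha <= k%:R.
Local Notation S := (k + D).+1.
Hypothesis C00 : 0 <= C0.
Hypothesis hC0 : forall a t, 0 <= a -> 0 < rad2 a t <= 1 -> 0 < gap2 gamma a t <= 1 ->
    `|radial_derive gamma alpha a S t| <=
       C0 * (rad2 a t `^ ((gamma - S%:R) / 2) * gap2 gamma a t `^ (alpha - S%:R)).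
Local Notation q1 := (2 * (k + D)%:R : R).
Local Notation q2 := (2 * (S%:R - alpha) : R).
Hypothesis C10 : 0 <= C1.
Hypothesis hC1 : forall (T : finType) (P : pred T) (kap : T -> R) (A x0 : R),
    0 < x0 -> 0 <= A ->
    (forall x, x0 <= x <= 2 -> #|[pred m | P m && (kap m <= x)]|%:R <= A * x `^ D%:R) ->
    \sum_(m | P m && (x0 <= kap m <= 1)) kap m `^ (- q1) <= C1 * A * x0 `^ (D%:R - q1).
Hypothesis C20 : 0 <= C2.
Hypothesis hC2 : forall (T : finType) (P : pred T) (kap : T -> R) (A x0 : R),
    0 < x0 -> 0 <= A ->
    (forall x, x0 <= x <= 2 -> #|[pred m | P m && (kap m <= x)]|%:R <= A * x `^ 1) ->
    \sum_(m | P m && (x0 <= kap m <= 1)) kap m `^ (- q2) <= C2 * A * x0 `^ (1 - q2).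

Variables ks CA Q : R.
Hypothesis ksE : ks = k%:R * S%:R.
Hypothesis CAE : CA = 4 * (6 * (1 + (4 * ks + 2))) ^+ D + 18 * D%:R ^+ 2 * 10 ^+ D.
Hypothesis QE : Q = (2 ^+ S * C0) ^+ 2 * (8 `^ S%:R) ^+ 2.

Let ks0 : 0 < ks.
Proof. by rewrite ksE mulr_gt0 // (lt_le_trans _ gk) // (lt_le_trans _ gamma1). Qed.
Let CA0 : 0 <= CA.
Proof.
rewrite CAE addr_ge0 // !mulr_ge0 ?exprn_ge0 // mulr_ge0 //.
by rewrite !addr_ge0 // mulr_ge0 // ltW.
Qed.
Let Q0 : 0 <= Q. Proof. by rewrite QE mulr_ge0 ?sqr_ge0. Qed.

Variables (p n h : nat).
Hypothesis p0 : (0 < p)%N.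
Hypothesis n0 : (0 < n)%N.
Hypothesis pn : (2 * (n + h * S) <= 2 ^ p)%N.
Hypothesis h0 : (0 < h)%N.
Hypothesis hn : (h <= 2 * n)%N.
Local Notation ZN := 'Z_(2 ^ p).
Local Notation G := {ffun I -> ZN}.
Local Notation z m := (znorm n m : R).
Variable i : I.
Local Notation Delta m := (iter S (gdiff (dir p i h))
  (fun m : G => riesz_profile gamma alpha (znorm n m)) m).
Variables u E F : R.
Hypothesis uE : u = h%:R / (2 * n%:R).
Hypothesis EE : E = 2 * S%:R * u.
Hypothesis FE : F = 2 * ks * u.

Let np : 0 < n%:R :> R. Proof. by rewrite ltr0n. Qed.
Let u0 : 0 < u. Proof. by rewrite uE divr_gt0 ?mulr_gt0 // ltr0n. Qed.
Let u1 : u <= 1.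
Proof. by rewrite uE ler_pdivrMr ?mulr_gt0 // mul1r -natrM ler_nat. Qed.
Let etaE : 2 * u = h%:R / n%:R.
Proof. by rewrite uE; field; rewrite gt_eqF. Qed.
Let EE' : E = S%:R * (2 * u). Proof. by rewrite EE; ring. Qed.
Let FE' : F = k%:R * E. Proof. by rewrite FE EE ksE; ring. Qed.
Let S1 : 1 <= S%:R :> R. Proof. by rewrite ler1n. Qed.
Let k1 : 1 <= k%:R :> R. Proof. exact: le_trans gk. Qed.
Let nu : n%:R^-1 <= 2 * u.
Proof. by rewrite etaE -[leLHS]mul1r ler_pM2r ?invr_gt0 // ler1n. Qed.
Let E0 : 0 < E.
Proof. by rewrite EE' mulr_gt0 // ?mulr_gt0 // (lt_le_trans _ S1). Qed.
Let EF : E <= F. Proof. by rewrite FE' ler_peMl // ltW. Qed.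
Let F0 : 0 < F. Proof. exact: lt_le_trans EF. Qed.
Let nE : n%:R^-1 <= 2 * E.
Proof.
apply: le_trans nu _; rewrite EE' [leRHS]mulrA ler_peMl ?mulr_ge0 ?(ltW u0) //.
by rewrite -[leLHS]mulr1 ler_pM // ler1n.
Qed.
Let nF : n%:R^-1 <= 2 * F.
Proof. by apply: le_trans nE _; rewrite ler_pM2l. Qed.
Let FX : 2 * F <= 4 * ks + 2.
Proof.
rewrite FE (_ : 2 * (2 * ks * u) = 4 * ks * u); last by ring.
by rewrite -[leLHS]addr0 lerD // ler_piMr // mulr_ge0 // ltW.
Qed.
Let X2 : 2 <= 4 * ks + 2.
Proof. by rewrite lerDr mulr_ge0 // ltW. Qed.

Let annulus x : n%:R^-1 <= x <= 4 * ks + 2 ->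
  #|[pred m : G | `|z m - 1| <= x]|%:R <= CA * (n%:R ^+ D * x).
Proof. by move=> hx; rewrite CAE; exact: card_annulus. Qed.

(** [T1] near the sphere, [T2] near the origin, and in between [T3] and [T4] for
    the singularities of the derivative at the origin and at the sphere. *)
Let T1 (m : G) : R := (`|z m - 1| <= 2 * F)%R%:R * (2 ^+ S * (3 * F) `^ alpha) ^+ 2.
Let T2 (m : G) : R := (z m <= 2 * E)%R%:R * (2 ^+ S * (3 * F)) ^+ 2.
Let T3 (m : G) : R := (2 * E <= z m <= 1)%R%:R * (Q * u ^+ (2 * S) * z m `^ (- q1)).
Let T4 (m : G) : R := ((z m <= 1) && (2 * E <= 1 - z m <= 1))%R%:R *
   (Q * u ^+ (2 * S) * (1 - z m) `^ (- q2)).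

Let Qu0 : 0 <= Q * u ^+ (2 * S).
Proof. by apply: mulr_ge0 => //; rewrite exprn_ge0 // ltW. Qed.
Let T1_ge0 m : 0 <= T1 m. Proof. by apply: mulr_ge0 => //; exact: sqr_ge0. Qed.
Let T2_ge0 m : 0 <= T2 m. Proof. by apply: mulr_ge0 => //; exact: sqr_ge0. Qed.
Let T3_ge0 m : 0 <= T3 m.
Proof. by apply: mulr_ge0 => //; apply: mulr_ge0 => //; exact: powR_ge0. Qed.
Let T4_ge0 m : 0 <= T4 m.
Proof. by apply: mulr_ge0 => //; apply: mulr_ge0 => //; exact: powR_ge0. Qed.

Let kS : (k <= S)%N. Proof. by rewrite -addnS leq_addr. Qed.

Let sqr_le_norm (x y : R) : `|x| <= y -> x ^+ 2 <= y ^+ 2.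
Proof. by move=> xy; rewrite -real_normK ?num_real // lerXn2r // nnegrE ?(le_trans _ xy). Qed.

Lemma sqr_Delta_le m : Delta m ^+ 2 <= T1 m + T2 m + (T3 m + T4 m).
Proof.
have zm0 : 0 <= z m by exact: znorm_ge0.
have t12 : 0 <= T1 m + T2 m by rewrite addr_ge0.
have t34 : 0 <= T3 m + T4 m by rewrite addr_ge0.
have [out|inn] := leP (1 + E) (z m).
  rewrite (Delta_outside gamma1 alpha0 p0 n0 h0 etaE EE' i out) expr0n.
  by rewrite addr_ge0.
have [bd|bd] := leP (riesz_gap gamma (z m)) (2 * F).
  apply: le_trans (_ : T1 m <= _); last by rewrite -addrA lerDl addr_ge0.
  rewrite /T1; have -> : `|z m - 1| <= 2 * F.
    have [z1|z1] := leP 1 (z m).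
      rewrite ger0_norm ?subr_ge0 // lerBlDr addrC; apply: le_trans (ltW inn) _.
      by rewrite lerD2l (le_trans EF) // ler_peMl ?(ltW F0) // ler1n.
    rewrite distrC ger0_norm ?subr_ge0 ?(ltW z1) //; apply: le_trans bd.
    rewrite riesz_gapE ?zm0 ?(ltW z1) // lerB //.
    have [->|zp] := eqVneq (z m) 0; first by rewrite powR0 // gt_eqF // (lt_le_trans _ gamma1).
    by apply: ge1r_powR => //; rewrite (ltW z1) lt_neqAle eq_sym zp zm0.
  rewrite mul1r; apply: sqr_le_norm.
  exact: (Delta_boundary gamma1 alpha0 gk kS p0 n0 h0 etaE EE' FE' i bd).
have [org|org] := leP (z m) (2 * E).
  apply: le_trans (_ : T2 m <= _); last by rewrite addrAC lerDr addr_ge0.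
  rewrite /T2 org mul1r; apply: sqr_le_norm.
  exact: (Delta_origin gamma1 alpha0 gk ak kS p0 n0 h0 etaE EE' FE' i org).
have [z1 g2 hD] := Delta_interior gamma1 gk ak kS p0 n0 pn h0 etaE EE' FE' i hC0 C00 bd org.
apply: le_trans (_ : T3 m + T4 m <= _); last by rewrite lerDr.
rewrite /T3 /T4 (ltW org) z1 g2 gerBl zm0 /= !mul1r -mulrDr.
apply: le_trans (sqr_le_norm hD) _.
have zz : 0 < z m < 1.
  apply/andP; split; first by apply: lt_trans org; rewrite mulr_gt0.
  by rewrite -subr_gt0; apply: lt_le_trans g2; rewrite mulr_gt0.
have e1 : 1 - S%:R = - (k + D)%:R :> R by rewrite -natr1; ring.
have e2 : alpha - S%:R = - (S%:R - alpha) by rewrite opprB.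
have aS : alpha <= S%:R by apply: le_trans ak _; rewrite ler_nat.
have c1 : 0 <= ((k + D)%:R : R) <= S%:R.
  by apply/andP; split; [exact: ler0n|rewrite ler_nat].
have c2 : (0 : R) <= S%:R - alpha <= S%:R by rewrite subr_ge0 aS gerBl ltW.
have hs := powRN_product_split zz c1 c2.
rewrite e1 e2 QE (_ : (2 * u) ^+ S = 2 ^+ S * u ^+ S); last by rewrite exprMn.
rewrite (_ : u ^+ (2 * S) = (u ^+ S) ^+ 2); last by rewrite mulnC exprM.
move: hs; set Y := _ * _; set W := (8 `^ _) ^+ 2; set V := _ + _ => hs.
rewrite [leLHS](_ : _ = (2 ^+ S * C0) ^+ 2 * (u ^+ S) ^+ 2 * Y ^+ 2); last by ring.
rewrite [leRHS](_ : _ = (2 ^+ S * C0) ^+ 2 * (u ^+ S) ^+ 2 * (W * V)); last by ring.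
by rewrite ler_wpM2l // mulr_ge0 // sqr_ge0.
Qed.

Let sum_indicator (P : pred G) (c : R) : \sum_m (P m)%:R * c = #|P|%:R * c.
Proof.
rewrite -mulr_suml -natr_sum; congr (_%:R * _).
by rewrite -sum1_card [RHS]big_mkcond /=; apply: eq_bigr => m _; rewrite unfold_in; case: (P m).
Qed.

Let powu (c a : R) : 0 <= c -> (c * u) `^ a = c `^ a * u `^ a.
Proof. by move=> c0; rewrite powRM // ltW. Qed.

(** An annulus of relative width [u] has about [n^D u] points. *)
Lemma sum_T1 : \sum_m T1 m <=
  CA * (4 * ks) * (2 ^+ S * (6 * ks) `^ alpha) ^+ 2 * (n%:R ^+ D * u `^ (1 + 2 * alpha)).
Proof.
rewrite /T1 (sum_indicator [pred m : G | `|z m - 1| <= 2 * F]).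
apply: le_trans (_ : CA * (n%:R ^+ D * (2 * F)) * (2 ^+ S * (3 * F) `^ alpha) ^+ 2 <= _).
  by apply: ler_wpM2r; [exact: sqr_ge0|apply: annulus; rewrite nF].
have e1 : 3 * F = 6 * ks * u by rewrite FE; ring.
have e2 : u `^ (1 + 2 * alpha) = u * (u `^ alpha) ^+ 2.
  rewrite powRD ?(gt_eqF u0) ?implybT // powRr1 ?(ltW u0) // -powR_mulrn ?powR_ge0 //.
  by rewrite -powRrM [alpha * _]mulrC.
rewrite e1 e2 powu; last by rewrite mulr_ge0 // ltW.
by rewrite le_eqVlt; apply/orP; left; apply/eqP; rewrite FE; ring.
Qed.

Lemma sum_T2 : \sum_m T2 m <=
  (24 * S%:R) ^+ D * (2 ^+ S * (6 * ks)) ^+ 2 * (n%:R ^+ D * u `^ (D%:R + 2)).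
Proof.
rewrite /T2 (sum_indicator [pred m : G | z m <= 2 * E]).
apply: le_trans (_ : (6 * n%:R * (2 * E)) ^+ D * (2 ^+ S * (3 * F)) ^+ 2 <= _).
  by apply: ler_wpM2r; [exact: sqr_ge0|exact: card_ball].
have e1 : 3 * F = 6 * ks * u by rewrite FE; ring.
have e2 : u `^ (D%:R + 2) = u ^+ D * u ^+ 2.
  by rewrite powRD ?(gt_eqF u0) ?implybT // !powR_mulrn ?(ltW u0).
have e3 : 6 * n%:R * (2 * E) = (24 * S%:R) * n%:R * u by rewrite EE; ring.
rewrite e1 e2 e3 !exprMn.
by rewrite le_eqVlt; apply/orP; left; apply/eqP; ring.
Qed.

(** The order [k + D + 1] of the difference makes the singularity at the origin
    steep enough for the sum to be carried by its smallest radii. *)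
Lemma sum_T3 : \sum_m T3 m <=
  Q * C1 * 6 ^+ D * (4 * S%:R) `^ (D%:R - q1) * (n%:R ^+ D * u `^ (D%:R + 2)).
Proof.
rewrite (_ : \sum_m T3 m = Q * u ^+ (2 * S) * \sum_(m : G | xpredT m && (2 * E <= z m <= 1)) z m `^ (- q1)); last first.
  rewrite mulr_sumr [RHS]big_mkcond /=; apply: eq_bigr => m _; rewrite /T3.
  by case: ifP => _; rewrite ?mul1r ?mul0r.
have E20 : 0 < 2 * E by rewrite mulr_gt0.
have A0 : 0 <= (6 * n%:R) ^+ D :> R by rewrite exprn_ge0 // mulr_ge0.
apply: le_trans (_ : Q * u ^+ (2 * S) * (C1 * (6 * n%:R) ^+ D * (2 * E) `^ (D%:R - q1)) <= _).
  apply: ler_wpM2l => //; apply: hC1 => // x /andP[x1 x2].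
  rewrite powR_mulrn; last by apply: le_trans x1; exact: ltW.
  by rewrite -exprMn; apply: card_ball => //; apply: le_trans x1.
have e1 : 2 * E = 4 * S%:R * u by rewrite EE; ring.
rewrite e1 powu; last by rewrite mulr_ge0.
have e2 : u `^ (D%:R + 2) = u ^+ (2 * S) * u `^ (D%:R - q1).
  rewrite -powR_mulrn ?(ltW u0) // -powRD ?(gt_eqF u0) ?implybT //; congr (_ `^ _).
  by rewrite natrM -natr1; ring.
rewrite e2 exprMn.
by rewrite le_eqVlt; apply/orP; left; apply/eqP; ring.
Qed.

Lemma sum_T4 : \sum_m T4 m <=
  Q * C2 * CA * (4 * S%:R) `^ (1 - q2) * (n%:R ^+ D * u `^ (1 + 2 * alpha)).
Proof.
rewrite (_ : \sum_m T4 m = Q * u ^+ (2 * S) *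
   \sum_(m : G | (z m <= 1) && (2 * E <= 1 - z m <= 1)) (1 - z m) `^ (- q2)); last first.
  rewrite mulr_sumr [RHS]big_mkcond /=; apply: eq_bigr => m _; rewrite /T4.
  by case: ifP => _; rewrite ?mul1r ?mul0r.
have E20 : 0 < 2 * E by rewrite mulr_gt0.
have A0 : 0 <= CA * n%:R ^+ D by apply: mulr_ge0 => //; rewrite exprn_ge0.
apply: le_trans (_ : Q * u ^+ (2 * S) * (C2 * (CA * n%:R ^+ D) * (2 * E) `^ (1 - q2)) <= _).
  apply: ler_wpM2l => //; apply: (hC2 (P := fun m : G => z m <= 1) (kap := fun m : G => 1 - z m)) => // x /andP[x1 x2].
  have x0 : 0 <= x by apply: le_trans x1; exact: ltW.
  rewrite powRr1 // -mulrA; apply: le_trans (annulus _); last by rewrite (le_trans nE) //= (le_trans x2).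
  rewrite ler_nat; apply: subset_leq_card; apply/fintype.subsetP => m.
  by rewrite !inE => /andP[z1 h1]; rewrite distrC ger0_norm // subr_ge0.
have e1 : 2 * E = 4 * S%:R * u by rewrite EE; ring.
rewrite e1 powu; last by rewrite mulr_ge0.
have e2 : u `^ (1 + 2 * alpha) = u ^+ (2 * S) * u `^ (1 - q2).
  rewrite -powR_mulrn ?(ltW u0) // -powRD ?(gt_eqF u0) ?implybT //; congr (_ `^ _).
  by rewrite natrM; ring.
rewrite e2.
by rewrite le_eqVlt; apply/orP; left; apply/eqP; ring.
Qed.

Lemma sum_sqr_Delta_le : \sum_m Delta m ^+ 2 <=
  (CA * (4 * ks) * (2 ^+ S * (6 * ks) `^ alpha) ^+ 2 +
   (24 * S%:R) ^+ D * (2 ^+ S * (6 * ks)) ^+ 2 +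
   (Q * C1 * 6 ^+ D * (4 * S%:R) `^ (D%:R - q1) +
    Q * C2 * CA * (4 * S%:R) `^ (1 - q2))) *
  (n%:R ^+ D * u `^ (D%:R + Num.min 2 (2 * alpha + 1 - D%:R))).
Proof.
apply: le_trans (ler_sum _ (fun m _ => sqr_Delta_le m)) _.
rewrite !big_split /=.
set e := D%:R + Num.min _ _.
have u01 : 0 < u <= 1 by rewrite u0 u1.
have h1 : n%:R ^+ D * u `^ (1 + 2 * alpha) <= n%:R ^+ D * u `^ e.
  rewrite ler_wpM2l ?exprn_ge0 //; apply: ger_powR => //.
  rewrite /e addrC -lerBrDr ge_min; apply/orP; right.
  by rewrite [1 + _]addrC.
have h2 : n%:R ^+ D * u `^ (D%:R + 2) <= n%:R ^+ D * u `^ e.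
  rewrite ler_wpM2l ?exprn_ge0 //; apply: ger_powR => //.
  by rewrite /e lerD2l ge_min lexx.
rewrite [leRHS]mulrDl [X in _ <= X + _]mulrDl [X in _ <= _ + X]mulrDl.
apply: lerD; apply: lerD.
- apply: le_trans sum_T1 _; apply: ler_wpM2l => //; apply: mulr_ge0; last exact: sqr_ge0.
  by apply: mulr_ge0 => //; apply: mulr_ge0 => //; exact: ltW.
- apply: le_trans sum_T2 _; apply: ler_wpM2l => //; apply: mulr_ge0; last exact: sqr_ge0.
  by apply: exprn_ge0; exact: mulr_ge0.
- apply: le_trans sum_T3 _; apply: ler_wpM2l => //; apply: mulr_ge0; last exact: powR_ge0.
  by apply: mulr_ge0; [exact: mulr_ge0|exact: exprn_ge0].
- apply: le_trans sum_T4 _; apply: ler_wpM2l => //; apply: mulr_ge0; last exact: powR_ge0.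
  by apply: mulr_ge0 => //; exact: mulr_ge0.
Qed.

End constants.

(** The critical index. With [u = 2^l / n] the square sum of the [S]-th difference
    with step [2^l] is at most of the order of [n^D u^(1 + 2 alpha)] near the
    sphere and [n^D u^(D + 2)] near the origin; compared with [(2^l)^D] this
    gains a power of [u] because [1 + 2 alpha > D]. *)
Lemma sum_sqr_radial_diff : exists (S : nat) (B t : R), [/\ 0 < t < 1, 1 <= B &
  forall p n L, (0 < p)%N -> (0 < n)%N -> (n <= 2 ^ L)%N -> (2 ^ L <= 2 * n)%N ->
    (2 * (n + 2 ^ L * S) <= 2 ^ p)%N ->
    let M := fun m : {ffun I -> 'Z_(2 ^ p)} => riesz_profile gamma alpha (znorm n m : R) in
    (forall i l, (l < L)%N -> \sum_m (iter S (gdiff (dir p i (2 ^ l))) M m) ^+ 2 <=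
       B * (2 ^ l)%:R ^+ #|I| * t ^+ (2 * (L - l))) /\
    \sum_m M m ^+ 2 <= B * (2 ^ L)%:R ^+ #|I|].
Proof.
have [k [gk ak]] := nat_above_both (le_trans ler01 gamma1) (ltW alpha0).
have k1 : 1 <= k%:R :> R by exact: le_trans gk.
have gamma0 : 0 <= gamma by apply: le_trans gamma1.
have aS : alpha <= (k + D).+1%:R by apply: le_trans ak _; rewrite ler_nat -addnS leq_addr.
have [C0 C00 hC0] := radial_derive_bound gamma0 aS.
have q1D : D%:R < 2 * (k + D)%:R :> R.
  rewrite natrD; have : 0 < D%:R :> R by rewrite ltr0n.
  by move=> ?; lra.
have q21 : 1 < 2 * ((k + D).+1%:R - alpha).
  have e : (k + D).+1%:R = k%:R + D%:R + 1 :> R by rewrite -natr1 natrD.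
  have d0 : 0 <= D%:R :> R by [].
  by rewrite e; lra.
have [C1 C10 hC1] := sum_inv_power_le (ler0n R D) q1D.
have [C2 C20 hC2] := sum_inv_power_le ler01 q21.
pose ks : R := k%:R * (k + D).+1%:R.
pose CA : R := 4 * (6 * (1 + (4 * ks + 2))) ^+ D + 18 * D%:R ^+ 2 * 10 ^+ D.
pose Q : R := (2 ^+ (k + D).+1 * C0) ^+ 2 * (8 `^ (k + D).+1%:R) ^+ 2.
(* the exponent gained; [t ^+ 2] is the gain per dyadic step *)
pose e1 : R := Num.min 2 (2 * alpha + 1 - D%:R).
have e10 : 0 < e1.
  by rewrite lt_min ltr0n /=; move: alphaD; rewrite ltr_pdivrMr //; lra.
pose t : R := 2^-1 `^ (e1 / 2).
have h01 : 0 < (2^-1 : R) < 1 by rewrite invr_gt0 ltr0n invf_lt1 ?ltr1n.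
have t01 : 0 < t < 1.
  rewrite powR_gt0 ?invr_gt0 //= -[ltRHS](one_powR (e1 / 2)).
  by apply: gt0_ltr_powR; rewrite ?nnegrE ?divr_gt0 //; case/andP: h01 => // /ltW.
have := fun p n h p0 n0 pn h0 hn i => @sum_sqr_Delta_le k C0 C1 C2 gk ak C00 hC0 C10 hC1 C20 hC2
   ks CA Q erefl erefl erefl p n h p0 n0 pn h0 hn i _ _ _ erefl erefl erefl.
set B0 := _ + _ => key.
have B00 : 0 <= B0.
  have ks0 : 0 <= ks by rewrite mulr_ge0.
  have CA0 : 0 <= CA.
    by rewrite addr_ge0 // !mulr_ge0 ?exprn_ge0 // mulr_ge0 // !addr_ge0 // mulr_ge0.
  have Q0 : 0 <= Q by rewrite mulr_ge0 ?sqr_ge0.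
  rewrite /B0; apply: addr_ge0; apply: addr_ge0.
  - by apply: mulr_ge0; [apply: mulr_ge0 => //; exact: mulr_ge0|exact: sqr_ge0].
  - by apply: mulr_ge0; [rewrite exprn_ge0 // mulr_ge0|exact: sqr_ge0].
  - apply: mulr_ge0; last exact: powR_ge0.
    by apply: mulr_ge0; [exact: mulr_ge0|exact: exprn_ge0].
  - apply: mulr_ge0; last exact: powR_ge0.
    by apply: mulr_ge0 => //; exact: mulr_ge0.
have f0 : 0 <= 6 ^+ D :> R by exact: exprn_ge0.
exists (k + D).+1, (B0 + 6 ^+ D + 1), t; split=> //.
  by rewrite lerDr addr_ge0.
move=> p n L p0 n0 nL Ln pn M; split.
  move=> i l lL.
  have h0 : (0 < 2 ^ l)%N by rewrite expn_gt0.
  have hL : (2 ^ l <= 2 ^ L)%N by rewrite leq_exp2l // ltnW.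
  have pn' : (2 * (n + 2 ^ l * (k + D).+1) <= 2 ^ p)%N.
    by apply: leq_trans pn; rewrite leq_pmul2l // leq_add2l leq_pmul2r.
  apply: le_trans (key p n (2 ^ l)%N p0 n0 pn' h0 (leq_trans hL Ln) i) _.
  set u : R := _ / _.
  have np : 0 < n%:R :> R by rewrite ltr0n.
  have u0 : 0 < u by rewrite divr_gt0 ?mulr_gt0 // ltr0n.
  rewrite -/e1 powRD ?(gt_eqF u0) ?implybT // powR_mulrn ?(ltW u0) // [n%:R ^+ _ * _]mulrA -exprMn.
  have nu : n%:R * u <= (2 ^ l)%:R.
    rewrite /u (_ : _ * (_ / _) = (2 ^ l)%:R / 2); last by field; rewrite gt_eqF.
    by rewrite ler_pdivrMr // ler_peMr // ler1n.
  have ue : u `^ e1 <= t ^+ (2 * (L - l)).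
    rewrite exprM -[t ^+ 2]powR_mulrn ?powR_ge0 // -powRrM divfK // powR_exprAC ?invr_ge0 //.
    apply: ge0_ler_powR; rewrite ?nnegrE ?(ltW e10) ?(ltW u0) ?exprn_ge0 ?invr_ge0 //.
    rewrite /u ler_pdivrMr ?mulr_gt0 // exprVn mulrC ler_pdivlMr ?exprn_gt0 //.
    by rewrite -natrX -!natrM ler_nat -expnD subnKC // ltnW.
  have te0 : 0 <= t ^+ (2 * (L - l)) by rewrite exprn_ge0 // ltW //; case/andP: t01.
  rewrite -mulrA; apply: le_trans (_ : B0 * ((2 ^ l)%:R ^+ D * t ^+ (2 * (L - l))) <= _).
    apply: ler_wpM2l => //; apply: ler_pM; rewrite ?powR_ge0 //.
      by rewrite exprn_ge0 // mulr_ge0 // ltW.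
    by rewrite lerXn2r ?nnegrE // mulr_ge0 // ltW.
  apply: ler_wpM2r; first by rewrite mulr_ge0 // exprn_ge0.
  by rewrite -addrA lerDl addr_ge0.
have n1 : n%:R^-1 <= 1 :> R by rewrite invf_le1 ?ler1n // ltr0n.
apply: le_trans (_ : #|[pred m : {ffun I -> 'Z_(2 ^ p)} | znorm n m <= 1 :> R]|%:R <= _).
  rewrite -sum1_card natr_sum [leRHS]big_mkcond /=; apply: ler_sum => m _.
  rewrite inE /M; have [z1|z1] := leP (znorm n m : R) 1.
    by rewrite exprn_ile1 ?riesz_profile_ge0 ?riesz_profile_le1.
  by rewrite riesz_profile_eq0 ?expr0n // ltW.
apply: le_trans (card_ball p0 n0 I n1) _; rewrite mulr1 exprMn.
apply: ler_pM; rewrite ?exprn_ge0 //.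
  by rewrite -addrA addrCA lerDl addr_ge0.
by rewrite lerXn2r ?nnegrE // ler_nat.
Qed.

End radial_kernel.

Section mass_bound_euclidean.
Context {R : realType}.
Variables (gamma alpha : R).
Hypothesis gamma1 : 1 <= gamma.

Lemma lq_normZ_2 (d : nat) (k : 'rV[int]_d) :
  lq_normZ 2%:E k = Num.sqrt (\sum_i (`|k ord0 i|%N%:R) ^+ 2) :> R.
Proof.
rewrite /lq_normZ /lq_norm powR12_sqrt; last by apply: sumr_ge0 => j _; exact: powR_ge0.
congr Num.sqrt; apply: eq_bigr => j _.
by rewrite mxE powR_mulrn // natr_absz intr_norm.
Qed.

Lemma mass_bound_l2 (d : nat) : (0 < d)%N -> (d%:R - 1) / 2 < alpha ->
  exists C : R, forall (n : nat) (F : seq 'rV[int]_d), (0 < n)%N ->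
    mass_bound C F (riesz_multiplier gamma alpha 2%:E n).
Proof.
move=> d0 ad; have I0 : (0 < #|'I_d|)%N by rewrite card_ord.
have alpha0 : 0 < alpha.
  by apply: le_lt_trans ad; rewrite divr_ge0 // subr_ge0 ler1n.
have ad' : (#|'I_d|%:R - 1) / 2 < alpha by rewrite card_ord.
have [S [B [t [t01 B1 key]]]] := sum_sqr_radial_diff gamma1 alpha0 I0 ad'.
exists (#|'I_d|%:R * (4 ^+ #|'I_d| * B) / (1 - t)) => n F n0.
have [L nL Ln] := expn_up n0.
have [p Lp ap] : exists2 p, (L + 2 + S <= p)%N &
    (L + 2 + \sum_(k <- F) \sum_i `|k ord0 i| <= p)%N.
  exists (L + 2 + S + \sum_(k <- F) \sum_i `|k ord0 i|)%N; first exact: leq_addr.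
  by rewrite leq_add2r leq_addr.
have Lp2 : (L + 2 <= p)%N by apply: leq_trans Lp; exact: leq_addr.
have p0 : (0 < p)%N by apply: leq_trans Lp2; rewrite addn2.
have pn : (2 * (n + 2 ^ L * S) <= 2 ^ p)%N.
  apply: leq_trans (_ : 2 * (2 ^ L * S.+1) <= _)%N.
    by rewrite leq_pmul2l // mulnS leq_add2r.
  apply: leq_trans (_ : 2 * (2 ^ L * 2 ^ S) <= _)%N.
    by rewrite leq_pmul2l // leq_pmul2l ?expn_gt0 // ltn_expl.
  by rewrite -expnD -expnS leq_exp2l // (leq_trans _ Lp) // addnAC addn2 ltnW.
have [key1 key2] := key p n L p0 n0 nL Ln pn.
apply: (mass_bound_gdft (N := 2 ^ p) (a := fun i => delta_mx ord0 i)
   (Mg := fun m : {ffun 'I_d -> 'Z_(2 ^ p)} => riesz_profile gamma alpha (znorm n m : R))).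
- exact: (expn2_gt1 Lp2).
- exact: (l1_gdft_directional Lp2 B1 t01 key1 key2 I0).
move=> k kF; rewrite /riesz_multiplier lq_normZ_2; congr (riesz_profile _ _ (Num.sqrt _ / _)).
apply: eq_bigr => i _; congr (_%:R ^+ 2).
have ki : idot (delta_mx ord0 i) k = k ord0 i.
  rewrite /idot (bigD1 i) //= mxE !eqxx mul1r big1 ?addr0 // => j ji.
  by rewrite mxE (negbTE ji) mul0r.
rewrite ffunE ki zrho_int ?(expn2_gt1 Lp2) //.
have h : (`|k ord0 i| <= \sum_(k <- F) \sum_i `|k ord0 i|)%N.
  by rewrite (big_rem k) //= (bigD1 i) //= -addnA leq_addr.
have h2 : (`|k ord0 i| < 2 ^ `|k ord0 i|)%N by exact: ltn_expl.
have h3 : (2 ^ (`|k ord0 i|).+1 <= 2 ^ p)%N.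
  rewrite leq_exp2l // (leq_trans _ ap) // -addn1 addnC leq_add //.
  by rewrite addn2.
by apply: leq_trans h3; rewrite expnS mul2n leq_double ltnW.
Qed.

End mass_bound_euclidean.

(** * Real valued norms and grids on the torus *)

Section rnorm_theory.
Context {R : realType} {V : normedModType R[i]}.
Implicit Types u v w : V.

Lemma rnormE v : `|v| = (rnorm v)%:C.
Proof. by rewrite /rnorm RRe_real // normr_real. Qed.

Lemma rnorm_ge0 v : 0 <= rnorm v.
Proof. by rewrite -lecR -rnormE normr_ge0. Qed.

Lemma rnorm0 : rnorm (0 : V) = 0.
Proof. by rewrite /rnorm normr0. Qed.

Lemma rnorm0_eq0 v : rnorm v = 0 -> v = 0.
Proof. by move=> v0; apply: normr0_eq0; rewrite rnormE v0. Qed.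

Lemma rnormN v : rnorm (- v) = rnorm v.
Proof. by rewrite /rnorm normrN. Qed.

Lemma rdistC u v : rnorm (u - v) = rnorm (v - u).
Proof. by rewrite -rnormN opprB. Qed.

Lemma rnormZ (a : R[i]) v : rnorm (a *: v) = cabs a * rnorm v.
Proof. by apply: complexI; rewrite -rnormE normrZ cabsE rnormE rmorphM. Qed.

Lemma ler_rnormD u v : rnorm (u + v) <= rnorm u + rnorm v.
Proof. by rewrite -lecR rmorphD /= -!rnormE ler_normD. Qed.

Lemma ler_rnorm_sum (J : Type) (r : seq J) (P : pred J) (F : J -> V) :
  rnorm (\sum_(i <- r | P i) F i) <= \sum_(i <- r | P i) rnorm (F i).
Proof.
elim/big_rec2: _ => [|i x y _ h]; first by rewrite rnorm0.
by apply: le_trans (ler_rnormD _ _) _; rewrite lerD2l.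
Qed.

Lemma ler_rdistD w u v : rnorm (u - v) <= rnorm (u - w) + rnorm (w - v).
Proof. by rewrite -lecR rmorphD /= -!rnormE ler_distD. Qed.

Lemma cvg_rnormP (T : Type) (F : set_system T) {FF : Filter F} (f : T -> V) v :
  f x @[x --> F] --> v <->
  forall e : R, 0 < e -> \forall t \near F, rnorm (v - f t) < e.
Proof.
split=> [/cvgrPdist_lt h e e0|h].
  have /h : 0 < e%:C by rewrite ltcR.
  by apply: filterS => t; rewrite rnormE ltcR.
apply/cvgrPdist_lt => e e0.
have er : e = (complex.Re e)%:C by rewrite RRe_real // gtr0_real.
move: e0; rewrite er ltcR => /h; apply: filterS => t.
by rewrite rnormE ltcR.
Qed.

Lemma cvg_rnorm_le (T : Type) (F : set_system T) {FF : ProperFilter F} (f : T -> V) v w (e : R) :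
  f x @[x --> F] --> v -> (\forall t \near F, rnorm (f t - w) <= e) -> rnorm (v - w) <= e.
Proof.
move=> /cvg_rnormP fv fe; apply/ler_addgt0Pr => h h0.
have [t [t1 t2]] := @filter_ex _ F _ _ (filterI (fv _ h0) fe).
by apply: le_trans (ler_rdistD (f t) _ _) _; rewrite addrC lerD // ltW.
Qed.

Lemma eq_rnorm_small u v : (forall e : R, 0 < e -> rnorm (u - v) <= e) -> u = v.
Proof.
move=> h; apply/eqP; rewrite -subr_eq0; apply/eqP; apply: rnorm0_eq0.
apply/eqP; rewrite eq_le rnorm_ge0 andbT.
by apply/ler_addgt0Pr => e e0; rewrite add0r h.
Qed.

End rnorm_theory.

Lemma cvg_rnorm_cauchy (R : realType) (V : completeNormedModType R[i]) (u : nat -> V) :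
  (forall e : R, 0 < e -> exists n0, forall n m, (n0 <= n)%N -> (n0 <= m)%N ->
    rnorm (u n - u m) <= e) -> cvgn u.
Proof.
move=> h; apply: cauchy_cvg; apply: cauchy_exP => e e0.
have er : e = (complex.Re e)%:C by rewrite RRe_real // gtr0_real.
move: e0; rewrite er ltcR => e0; move: (complex.Re e) e0 => {er}e e0.
have e2 : 0 < e / 2 by rewrite divr_gt0.
have [n0 hn] := h _ e2; exists (u n0).
exists n0 => // n /= n0n; rewrite -ball_normE /ball_ /= rnormE ltcR.
by apply: le_lt_trans (hn _ _ _ _) _ => //; rewrite ltr_pdivrMr // ltr_pMr // ltr1n.
Qed.

Section torus_grid.
Context {R : realType} {d : nat}.
Variable N : nat.
Hypothesis N1 : (1 < N)%N.

Definition grid (y : {ffun 'I_d -> 'Z_N}) : 'rV[R]_d :=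
  \row_j (2 * pi * (y j : nat)%:R / N%:R).

(** The lattice of periods of the torus. *)
Definition period (z : 'rV[int]_d) : 'rV[R]_d := \row_j (2 * pi * (z ord0 j)%:~R).

Lemma Zp_int_mod (q : int) : exists z : int, q = (nat_of_ord (q%:~R : 'Z_N))%:Z + N%:Z * z.
Proof.
have [m hm] : exists m : nat, q + N%:Z * `|q|%N%:Z = m%:Z.
  have : 0 <= q + N%:Z * `|q|%N%:Z by nia.
  by case: (q + _) => // m _; exists m.
have e : (q%:~R : 'Z_N) = m%:R.
  have : (q + N%:Z * `|q|%N%:Z)%:~R = (m%:Z)%:~R :> 'Z_N by rewrite hm.
  by rewrite intrD intrM -!pmulrn pchar_Zp // mul0r addr0.
rewrite e val_Zp_nat //; exists ((m %/ N)%N%:Z - `|q|%N%:Z).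
have := divn_eq m N; move: (m %/ N)%N (m %% N)%N => a b; move: hm; nia.
Qed.

Let N0 : N%:R != 0 :> R.
Proof. by rewrite pnatr_eq0 -lt0n; exact: ltnW. Qed.

Lemma gridD a y : exists z, grid a + grid y = grid (a + y) + period z.
Proof.
exists (\row_j ((a j + y j)%N %/ N)%N%:Z); apply/rowP => j; rewrite !mxE !ffunE.
have -> : ((a j + y j)%R : nat) = ((a j + y j)%N %% N)%N.
  by rewrite -val_Zp_nat // natrD !natr_Zp.
rewrite -mulrDl -mulrDr -natrD [in LHS](divn_eq (a j + y j)%N N) natrD natrM.
by rewrite -pmulrn; field.
Qed.

Lemma grid_near x : exists a z, forall j,
  `|(x - grid a - period z) ord0 j| <= 2 * pi / N%:R.
Proof.
have pi0 := pi_gt0 R.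
have Np : 0 < N%:R :> R by rewrite lt0r N0 ler0n.
pose q j := Num.floor (x ord0 j * N%:R / (2 * pi)).
pose a : {ffun 'I_d -> 'Z_N} := [ffun j => (q j)%:~R].
have [z hz] := choice (fun j => Zp_int_mod (q j)).
exists a, (\row_j z j) => j; rewrite !mxE ffunE.
have /andP[q1 q2] : (q j)%:~R <= x ord0 j * N%:R / (2 * pi) < (q j + 1)%:~R := floor_itv _.
have -> : x ord0 j - 2 * pi * (nat_of_ord ((q j)%:~R : 'Z_N))%:R / N%:R - 2 * pi * (z j)%:~R =
   2 * pi / N%:R * (x ord0 j * N%:R / (2 * pi) - (q j)%:~R).
  have e : (q j)%:~R = (nat_of_ord ((q j)%:~R : 'Z_N))%:R + N%:R * (z j)%:~R :> R.
    by rewrite {1}(hz j) intrD intrM -!pmulrn.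
  have key (p t b c M : R) : p != 0 -> M != 0 ->
      t - 2 * p * b / M - 2 * p * c = 2 * p / M * (t * M / (2 * p) - (b + M * c)).
    by move=> p0 M0; field; rewrite p0.
  by rewrite key ?(gt_eqF pi0) // -e.
have c0 : 0 <= 2 * pi / N%:R :> R by rewrite divr_ge0 ?mulr_ge0 // ltW.
rewrite normrM ger0_norm // ler_piMr // ger0_norm ?subr_ge0 //.
by move: q2; rewrite intrD => /ltW; rewrite lerBlDl.
Qed.

End torus_grid.

(** * Averages of a torus action *)

Section torus_action.
Context {R : realType} {d : nat} {E : completeNormedModType R[i]}.

(** Continuity is asked at the origin only; isometry propagates it. *)
Record torus_action (V : 'rV[R]_d -> E -> E) : Prop := TorusAction {
  act_linear : forall x (a : R[i]) f g, V x (a *: f + g) = a *: V x f + V x g ;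
  act_norm : forall x f, rnorm (V x f) = rnorm f ;
  act_add : forall x y f, V (x + y) f = V x (V y f) ;
  act_period : forall j f, V ((2 * pi) *: delta_mx ord0 j) f = f ;
  act_small : forall f (e : R), 0 < e -> exists2 r : R, 0 < r &
    forall x : 'rV[R]_d, (forall j, `|x ord0 j| <= r) -> rnorm (V x f - f) <= e
}.

End torus_action.

Section torus_mean.
Context {R : realType} {d : nat} {E : completeNormedModType R[i]}.
Variable V : 'rV[R]_d -> E -> E.
Hypothesis HV : torus_action V.

Lemma torus_actB x f g : V x (f - g) = V x f - V x g.
Proof. by rewrite addrC -scaleN1r (act_linear HV) scaleN1r addrC. Qed.

Lemma torus_act0r x : V x 0 = 0.
Proof. by rewrite -[X in V x X](subrr 0) torus_actB subrr. Qed.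

Lemma torus_actDr x f g : V x (f + g) = V x f + V x g.
Proof. by rewrite -[f in LHS]scale1r (act_linear HV) scale1r. Qed.

Lemma torus_actZ x a f : V x (a *: f) = a *: V x f.
Proof. by rewrite -[a *: f]addr0 (act_linear HV) torus_act0r addr0. Qed.

Lemma torus_act_sum (J : Type) (r : seq J) (P : pred J) (F : J -> E) x :
  V x (\sum_(i <- r | P i) F i) = \sum_(i <- r | P i) V x (F i).
Proof. exact: (big_morph _ (torus_actDr x) (torus_act0r x)). Qed.

Lemma torus_act0 f : V 0 f = f.
Proof.
apply/eqP; rewrite -subr_eq0; apply/eqP; apply: rnorm0_eq0.
by rewrite -((act_norm HV) 0) torus_actB -(act_add HV) addr0 subrr rnorm0.
Qed.

Lemma torus_act_period z f : V (period z) f = f.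
Proof.
have VN x : V x f = f -> V (- x) f = f.
  by move=> h; rewrite -[in LHS]h -(act_add HV) addNr torus_act0.
have Vn x n : V x f = f -> V (x *+ n) f = f.
  by move=> h; elim: n => [|n IH]; rewrite ?mulr0n ?torus_act0 // mulrS (act_add HV) IH.
have -> : period z = \sum_j ((2 * pi : R) *: delta_mx ord0 j) *~ (z ord0 j).
  rewrite [LHS]row_sum_delta; apply: eq_bigr => j _.
  by rewrite mxE -[RHS]scaler_int scalerA mulrC.
elim/big_ind: _ => [|x y hx hy|j _]; [exact: torus_act0|by rewrite (act_add HV) hy|].
case: (z ord0 j) => n; first exact/Vn/(act_period HV).
by rewrite NegzE mulrNz; apply/VN/Vn/(act_period HV).
Qed.

Definition avg N f : E :=
  ((N ^ d)%:R^-1)%:C *: \sum_(y : {ffun 'I_d -> 'Z_N}) V (grid y) f.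

Lemma avgP N (a : R[i]) f g : avg N (a *: f + g) = a *: avg N f + avg N g.
Proof.
rewrite /avg; under eq_bigr do rewrite (act_linear HV).
by rewrite big_split /= -scaler_sumr scalerDr !scalerA mulrC.
Qed.

Lemma avgB N f g : avg N (f - g) = avg N f - avg N g.
Proof. by rewrite addrC -scaleN1r avgP scaleN1r addrC. Qed.

Lemma torus_act_avg N x f : V x (avg N f) = avg N (V x f).
Proof.
rewrite /avg torus_actZ torus_act_sum; congr (_ *: _); apply: eq_bigr => y _.
by rewrite -!(act_add HV) addrC.
Qed.

Lemma avgC N M f : avg N (avg M f) = avg M (avg N f).
Proof.
have avg0 : avg M 0 = 0 by rewrite -[X in avg M X](subrr 0) avgB subrr.
have avgZ a g : avg M (a *: g) = a *: avg M g by rewrite -[a *: g]addr0 avgP avg0 addr0.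
have avgD g h : avg M (g + h) = avg M g + avg M h by rewrite -[g in LHS]scale1r avgP scale1r.
rewrite {1}/avg [in RHS]/(avg N f) avgZ (big_morph _ avgD avg0); congr (_ *: _).
by apply: eq_bigr => y _; rewrite torus_act_avg.
Qed.

Lemma avg_ind N f g (e : R) : (1 < N)%N ->
  (forall y : {ffun 'I_d -> 'Z_N}, rnorm (V (grid y) f - g) <= e) -> rnorm (avg N f - g) <= e.
Proof.
move=> N1 h.
have cd : #|{ffun 'I_d -> 'Z_N}| = (N ^ d)%N.
  by rewrite card_ffun !card_ord /= Zp_cast.
have N0 : 0 < (N ^ d)%:R :> R by rewrite ltr0n expn_gt0 ltnW.
have -> : avg N f - g = ((N ^ d)%:R^-1)%:C *: \sum_(y : {ffun 'I_d -> 'Z_N}) (V (grid y) f - g).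
  rewrite sumrB sumr_const cd -[g *+ _]scaler_nat scalerBr scalerA -(rmorph_nat (real_complex R)).
  by rewrite -rmorphM /= mulVf ?gt_eqF // scale1r.
rewrite rnormZ cabs_real ger0_norm ?invr_ge0 ?(ltW N0) // ler_pdivrMl //.
apply: le_trans (ler_rnorm_sum _ _ _) _.
apply: le_trans (ler_sum _ (fun y _ => h y)) _.
by rewrite sumr_const cd mulr_natl.
Qed.

Lemma rnorm_avg N f : (1 < N)%N -> rnorm (avg N f) <= rnorm f.
Proof.
move=> N1; rewrite -[avg N f]subr0; apply: avg_ind => // y.
by rewrite subr0 (act_norm HV).
Qed.

Lemma torus_act_grid_avg N a f : (1 < N)%N -> V (@grid R d N a) (avg N f) = avg N f.
Proof.
move=> N1; rewrite /avg torus_actZ torus_act_sum; congr (_ *: _).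
rewrite [RHS](reindex_inj (addrI a)) /=; apply: eq_bigr => y _.
have [z e] := gridD (R := R) N1 a y.
by rewrite -(act_add HV) e (act_add HV) torus_act_period.
Qed.

(** Averages over a fine grid are almost invariant: a translation is a grid
    translation, which they absorb, followed by a small one. *)
Lemma avg_almost_invariant f (e : R) : 0 < e -> exists N0, forall N, (1 < N)%N ->
  (N0 <= N)%N -> forall x, rnorm (V x (avg N f) - avg N f) <= e.
Proof.
move=> e0; have [r r0 hr] := act_small HV f e0.
exists (Num.bound (2 * pi / r)) => N N1 hN x.
have Np : 0 < N%:R :> R by rewrite ltr0n ltnW.
have [a [z haz]] := grid_near N1 x.
set w := x - grid a - period z in haz.
have -> : V x (avg N f) = V w (avg N f).
  rewrite -[in RHS](torus_act_grid_avg a f N1) -[in RHS](torus_act_period z (avg N f)) -!(act_add HV).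
  by congr V; rewrite [RHS]addrAC /w subrK subrK.
rewrite torus_act_avg -avgB; apply: le_trans (rnorm_avg _ N1) _; apply: hr => j.
apply: le_trans (haz j) _; rewrite ler_pdivrMr // [r * _]mulrC -ler_pdivrMr //.
apply: le_trans (_ : (Num.bound (2 * pi / r))%:R <= N%:R :> R); last by rewrite ler_nat.
by apply/ltW; apply: le_lt_trans (archi_boundP _); rewrite ?ler_norm // divr_ge0 ?mulr_ge0 ?pi_ge0 // ltW.
Qed.

(** Averages over two grids commute, and averaging what is already almost
    invariant changes it little; neither grid has to refine the other. *)
Lemma cvg_avg f : cvgn (fun n => avg n.+2 f).
Proof.
apply: cvg_rnorm_cauchy => e e0; have e2 : 0 < e / 2 by rewrite divr_gt0.
have [N0 hN] := avg_almost_invariant f e2.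
have h n m : (N0 <= n)%N -> rnorm (avg n.+2 f - avg m.+2 (avg n.+2 f)) <= e / 2.
  move=> n0; rewrite rdistC; apply: avg_ind => // y.
  by apply: hN => //; apply: leq_trans n0 _; rewrite -addn2 leq_addr.
exists N0 => n m n0 m0; apply: le_trans (ler_rdistD (avg m.+2 (avg n.+2 f)) _ _) _.
rewrite [e]splitr lerD ?h // avgC rdistC; exact: h.
Qed.

(** The mean over the torus: the limit replaces an integral in [E]. *)
Definition mean f : E := lim (avg n.+2 f @[n --> \oo]).

Lemma mean_cvg f : avg n.+2 f @[n --> \oo] --> mean f.
Proof. exact: cvg_avg. Qed.

Lemma mean_unique f g : avg n.+2 f @[n --> \oo] --> g -> mean f = g.
Proof. by move=> h; apply: (cvg_unique (@norm_hausdorff _ E)) h; exact: mean_cvg. Qed.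

Lemma meanP (a : R[i]) f g : mean (a *: f + g) = a *: mean f + mean g.
Proof.
apply: mean_unique; under eq_fun do rewrite avgP.
by apply: cvgD; [apply: cvgZr|]; exact: mean_cvg.
Qed.

Lemma rnorm_mean f : rnorm (mean f) <= rnorm f.
Proof.
rewrite -[mean f]subr0; apply: cvg_rnorm_le (@mean_cvg f) _.
by apply: nearW => n; rewrite subr0 rnorm_avg.
Qed.

Lemma torus_act_mean x f : V x (mean f) = mean f.
Proof.
apply: eq_rnorm_small => e e0; have e3 : 0 < e / 3 by rewrite divr_gt0.
have [N0 hN] := avg_almost_invariant f e3.
have /cvg_rnormP /(_ _ e3) [N2 _ hm] := @mean_cvg f.
pose n := maxn N0 N2; have n0 : (N0 <= n)%N by exact: leq_maxl.
have n2 : (N2 <= n)%N by exact: leq_maxr.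
have h1 := ltW (hm _ n2); have h2 := hN n.+2 isT (leqW (leqW n0)) x.
have h3 : rnorm (V x (mean f) - V x (avg n.+2 f)) <= e / 3 by rewrite -torus_actB (act_norm HV).
apply: le_trans (ler_rdistD (V x (avg n.+2 f)) _ _) _.
have : rnorm (V x (avg n.+2 f) - mean f) <= e / 3 + e / 3.
  apply: le_trans (ler_rdistD (avg n.+2 f) _ _) _.
  by rewrite lerD // rdistC.
lra.
Qed.

Lemma mean_translate x f : mean (V x f) = mean f.
Proof.
rewrite -[RHS](torus_act_mean x); apply: mean_unique; apply/cvg_rnormP => e e0.
have /cvg_rnormP /(_ _ e0) := @mean_cvg f; apply: filterS => n.
by rewrite -torus_act_avg -torus_actB (act_norm HV).
Qed.

Lemma mean_invariant f : (forall x, V x f = f) -> mean f = f.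
Proof.
move=> h; apply: mean_unique.
apply/cvg_rnormP => e e0; apply: nearW => n; rewrite rdistC.
by apply: le_lt_trans e0; apply: avg_ind => // y; rewrite h subrr rnorm0.
Qed.

Lemma mean_functional (phi : E -> R[i]) (K : R) f :
  (forall g h, phi (g + h) = phi g + phi h) ->
  (forall a g, phi (a *: g) = a * phi g) ->
  (forall g, cabs (phi g) <= K * rnorm g) -> (forall x, phi (V x f) = phi f) ->
  phi (mean f) = phi f.
Proof.
move=> phiD phiZ phiK phiV.
have phiB g h : phi (g - h) = phi g - phi h by rewrite phiD -scaleN1r phiZ mulN1r.
have phi0 : phi 0 = 0 by rewrite -(scale0r 0) phiZ mul0r.
have K0 : 0 <= `|K| + 1 by rewrite addr_ge0.
have phi_avg n : phi (avg n.+2 f) = phi f.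
  rewrite /avg phiZ (big_morph _ phiD phi0).
  under eq_bigr do rewrite phiV.
  rewrite sumr_const card_ffun !card_ord /= -[phi f *+ _]mulr_natl mulrA -(rmorph_nat (real_complex R)).
  by rewrite -rmorphM /= mulVf ?mul1r // pnatr_eq0 expn_eq0.
apply/eqP; rewrite -subr_eq0 -normr_eq0 cabsE; apply/eqP; congr (_%:C).
apply/eqP; rewrite eq_le cabs_ge0 andbT; apply/ler_addgt0Pr => e e0; rewrite add0r.
have e1 : 0 < e / (`|K| + 1) by rewrite divr_gt0 // ltr_wpDl.
have /cvg_rnormP /(_ _ e1) [n _ hm] := @mean_cvg f.
have := ltW (hm n (leqnn n)); rewrite ler_pdivlMr ?ltr_wpDl // => h.
rewrite -(phi_avg n) -phiB; apply: le_trans (phiK _) _.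
apply: le_trans h; rewrite mulrC ler_wpM2l ?rnorm_ge0 //.
by apply: le_trans (ler_norm _) _; rewrite lerDl.
Qed.

End torus_mean.

(** * The Fejer kernel on a cycle *)


Section fejer_kernel.
Context {R : realType}.
Variable N m : nat.
Hypothesis N1 : (1 < N)%N.
Hypothesis m0 : (0 < m)%N.
Hypothesis mN : (m <= N)%N.

Definition fejer (c : 'Z_N) : R := cabs (\sum_(a < m) zchar ((a : nat)%:R * c) : R[i]) ^+ 2 / m%:R.

Lemma fejer_ge0 c : 0 <= fejer c.
Proof. by rewrite divr_ge0 ?sqr_ge0. Qed.

Lemma fejerE c : (fejer c)%:C =
  (m%:R^-1)%:C * \sum_(a < m) \sum_(b < m) zchar (((a : nat)%:R - (b : nat)%:R) * c).
Proof.
rewrite /fejer mulrC rmorphM /= sqr_cabs rmorph_sum /= mulr_suml; congr (_ * _).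
apply: eq_bigr => a _; rewrite mulr_sumr; apply: eq_bigr => b _.
by rewrite mulrBl zcharD // zcharN.
Qed.

Lemma fejer_sum : \sum_c fejer c = N%:R.
Proof.
apply: complexI; rewrite rmorph_sum rmorph_nat /=; under eq_bigr do rewrite fejerE.
rewrite -mulr_sumr exchange_big /=; under eq_bigr do rewrite exchange_big /=.
have ab (a b : 'I_m) : \sum_c zchar (((a : nat)%:R - (b : nat)%:R) * c : 'Z_N) =
    (if a == b then N%:R else 0) :> R[i].
  under eq_bigr do rewrite mulrC; rewrite zchar_sum // subr_eq0.
  have lt (e : 'I_m) : (e < N)%N by exact: leq_trans (ltn_ord e) mN.
  rewrite -(inj_eq val_inj) /= !val_Zp_nat // !modn_small //.
under eq_bigr => a _.
  under eq_bigr => b _ do rewrite ab.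
  rewrite (bigD1 a) //= eqxx big1 ?addr0; last by move=> b; rewrite eq_sym => /negbTE ->.
  over.
rewrite sumr_const card_ord -[N%:R *+ m]mulr_natl mulrA -[X in _ * X * _](rmorph_nat (real_complex R)).
by rewrite -rmorphM /= mulVf ?mul1r // pnatr_eq0 -lt0n.
Qed.

(** Multiplied by [zchar c - 1] the geometric sum telescopes to
    [zchar (m c) - 1]. *)
Lemma fejer_second_moment c : fejer c * cabs (zchar c - 1 : R[i]) ^+ 2 <= 4 / m%:R.
Proof.
rewrite /fejer mulrAC -exprMn -cabsM.
have -> : (\sum_(a < m) zchar ((a : nat)%:R * c)) * (zchar c - 1) = zchar (m%:R * c) - 1 :> R[i].
  elim: (m) => [|k IH]; first by rewrite big_ord0 mul0r mul0r zchar0 subrr.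
  rewrite big_ord_recr mulrDl IH /= -[k.+1]addn1 natrD mulrDl mul1r zcharD //; ring.
rewrite ler_wpM2r ?invr_ge0 //.
have : cabs (zchar (m%:R * c) - 1 : R[i]) <= 2.
  apply: le_trans (ler_cabsD _ _) _; rewrite cabsN cabs_zchar.
  by rewrite -(rmorph1 (real_complex R)) cabs_real normr1.
by have := cabs_ge0 (zchar (m%:R * c) - 1 : R[i]); nra.
Qed.

End fejer_kernel.

Section concentration.
Context {R : realType}.

Lemma cis_near1 (r : R) : 0 < r -> exists2 eta, 0 < eta &
  forall u, 0 <= u <= 2 * pi -> cabs (cis u - 1) ^+ 2 < eta ->
    exists b : bool, `|u - 2 * pi * b%:R| <= r.
Proof.
move=> r0; pose s := Num.min r pi; have pi0 := pi_gt0 R.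
have s0 : 0 < s by rewrite lt_min r0.
have sp : s \in `[0, pi] by rewrite in_itv /= (ltW s0) ge_min lexx orbT.
have p0 : (0 : R) \in `[0, pi] by rewrite in_itv /= lexx ltW.
exists (2 - 2 * cos s).
  by have := ltr_cos p0 sp; rewrite cos0 /= s0 => ?; lra.
have half u : 0 <= u <= pi -> 2 - 2 * cos u < 2 - 2 * cos s -> u <= r.
  move=> u0 h; have up : u \in `[0, pi] by rewrite in_itv.
  have := ltr_cos up sp; rewrite /= => e.
  have : u < s by rewrite -e; lra.
  by rewrite lt_min => /andP[/ltW].
move=> u /andP[u0 u2]; rewrite sqr_cabs_cisB1 => h; have [up|up] := leP u pi.
  by exists false; rewrite mulr0 subr0 ger0_norm // half // u0.
exists true; rewrite mulr1 distrC ger0_norm ?subr_ge0 // half //.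
  by rewrite subr_ge0 u2 /=; lra.
by rewrite -cosN opprB -(cosD2pi (u - _)) -[pi *+ 2]mulr_natl subrK.
Qed.

End concentration.

(** * Spectral projections of a torus action *)

Section torus_characters.
Context {R : realType} {d : nat}.
Implicit Types (k l : 'rV[int]_d) (x y : 'rV[R]_d).

Lemma dotZD k x y : dotZ k (x + y) = dotZ k x + dotZ k y.
Proof. by rewrite -big_split; apply: eq_bigr => j _; rewrite mxE mulrDr. Qed.

Lemma dotZBl k l x : dotZ (k - l) x = dotZ k x - dotZ l x.
Proof.
by rewrite -sumrB; apply: eq_bigr => j _; rewrite !mxE intrB mulrBl.
Qed.

Lemma dotZ_delta k (u : R) j : dotZ k (u *: delta_mx ord0 j) = (k ord0 j)%:~R * u.
Proof.
rewrite /dotZ (bigD1 j) //= !mxE !eqxx mulr1 big1 ?addr0 // => i ij.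
by rewrite !mxE (negbTE ij) andbF !mulr0.
Qed.

Lemma cis_small (e : R) : 0 < e -> exists2 r : R, 0 < r &
  forall u, `|u| <= r -> cabs (cis u - 1) <= e.
Proof.
move=> e0; have e2 : 0 < e ^+ 2 / 2 by rewrite divr_gt0 // exprn_gt0.
have /cvgrPdist_lt /(_ _ e2) := @continuous_cos R 0.
case=> r /= r0 hr; exists (r / 2) => [|u ur]; first by rewrite divr_gt0.
have : `|cos 0 - cos u| < e ^+ 2 / 2.
  apply: hr; rewrite /= sub0r normrN; apply: le_lt_trans ur _.
  by rewrite ltr_pdivrMr // ltr_pMr // ltr1n.
rewrite cos0 => /ltr_normlW h.
rewrite -(ler_pXn2r (n := 2)) ?nnegrE ?cabs_ge0 ?(ltW e0) // sqr_cabs_cisB1; lra.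
Qed.

End torus_characters.

Section fourier_projections.
Context {R : realType} {d : nat} {E : completeNormedModType R[i]}.
Variable U : 'rV[R]_d -> E -> E.
Hypothesis HU : torus_action U.
Implicit Types (k l : 'rV[int]_d) (x y : 'rV[R]_d) (f g h : E).

(** Twisting the action by a character turns the vectors of frequency [k] into
    the invariant ones. *)
Definition twist k x f : E := cis (dotZ k x) *: U x f.

Lemma twistP k x (a : R[i]) f g : twist k x (a *: f + g) = a *: twist k x f + twist k x g.
Proof. by rewrite /twist (act_linear HU) scalerDr !scalerA mulrC. Qed.

Lemma twist_norm k x f : rnorm (twist k x f) = rnorm f.
Proof. by rewrite rnormZ cabs_cis mul1r (act_norm HU). Qed.

Lemma twistD k x y f : twist k (x + y) f = twist k x (twist k y f).
Proof.
rewrite /twist (act_add HU) dotZD cisD -[in RHS](addr0 (_ *: U y f)) (act_linear HU).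
by rewrite (torus_act0r HU) addr0 scalerA.
Qed.

Lemma twist_per k j f : twist k ((2 * pi) *: delta_mx ord0 j) f = f.
Proof. by rewrite /twist (act_period HU) dotZ_delta mulrC cis2piz scale1r. Qed.

Lemma twist_cont k f (e : R) : 0 < e -> exists2 r : R, 0 < r &
  forall x : 'rV[R]_d, (forall j, `|x ord0 j| <= r) -> rnorm (twist k x f - f) <= e.
Proof.
move=> e0; have e2 : 0 < e / 2 by rewrite divr_gt0.
have [r r0 hr] := act_small HU f e2.
have f1 : 0 < rnorm f + 1 by rewrite ltr_wpDl ?rnorm_ge0.
have e3 : 0 < e / 2 / (rnorm f + 1) by rewrite divr_gt0.
have [s s0 hs] := cis_small e3.
pose K : R := \sum_j `|(k ord0 j)%:~R| + 1.
have K0 : 0 < K by rewrite ltr_wpDl // sumr_ge0.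
exists (Num.min r (s / K)); first by rewrite lt_min r0 divr_gt0.
move=> x hx.
have -> : twist k x f - f = cis (dotZ k x) *: (U x f - f) + (cis (dotZ k x) - 1) *: f.
  by rewrite scalerBr scalerBl scale1r addrA subrK.
apply: le_trans (ler_rnormD _ _) _; rewrite [e]splitr; apply: lerD.
  rewrite rnormZ cabs_cis mul1r; apply: hr => j; apply: le_trans (hx j) _.
  by rewrite ge_min lexx.
rewrite rnormZ; apply: le_trans (_ : e / 2 / (rnorm f + 1) * rnorm f <= _); last first.
  by rewrite mulrAC ler_pdivrMr // ler_pM2l // lerDl.
rewrite ler_wpM2r ?rnorm_ge0 // hs //.
apply: le_trans (ler_norm_sum _ _ _) _.
apply: le_trans (_ : \sum_j `|(k ord0 j)%:~R| * (s / K) <= _).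
  apply: ler_sum => j _; rewrite normrM ler_wpM2l //; apply: le_trans (hx j) _.
  by rewrite ge_min lexx orbT.
by rewrite -mulr_suml mulrC -mulrA ler_piMr ?(ltW s0) // ler_pdivrMl // mulr1 lerDl.
Qed.

Lemma twist_action k : torus_action (twist k).
Proof.
exact: TorusAction (twistP k) (twist_norm k) (twistD k) (twist_per k) (twist_cont k).
Qed.

Definition freq_proj k f : E := mean (twist k) f.

(** The vectors of frequency [k]. *)
Definition eigen k h := forall x, U x h = cis (- dotZ k x) *: h.

Lemma freq_projP k (a : R[i]) f g : freq_proj k (a *: f + g) = a *: freq_proj k f + freq_proj k g.
Proof.
exact: (meanP (twist_action k)).
Qed.

Lemma rnorm_proj k f : rnorm (freq_proj k f) <= rnorm f.
Proof.
exact: (rnorm_mean (twist_action k)).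
Qed.

Lemma cis_scaleK (u : R) f : cis (- u) *: (cis u *: f) = f.
Proof. by rewrite scalerA -cisD addNr cis0 scale1r. Qed.

Lemma eigen_proj k f : eigen k (freq_proj k f).
Proof.
move=> x; have := torus_act_mean (twist_action k) x f.
by rewrite {1}/twist -/(freq_proj k f) => {2}<-; rewrite cis_scaleK.
Qed.

Lemma proj_eigen k h : eigen k h -> freq_proj k h = h.
Proof.
move=> kh; apply: (mean_invariant (twist_action k)) => x.
by rewrite /twist kh scalerA -cisD subrr cis0 scale1r.
Qed.

(** A translation by half a period of the frequency difference changes the sign
    of [h], but not its mean. *)
Lemma proj_eigen0 k l h : eigen l h -> k != l -> freq_proj k h = 0.
Proof.
move=> lh kl.
have [j kj] : exists j, k ord0 j != l ord0 j.
  apply/existsP; apply: contraNT kl; rewrite negb_exists => /forallP kl.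
  by apply/eqP/rowP => j; apply/eqP; have := kl j; rewrite negbK.
pose u : R := pi / (k ord0 j - l ord0 j)%:~R; pose x : 'rV[R]_d := u *: delta_mx ord0 j.
have xh : twist k x h = -1 *: h.
  rewrite /twist lh scalerA -cisD -dotZBl dotZ_delta !mxE mulrC /u divfK.
    by congr (_ *: _); rewrite /cis cospi sinpi; apply/eqP; rewrite eq_complex /= oppr0 !eqxx.
  by rewrite intr_eq0 subr_eq0.
have : freq_proj k (twist k x h) = freq_proj k h.
  exact: (mean_translate (twist_action k)).
rewrite xh -[X in freq_proj k X]addr0 freq_projP => h1.
have p0 : freq_proj k 0 = 0.
  by apply: rnorm0_eq0; apply/eqP; rewrite eq_le rnorm_ge0 -(@rnorm0 _ E) rnorm_proj.
move: h1; rewrite p0 addr0 scaleN1r => /eqP; rewrite eq_sym -subr_eq0 opprK -mulr2n.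
by rewrite -scaler_nat scaler_eq0 pnatr_eq0 /= => /eqP.
Qed.

Lemma proj_functional k (phi : E -> R[i]) (K : R) f :
  (forall g h, phi (g + h) = phi g + phi h) ->
  (forall a g, phi (a *: g) = a * phi g) ->
  (forall g, cabs (phi g) <= K * rnorm g) ->
  (forall x, phi (U x f) = cis (- dotZ k x) * phi f) -> phi (freq_proj k f) = phi f.
Proof.
move=> phiD phiZ phiK phiU.
apply: (mean_functional (twist_action k)
  phiD phiZ phiK) => x.
by rewrite /twist phiZ phiU mulrA -cisD subrr cis0 mul1r.
Qed.

End fourier_projections.

(** * Density of trigonometric polynomials *)

Section fejer_approximation.
Context {R : realType} {d : nat} {E : completeNormedModType R[i]}.
Variable U : 'rV[R]_d -> E -> E.
Hypothesis HU : torus_action U.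
Implicit Types (k l : 'rV[int]_d) (x y : 'rV[R]_d) (f g h : E).

Section weights.
Variables (N m : nat).
Hypothesis N1 : (1 < N)%N.
Hypothesis m0 : (0 < m)%N.
Hypothesis mN : (m <= N)%N.
Local Notation J := {ffun 'I_d -> 'I_m * 'I_m}.

Definition fejer_weight (y : {ffun 'I_d -> 'Z_N}) : R := \prod_j fejer m (y j).

Definition diff_freq (p : J) : 'rV[int]_d := \row_j ((p j).1%:Z - (p j).2%:Z).

Lemma fejer_weight_ge0 (y : {ffun 'I_d -> 'Z_N}) : 0 <= fejer_weight y.
Proof. by apply: prodr_ge0 => j _; exact: fejer_ge0. Qed.

Lemma fejer_weight_sum : \sum_y fejer_weight y = (N ^ d)%:R.
Proof.
rewrite /fejer_weight -(bigA_distr_bigA (fun j a => fejer m a)) /=.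
by under eq_bigr do rewrite fejer_sum //; rewrite prodr_const card_ord natrX.
Qed.

(** All directions but [j] contribute the total mass of a Fejer kernel. *)
Lemma fejer_weight_second_moment j :
  \sum_y fejer_weight y * cabs (zchar (y j) - 1 : R[i]) ^+ 2 <= (N ^ d)%:R * (4 / m%:R).
Proof.
pose g i (a : 'Z_N) : R := fejer m a * (if i == j then cabs (zchar a - 1 : R[i]) ^+ 2 else 1).
under eq_bigr => y _.
  rewrite (_ : _ * _ = \prod_i g i (y i)); last first.
    rewrite /g big_split /=; congr (_ * _).
    by rewrite (bigD1 j) //= eqxx big1 ?mulr1 // => i /negbTE ->.
  over.
rewrite -(bigA_distr_bigA g) /= (bigD1 j) //= {1}/g eqxx.
rewrite [X in _ * X](_ : _ = N%:R ^+ d.-1); last first.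
  under eq_bigr => i ij do under eq_bigr => a _ do rewrite /g (negbTE ij) mulr1.
  under eq_bigr do rewrite fejer_sum //.
  by rewrite prodr_const cardC1 card_ord.
have d0 : (0 < d)%N by exact: leq_ltn_trans (ltn_ord j).
rewrite [leRHS](_ : _ = (N%:R * (4 / m%:R)) * N%:R ^+ d.-1); last first.
  by rewrite natrX -{1}(prednK d0) exprS; ring.
rewrite ler_wpM2r ?exprn_ge0 //.
apply: le_trans (_ : \sum_(a : 'Z_N) 4 / m%:R <= _).
  by apply: ler_sum => a _; exact: fejer_second_moment.
by rewrite sumr_const card_ord /= Zp_cast // -[leLHS]mulr_natl.
Qed.

Lemma fejer_weightE (y : {ffun 'I_d -> 'Z_N}) :
  (fejer_weight y)%:C = ((m%:R ^- d))%:C * \sum_(p : J) cis (dotZ (diff_freq p) (grid y)).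
Proof.
rewrite /fejer_weight rmorph_prod /=; under eq_bigr do rewrite fejerE // pair_big /=.
rewrite big_split /= prodr_const card_ord -rmorphXn exprVn /=; congr (_ * _).
rewrite (bigA_distr_bigA (fun j (q : 'I_m * 'I_m) =>
  zchar (((q.1 : nat)%:R - (q.2 : nat)%:R) * y j))) /=.
apply: eq_bigr => p _; rewrite /dotZ cis_sum; apply: eq_bigr => j _; rewrite !mxE.
rewrite -[y j in LHS]natr_Zp -[X in zchar X](_ : (((p j).1%:Z - (p j).2%:Z) * (y j : nat)%:Z)%:~R = _).
  by rewrite zchar_int // intrM -pmulrn; congr cis; ring.
by rewrite intrM intrB -!pmulrn.
Qed.

Lemma sum_avg_twist f :
  \sum_(p : J) (m%:R ^- d)%:C *: avg (twist U (diff_freq p)) N f =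
  ((N ^ d)%:R^-1)%:C *: \sum_(y : {ffun 'I_d -> 'Z_N}) (fejer_weight y)%:C *: U (grid y) f.
Proof.
rewrite /avg; under eq_bigr do rewrite scalerA mulrC -scalerA.
rewrite -scaler_sumr; congr (_ *: _).
under eq_bigr do rewrite scaler_sumr; rewrite exchange_big /=; apply: eq_bigr => y _.
by rewrite fejer_weightE mulr_sumr scaler_suml; apply: eq_bigr => p _; rewrite /twist scalerA.
Qed.

Lemma grid_near0 (r eta : R) : (forall u, 0 <= u <= 2 * pi -> cabs (cis u - 1) ^+ 2 < eta ->
    exists b : bool, `|u - 2 * pi * b%:R| <= r) ->
  forall y : {ffun 'I_d -> 'Z_N}, (forall j, cabs (zchar (y j) - 1 : R[i]) ^+ 2 < eta) ->
  exists z, forall j, `|(grid y - period z : 'rV[R]_d) ord0 j| <= r.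
Proof.
move=> hr y hy; have Np : 0 < N%:R :> R by rewrite ltr0n ltnW.
have pi0 := pi_ge0 R.
have h j : exists b : bool, `|2 * pi * (y j : nat)%:R / N%:R - 2 * pi * b%:R| <= r.
  apply: hr (hy j); rewrite divr_ge0 ?mulr_ge0 //= ler_pdivrMr // ler_wpM2l ?mulr_ge0 //.
  by rewrite ler_nat -[X in (_ <= X)%N](Zp_cast N1) ltnW.
have [b hb] := choice h; exists (\row_j (b j : nat)%:Z) => j.
by rewrite !mxE -pmulrn.
Qed.

End weights.

(** Fejer means are averages of translates for a probability concentrated at
    the origin, hence approximate the identity, and they are combinations of
    spectral projections. *)
Lemma fejer_approx f (e : R) : 0 < e -> exists (J : finType) (k : J -> 'rV[int]_d) (c : R[i]),
  rnorm (f - \sum_j c *: freq_proj U (k j) f) <= e.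
Proof.
move=> e0; have e2 : 0 < e / 2 by rewrite divr_gt0.
have [r r0 hr] := act_small HU f e2.
have [eta eta0 heta] := cis_near1 r0.
pose K : R := 2 * rnorm f / eta.
have K0 : 0 <= K by rewrite divr_ge0 ?mulr_ge0 ?rnorm_ge0 // ltW.
pose m := (Num.bound (2 * (K * (d%:R * 4)) / e)).+1.
have hm : K * (d%:R * (4 / m%:R)) <= e / 2.
  have h : 2 * (K * (d%:R * 4)) / e < m%:R.
    apply: lt_le_trans (archi_boundP _) _; last by rewrite ler_nat.
    by apply: divr_ge0; [apply: mulr_ge0 => //; exact: mulr_ge0|exact: ltW].
  rewrite !mulrA ler_pdivrMr ?ltr0n //; move: h; rewrite ltr_pdivrMr //.
  by rewrite [m%:R * e]mulrC -!mulrA => h; lra.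
pose J := {ffun 'I_d -> 'I_m * 'I_m}.
exists J, (@diff_freq m), (m%:R ^- d)%:C; rewrite rdistC.
have cv : (\sum_(p : J) (m%:R ^- d)%:C *: avg (twist U (diff_freq p)) n.+2 f) @[n --> \oo] -->
    \sum_(p : J) (m%:R ^- d)%:C *: freq_proj U (diff_freq p) f.
  apply: cvg_big => [|p _]; first exact: add_continuous.
  apply: cvgZr.
  exact: (mean_cvg (twist_action HU _)).
apply: cvg_rnorm_le cv _; exists m => // n /= mn.
set N := n.+2; have N1 : (1 < N)%N by [].
have mN : (m <= N)%N by rewrite (leq_trans mn) // /N -addn2 leq_addr.
have N0 : 0 < (N ^ d)%:R :> R by rewrite ltr0n expn_gt0.
rewrite sum_avg_twist //.
have -> : ((N ^ d)%:R^-1)%:C *: \sum_(y : {ffun 'I_d -> 'Z_N}) (fejer_weight m y)%:C *: U (grid y) f - f =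
   ((N ^ d)%:R^-1)%:C *: \sum_(y : {ffun 'I_d -> 'Z_N}) (fejer_weight m y)%:C *: (U (grid y) f - f).
  under [in RHS]eq_bigr do rewrite scalerBr.
  rewrite sumrB -scaler_suml -rmorph_sum /= fejer_weight_sum // scalerBr scalerA -rmorphM /=.
  by rewrite mulVf ?gt_eqF // scale1r.
rewrite rnormZ cabs_real ger0_norm ?invr_ge0 ?(ltW N0) // ler_pdivrMl //.
apply: le_trans (ler_rnorm_sum _ _ _) _.
(* Chebyshev: a grid point away from the origin has a large term in the sum *)
have pt (y : {ffun 'I_d -> 'Z_N}) : rnorm ((fejer_weight m y)%:C *: (U (grid y) f - f)) <=
    fejer_weight m y * (e / 2) +
    \sum_j K * (fejer_weight m y * cabs (zchar (y j) - 1 : R[i]) ^+ 2).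
  rewrite rnormZ cabs_real ger0_norm ?fejer_weight_ge0 //.
  have w0 := fejer_weight_ge0 m y.
  have [/forallP hy|] := boolP [forall j, cabs (zchar (y j) - 1 : R[i]) ^+ 2 < eta].
    rewrite -[leLHS]addr0; apply: lerD; last first.
      by apply: sumr_ge0 => j _; exact: mulr_ge0 K0 (mulr_ge0 w0 (sqr_ge0 _)).
    rewrite ler_wpM2l //; have [z hz] := grid_near0 N1 heta hy.
    rewrite -[X in rnorm (X - _)](_ : U (grid y - period z) f = _); first exact: hr.
    rewrite -[in RHS](subrK (period z) (grid y)) [in RHS](act_add HU).
    by rewrite (torus_act_period HU).
  rewrite negb_forall => /existsP[j]; rewrite -leNgt => hj.
  rewrite -[leLHS]add0r; apply: lerD; first by rewrite mulr_ge0 // ltW.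
  rewrite (bigD1 j) //= -[leLHS]addr0; apply: lerD; last first.
    by apply: sumr_ge0 => i _; exact: mulr_ge0 K0 (mulr_ge0 w0 (sqr_ge0 _)).
  rewrite mulrCA; apply: ler_wpM2l => //.
  apply: le_trans (_ : K * eta <= _); last exact: ler_wpM2l.
  rewrite /K divfK ?gt_eqF //; apply: le_trans (ler_rnormD _ _) _.
  by rewrite rnormN (act_norm HU) mulr_natl.
apply: le_trans (_ : \sum_(y : {ffun 'I_d -> 'Z_N}) (fejer_weight m y * (e / 2) +
    \sum_j K * (fejer_weight m y * cabs (zchar (y j) - 1 : R[i]) ^+ 2)) <= _).
  by apply: ler_sum => y _; exact: pt.
rewrite big_split /= -mulr_suml fejer_weight_sum // [e in leRHS]splitr mulrDr lerD2l.
rewrite exchange_big /=; under eq_bigr do rewrite -mulr_sumr.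
apply: le_trans (_ : \sum_(j < d) K * ((N ^ d)%:R * (4 / m%:R)) <= _).
  by apply: ler_sum => j _; apply: ler_wpM2l => //; exact: fejer_weight_second_moment.
rewrite sumr_const card_ord -[leLHS]mulr_natl.
rewrite [leLHS](_ : _ = (N ^ d)%:R * (K * (d%:R * (4 / m%:R)))); last by ring.
exact: ler_wpM2l.
Qed.

End fejer_approximation.

(** * Multiplier operators *)

Section multiplier_operator.
Context {R : realType} {d : nat} {E : completeNormedModType R[i]}.
Variable U : 'rV[R]_d -> E -> E.
Hypothesis HU : torus_action U.
Implicit Types (k l : 'rV[int]_d) (x y : 'rV[R]_d) (f g h : E).

Definition multiplier_op (s : seq 'rV[int]_d) (M : 'rV[int]_d -> R) f : E :=
  \sum_(l <- s) (M l)%:C *: freq_proj U l f.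

Section fixed_multiplier.
Variables (s : seq 'rV[int]_d) (M : 'rV[int]_d -> R).
Hypothesis s_uniq : uniq s.
Hypothesis M_supp : forall k, k \notin s -> M k = 0.
Local Notation T := (multiplier_op s M).

Lemma multiplier_opP (a : R[i]) f g : T (a *: f + g) = a *: T f + T g.
Proof.
rewrite /multiplier_op scaler_sumr -big_split /=; apply: eq_bigr => l _.
by rewrite (freq_projP HU) scalerDr !scalerA mulrC.
Qed.

Lemma rnorm_multiplier_op f : rnorm (T f) <= (\sum_(l <- s) `|M l|) * rnorm f.
Proof.
apply: le_trans (ler_rnorm_sum _ _ _) _; rewrite mulr_suml; apply: ler_sum => l _.
by rewrite rnormZ cabs_real ler_wpM2l // (rnorm_proj HU).
Qed.

Lemma multiplier_op_eigen k h : eigen U k h -> T h = (M k)%:C *: h.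
Proof.
move=> kh; have E0 l : l != k -> (M l)%:C *: freq_proj U l h = 0.
  by move=> lk; rewrite (proj_eigen0 HU kh lk) scaler0.
have Ek : freq_proj U k h = h := proj_eigen HU kh.
have [ks|ks] := boolP (k \in s).
  by rewrite /multiplier_op (bigD1_seq k) //= Ek big1 ?addr0.
rewrite M_supp // scale0r /multiplier_op big_seq big1 // => l ls.
by apply: E0; apply: contraNneq ks => <-.
Qed.

Lemma multiplier_op_poly (J : finType) (k : J -> 'rV[int]_d) (c : R[i]) f :
  T (\sum_j c *: freq_proj U (k j) f) = \sum_j c *: ((M (k j))%:C *: freq_proj U (k j) f).
Proof.
have T0 : T 0 = 0 by rewrite -[X in T X](addNr (0 : E)) -scaleN1r multiplier_opP scaleN1r addNr.
have TD g h : T (g + h) = T g + T h by rewrite -[g in LHS]scale1r multiplier_opP scale1r.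
have TZ a g : T (a *: g) = a *: T g by rewrite -[a *: g in LHS]addr0 multiplier_opP T0 addr0.
rewrite (big_morph _ TD T0); apply: eq_bigr => j _; rewrite TZ; congr (_ *: _).
by apply: multiplier_op_eigen; exact: (eigen_proj HU).
Qed.

Lemma multiplier_opB f g : T (f - g) = T f - T g.
Proof. by rewrite addrC -scaleN1r multiplier_opP scaleN1r addrC. Qed.

(** On a trigonometric polynomial the operator is the combination of
    translations given by the kernel on the frequencies that occur; the general
    case follows by density. *)
Lemma multiplier_op_bound (C : R) f :
  (forall F : seq 'rV[int]_d, mass_bound C F M) -> rnorm (T f) <= C * rnorm f.
Proof.
move=> hC.
have C0 : 0 <= C.
  by have [r h _] := hC [::]; apply: le_trans h; apply: sumr_ge0 => i _; exact: cabs_ge0.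
apply/ler_addgt0Pr => e e0.
pose K := \sum_(l <- s) `|M l| + C.
have K0 : 0 <= K by rewrite addr_ge0 // sumr_ge0.
have e1 : 0 < e / (K + 1) by rewrite divr_gt0 // ltr_wpDl.
have [J [k [c hg]]] := fejer_approx HU f e1.
set g := \sum_j _ in hg.
have gb : rnorm (T g) <= C * rnorm g.
  have [r r1 r2] := hC [seq k j | j <- index_enum J].
  have -> : T g = \sum_(cx <- r) cx.1 *: U cx.2 g.
    rewrite /g multiplier_op_poly.
    under [RHS]eq_bigr do rewrite (torus_act_sum HU) scaler_sumr.
    rewrite exchange_big /=; apply: eq_bigr => j _.
    rewrite -r2; last by apply: map_f; rewrite mem_index_enum.
    rewrite scaler_suml scaler_sumr; apply: eq_bigr => cx _.
    rewrite (torus_actZ HU) (eigen_proj HU).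
    by rewrite !scalerA; congr (_ *: _); ring.
  apply: le_trans (ler_rnorm_sum _ _ _) _.
  under eq_bigr do rewrite rnormZ (act_norm HU).
  by rewrite -mulr_suml ler_wpM2r ?rnorm_ge0.
have -> : T f = T (f - g) + T g by rewrite multiplier_opB subrK.
apply: le_trans (ler_rnormD _ _) _.
have h1 := rnorm_multiplier_op (f - g).
have h2 : rnorm g <= rnorm f + rnorm (f - g).
  by rewrite -[X in rnorm X <= _](subKr f) -[rnorm (f - g)]rnormN ler_rnormD.
have h3 : K * rnorm (f - g) <= e.
  apply: le_trans (_ : K * (e / (K + 1)) <= _); first exact: ler_wpM2l.
  by rewrite mulrA ler_pdivrMr ?ltr_wpDl // mulrC ler_wpM2l ?(ltW e0) // lerDl.
apply: le_trans (lerD h1 gb) _.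
apply: le_trans (_ : (\sum_(l <- s) `|M l|) * rnorm (f - g) + C * (rnorm f + rnorm (f - g)) <= _).
  by rewrite lerD2l ler_wpM2l.
by move: h3; rewrite /K mulrDl mulrDr => h3; lra.
Qed.

End fixed_multiplier.

(** On trigonometric polynomials the convergence is that of finitely many
    coefficients; the uniform bound carries it to the closure. *)
Lemma multiplier_op_cvg (C : R) (s : nat -> seq 'rV[int]_d) (M : nat -> 'rV[int]_d -> R) f :
  (forall n, (0 < n)%N -> uniq (s n)) ->
  (forall n k, (0 < n)%N -> k \notin s n -> M n k = 0) ->
  (forall n F, (0 < n)%N -> mass_bound C F (M n)) ->
  (forall k, M n k @[n --> \oo] --> (1 : R)) ->
  multiplier_op (s n) (M n) f @[n --> \oo] --> f.
Proof.
move=> su sM hC M1; apply/cvg_rnormP => e e0.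
have C0 : 0 <= C.
  have [r h _] := hC 1%N [::] isT.
  by apply: le_trans h; apply: sumr_ge0 => i _; exact: cabs_ge0.
have e1 : 0 < e / 2 / (C + 1) by rewrite !divr_gt0 // ltr_wpDl.
have [J [k [c hg]]] := fejer_approx HU f e1.
set g := \sum_j _ in hg.
have gc : multiplier_op (s n) (M n) g @[n --> \oo] --> g.
  have h : \sum_j c *: ((M n (k j))%:C *: freq_proj U (k j) f) @[n --> \oo] --> g.
    apply: cvg_big => [|j _]; first exact: add_continuous.
    apply: cvgZr; rewrite -[X in _ --> X]scale1r; apply: cvgZl.
    apply/cvgrPdist_lt => h h0.
    have hr : h = (complex.Re h)%:C by rewrite RRe_real // gtr0_real.
    move: h0; rewrite hr ltcR => h0.
    have /cvgrPdist_lt /(_ _ h0) := M1 (k j); apply: filterS => n.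
    by rewrite -(rmorph1 (real_complex R)) -rmorphB /= cabsE cabs_real ltcR.
  apply: cvg_trans h; apply: near_eq_cvg; exists 1%N => // n n0 /=.
  by rewrite (multiplier_op_poly (su n n0)) // => l ls; exact: sM.
have e2 : 0 < e / 2 by rewrite divr_gt0.
have /cvg_rnormP /(_ _ e2) := gc.
move=> [N0 _ hN]; exists (maxn 1 N0) => // n /=; rewrite geq_max => /andP[n0 nN].
have := hN n nN => /= h.
have sMn l : l \notin s n -> M n l = 0 by exact: sM.
have hb := multiplier_op_bound (su n n0) sMn (f - g) (fun F => hC n F n0).
have -> : f - multiplier_op (s n) (M n) f =
    (f - g) + (g - multiplier_op (s n) (M n) g) - multiplier_op (s n) (M n) (f - g).
  by rewrite multiplier_opB // addrA subrK opprB addrA subrK.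
apply: le_lt_trans (ler_rnormD _ _) _; rewrite rnormN.
apply: le_lt_trans (lerD (ler_rnormD _ _) hb) _.
have : (C + 1) * rnorm (f - g) <= e / 2.
  by rewrite -ler_pdivlMl ?ltr_wpDl // mulrC.
by rewrite mulrDl mul1r => h2; move: h; lra.
Qed.

End multiplier_operator.

(** * Translation invariance of the Lebesgue measure of the line and of a period *)

Section lebesgue_translation.
Context {R : realType}.
Local Notation mu := (@lebesgue_measure R).
Local Open Scope ereal_scope.

Lemma measurable_addr (x : R) : measurable_fun [set: R] (fun s : R => (s + x)%R).
Proof. by apply: measurable_funD => //; exact: measurable_cst. Qed.

Lemma lebesgue_measure_translate (x : R) (A : set R) : measurable A ->
  mu ((fun s : R => (s + x)%R) @^-1` A) = mu A.
Proof.
move=> mA.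
have mf : measurable_fun [set: measurableTypeR R] (fun s : R => (s + x)%R : measurableTypeR R).
  exact: measurable_addr.
pose f : {mfun measurableTypeR R >-> measurableTypeR R} := HB.pack (fun s : R => (s + x)%R) (isMeasurableFun.Build _ _ _ _ _ mf).
apply/esym; apply: (lebesgue_measure_unique (mu := pushforward mu f)) => // X [[a b] _ <-].
transitivity (mu [set` `](a - x), (b - x)]%R]); last first.
  congr (mu _); apply/seteqP; split => s; by rewrite /= !in_itv /= ltrBlDr lerBrDr.
rewrite !lebesgue_measure_itv /= !lte_fin ltrD2r.
by case: ifP => // _; rewrite -!EFinB; congr EFin; ring.
Qed.

Lemma integral_translate (x : R) (D : set R) (g : R -> \bar R) :
  measurable D -> measurable_fun [set: R] g -> (forall s, 0 <= g s) ->
  \int[mu]_(s in (fun s : R => (s + x)%R) @^-1` D) g (s + x)%R = \int[mu]_(s in D) g s.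
Proof.
move=> mD mg g0; have mf := measurable_addr x.
rewrite -[LHS](@ge0_integral_pushforward _ _ (measurableTypeR R) (measurableTypeR R) R _ mf mu _ g) //; last first.
  exact: measurable_funS mg.
by apply: eq_measure_integral => A mA _; exact: lebesgue_measure_translate.
Qed.

Section periodic.
Variables (c : R) (g : R -> \bar R).
Hypothesis c0 : (0 < c)%R.
Hypothesis mg : measurable_fun [set: R] g.
Hypothesis g0 : forall s, 0 <= g s.
Hypothesis gc : forall s, g (s + c)%R = g s.

Let J (a b : R) := \int[mu]_(s in [set` `[a, b[%R]) g s.

Let J_cat a b e : (a <= b)%R -> (b <= e)%R -> J a e = J a b + J b e.
Proof.
move=> ab be; rewrite /J -ge0_integral_setU //.
- congr (integral _ _ _); apply/seteqP; split => s; rewrite /= !in_itv /=.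
    move=> /andP[as_ se]; have [sb|sb] := ltP s b; first by left; rewrite as_.
    by right; rewrite se.
  move=> [] /andP[h1 h2]; apply/andP; split => //.
    exact: lt_le_trans be.
  exact: le_trans h1.
- exact: measurable_funS mg.
- apply/disj_setPS => s [] /=; rewrite !in_itv /= => /andP[_ h1] /andP[h2 _].
  by move: (lt_le_trans h1 h2); rewrite ltxx.
Qed.

Let J_shift a b x : (forall s, g (s + x)%R = g s) -> J (a + x)%R (b + x)%R = J a b.
Proof.
move=> gx; rewrite /J -[LHS](integral_translate x) //.
rewrite (_ : _ @^-1` _ = [set` `[a, b[%R]); first by apply: eq_integral => s _; rewrite gx.
by apply/seteqP; split => s; rewrite /= !in_itv /= lerD2r ltrD2r.
Qed.

Lemma periodic_int (n : int) s : g (s + c * n%:~R)%R = g s.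
Proof.
have gn m t : g (t + c * m%:R)%R = g t.
  elim: m => [|m IH]; first by rewrite mulr0 addr0.
  by rewrite -natr1 mulrDr mulr1 addrA gc.
case: n => m; first exact: gn.
by rewrite NegzE mulrNz -[LHS](gn m.+1) mulrN subrK.
Qed.

(** Modulo a multiple of [c] the shift is by some [y < c], which moves the first
    piece of length [y] to the other end of the period. *)
Lemma periodic_integral a b : J a (a + c) = J b (b + c).
Proof.
pose n := Num.floor ((b - a) / c); pose y := (b - a - c * n%:~R)%R.
have /andP[n1 n2] : (n%:~R <= (b - a) / c < (n + 1)%:~R)%R := floor_itv _.
have y0 : (0 <= y)%R by rewrite /y subr_ge0 mulrC -ler_pdivlMr.
have yc : (y <= c)%R.
  move: n2; rewrite intrD ltr_pdivrMr // mulrDl mul1r => /ltW h.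
  by rewrite /y lerBlDl [(c * _)%R]mulrC.
have -> : b = (a + y + c * n%:~R)%R by rewrite /y; ring.
rewrite -[(a + y + _ + c)%R](_ : (a + y + c + c * n%:~R)%R = _)%R; last by ring.
rewrite J_shift; last exact: periodic_int.
rewrite (@J_cat a (a + y)%R (a + c)%R) ?lerDl ?lerD2l // (@J_cat (a + y)%R (a + c)%R (a + y + c)%R) ?lerD2l //; last first.
  by rewrite addrAC lerDl.
by rewrite addeC addrAC J_shift // addrAC.
Qed.

End periodic.

Lemma periodic_integral_translate (g : R -> \bar R) (x : R) :
  measurable_fun [set: R] g -> (forall s, 0 <= g s) -> (forall s, g (s + 2 * pi)%R = g s) ->
  \int[mu]_(s in [set` `[- pi, pi]%R]) g (s - x)%R = \int[mu]_(s in [set` `[- pi, pi]%R]) g s.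
Proof.
move=> mg g0 gc; have c0 : (0 < 2 * pi :> R)%R by rewrite mulr_gt0 // pi_gt0.
have mgx : measurable_fun [set: R] (fun s => g (s - x)%R).
  by apply: measurableT_comp => //; exact: measurable_addr.
rewrite -!integral_itv_bndo_bndc; [|exact: measurable_funS mg|exact: measurable_funS mgx].
rewrite -[RHS](integral_translate (- x)) //.
have e : (pi = - pi + 2 * pi :> R)%R by ring.
rewrite [X in `[_, X[%R]e.
rewrite (@periodic_integral _ _ c0 mgx _ _ (- pi)%R (- pi + x)%R) //; last first.
  by move=> s; rewrite addrAC gc.
congr (integral _ _ _).
apply/seteqP; split => s; rewrite /= !in_itv /= lerBrDr ltrBlDr => /andP[-> h] /=.
  by rewrite (lt_le_trans h) //; lra.
by rewrite (lt_le_trans h) //; lra.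
Qed.

End lebesgue_translation.

(** * Translation invariance of the torus *)

Section torus_translation.
Context {R : realType}.
Local Notation mu := (@lebesgue_measure R).
Local Open Scope ereal_scope.

Definition ge0_torus_fun n (F : 'rV[R]_n -> \bar R) :=
  [/\ measurable_fun setT F, forall x, 0 <= F x &
      forall x j, F (x + (2 * pi) *: delta_mx ord0 j)%R = F x].

Lemma measurable_torus n : measurable (torus : set 'rV[R]_n).
Proof.
rewrite (_ : torus = \bigcap_(i in [set: 'I_n])
    ((fun x : 'rV[R]_n => x ord0 i) @^-1` [set` `[- pi, pi]%R])).
  apply: fin_bigcap_measurable => // i _.
  by rewrite -[X in measurable X]setTI; apply: measurable_coord.
apply/seteqP; split => x /= h i; first by move=> _; rewrite /= in_itv /= h.
by have := h i I; rewrite /= in_itv.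
Qed.

Lemma measurable_subr n (x : 'rV[R]_n) : measurable_fun setT (fun t : 'rV[R]_n => (t - x)%R).
Proof.
apply: measurable_fun_rV => i; under eq_fun do rewrite !mxE.
by apply: measurable_funB; [exact: measurable_coord|exact: measurable_cst].
Qed.

Lemma measurable_consr n (s : R) : measurable_fun setT (fun v : 'rV[R]_n => cons_rV (s, v)).
Proof. by apply: measurableT_comp; [exact: measurable_cons_rV|exact: measurable_pair1]. Qed.

(** [measurable_cons_rV] for the copy of [R] that carries [lebesgue_measure]. *)
Lemma measurable_cons_Borel n :
  measurable_fun [set: measurableTypeR R * 'rV[R]_n] (@cons_rV R n).
Proof. exact: measurable_cons_rV. Qed.

Lemma rV_ord0P n (u v : 'rV[R]_n) : (forall i, u ord0 i = v ord0 i) -> u = v.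
Proof. by move=> h; apply/rowP. Qed.

Lemma rV_addE n (u v : 'rV[R]_n) i : ((u + v) ord0 i = u ord0 i + v ord0 i)%R.
Proof. by rewrite mxE. Qed.

Lemma rV_subE n (u v : 'rV[R]_n) i : ((u - v) ord0 i = u ord0 i - v ord0 i)%R.
Proof. by rewrite !mxE. Qed.

Lemma rV_deltaE n (c : R) (i j : 'I_n) :
  ((c *: delta_mx ord0 j : 'rV[R]_n) ord0 i = if i == j then c else 0)%R.
Proof. by rewrite !mxE eqxx /=; case: eqP; rewrite ?mulr1 ?mulr0. Qed.

Lemma integral_torus_succ n (F : 'rV[R]_n.+1 -> \bar R) :
  measurable_fun setT F -> (forall x, 0 <= F x) ->
  \int[lebesgue_rV n.+1]_(x in torus) F x =
  \int[mu]_(s in [set` `[- pi, pi]%R]) \int[lebesgue_rV n]_(v in torus) F (cons_rV (s, v)).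
Proof.
move=> mF F0.
rewrite [LHS](@ge0_integral_pushforward _ _ _ _ R _ (@measurable_cons_Borel n)
   (mu \x lebesgue_rV n) torus F) //; [|exact: measurable_torus|exact: measurable_funS mF].
have -> : @cons_rV R n @^-1` torus = [set` `[- pi, pi]%R] `*` torus.
  apply/seteqP; split => [[s v] h|[s v] [/= h1 h2] i] /=.
    split=> [|i] /=; first by have := h ord0; rewrite cons_rV0 in_itv.
    by have := h (lift ord0 i); rewrite cons_rV_lift.
  case: (unliftP ord0 i) => [j|] ->; rewrite ?cons_rV_lift ?cons_rV0; first exact: h2.
  by move: h1; rewrite in_itv.
have mD : measurable ([set` `[- pi, pi]%R] `*` torus : set (measurableTypeR R * 'rV[R]_n)).
  by apply: measurableX => //; exact: measurable_torus.
rewrite integral_mkcond fubini_tonelli1; first last.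
- by move=> p; rewrite patchE; case: ifP => // _; exact: F0.
- apply/(measurable_restrictT _ mD); apply: measurable_funS (_ : measurable_fun setT _) => //.
  by apply: measurableT_comp => //; exact: measurable_cons_rV.
rewrite [RHS]integral_mkcond; apply: eq_integral => s _.
rewrite /fubini_F [RHS]patchE; case: ifPn => hs.
  rewrite [RHS]integral_mkcond; apply: eq_integral => v _; rewrite !patchE /=.
  congr (if _ then _ else _); apply/idP/idP; rewrite !inE; first by case.
  by move=> ?; split => //; move: hs; rewrite inE.
apply: integral0_eq => v _; rewrite patchE ifN //; apply/negP; rewrite inE => -[/= h _].
by move: hs; rewrite notin_setE.
Qed.

Lemma cons_rVB n (p : R * 'rV[R]_n) (x : 'rV[R]_n.+1) :
  (cons_rV p - x = cons_rV (p.1 - (uncons_rV x).1, p.2 - (uncons_rV x).2))%R.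
Proof.
apply: rV_ord0P => i; case: (unliftP ord0 i) => [j|] ->; rewrite rV_subE.
  by rewrite !cons_rV_lift rV_subE /= [in RHS]mxE.
by rewrite !cons_rV0.
Qed.

Lemma ge0_torus_fun_cons n (F : 'rV[R]_n.+1 -> \bar R) s : ge0_torus_fun F ->
  ge0_torus_fun (fun v => F (cons_rV (s, v))).
Proof.
move=> [mF F0 Fp]; split=> // [|v j].
  by apply: measurableT_comp => //; exact: measurable_consr.
rewrite -[RHS](Fp _ (lift ord0 j)); congr F; apply: rV_ord0P => i.
case: (unliftP ord0 i) => [l|] ->; rewrite rV_addE rV_deltaE.
  by rewrite !cons_rV_lift rV_addE rV_deltaE (inj_eq lift_inj).
by rewrite !cons_rV0 (negbTE (neq_lift _ _)) addr0.
Qed.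

(** Fubini: one coordinate at a time. *)
Lemma integral_torus_translate n (F : 'rV[R]_n -> \bar R) x : ge0_torus_fun F ->
  \int[lebesgue_rV n]_(t in torus) F (t - x)%R = \int[lebesgue_rV n]_(t in torus) F t.
Proof.
elim: n F x => [|n IH] F x [mF F0 Fp].
  by apply: eq_integral => t _; congr F; rewrite [t]thinmx0 [LHS]thinmx0.
have mFx : measurable_fun setT (fun t : 'rV[R]_n.+1 => F (t - x)%R).
  by apply: measurableT_comp => //; exact: measurable_subr.
rewrite (integral_torus_succ mF F0) (integral_torus_succ mFx (fun t => F0 (t - x)%R)).
pose Phi s := \int[lebesgue_rV n]_(v in torus) F (cons_rV (s, v)).
transitivity (\int[mu]_(s in [set` `[- pi, pi]%R]) Phi (s - (uncons_rV x).1)%R).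
  apply: eq_integral => s _; rewrite /Phi.
  rewrite -[RHS](IH (fun v => F (cons_rV ((s - (uncons_rV x).1)%R, v))) (uncons_rV x).2).
    by apply: eq_integral => v _; rewrite cons_rVB.
  exact: ge0_torus_fun_cons.
apply: periodic_integral_translate.
- have mD : measurable (setT `*` torus : set (measurableTypeR R * 'rV[R]_n)).
    by apply: measurableX => //; exact: measurable_torus.
  have mG : measurable_fun [set: measurableTypeR R * 'rV[R]_n]
      ((F \o @cons_rV R n) \_ (setT `*` torus)).
    apply/(measurable_restrictT _ mD); apply: measurable_funS (_ : measurable_fun setT _) => //.
    by apply: measurableT_comp => //; exact: measurable_cons_rV.
  have G0 p : 0 <= ((F \o @cons_rV R n) \_ (setT `*` torus)) p.
    by rewrite patchE; case: ifP => // _; exact: F0.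
  have := @measurable_fun_fubini_tonelli_F _ _ (measurableTypeR R) 'rV[R]_n R (lebesgue_rV n) _ mG G0.
  congr (measurable_fun _ _); apply/funext => s; rewrite /fubini_F /Phi [RHS]integral_mkcond.
  apply: eq_integral => v _; rewrite !patchE /=; congr (if _ then _ else _).
  by apply/idP/idP; rewrite !inE; [case|split].
- by move=> s; apply: integral_ge0.
move=> s; apply: eq_integral => v _; rewrite -[RHS](Fp _ ord0); congr F; apply: rV_ord0P => i.
case: (unliftP ord0 i) => [l|] ->; rewrite rV_addE rV_deltaE.
  by rewrite !cons_rV_lift eq_sym (negbTE (neq_lift _ _)) addr0.
by rewrite !cons_rV0 eqxx.
Qed.

End torus_translation.

(** * Null sets of the torus and translation invariant functions *)

Section torus_null_sets.
Context {R : realType} {n : nat}.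
Implicit Types (f g h : 'rV[R]_n -> R[i]) (x t : 'rV[R]_n).
Local Open Scope ereal_scope.
Local Notation lam := (lebesgue_rV n : set 'rV[R]_n -> \bar R).

(** A measurable distance between the values, which makes almost everywhere
    equality the vanishing of an integral. *)
Definition cgap f g t : \bar R :=
  (`|complex.Re (f t) - complex.Re (g t)| + `|complex.Im (f t) - complex.Im (g t)|)%:E.

Lemma cgap_ge0 f g t : 0 <= cgap f g t.
Proof. by rewrite lee_fin addr_ge0. Qed.

Lemma cgap_eq0 f g t : (cgap f g t == 0) = (f t == g t).
Proof.
rewrite eqe paddr_eq0 // !normr_eq0 !subr_eq0.
by case: (f t) (g t) => a b [c e]; rewrite /= eq_complex.
Qed.

Lemma measurable_cgap f g : cmeasurable f -> cmeasurable g ->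
  measurable_fun setT (cgap f g).
Proof.
move=> [f1 f2] [g1 g2]; apply/measurable_EFinP.
by apply: measurable_funD; apply: measurableT_comp => //; exact: measurable_funB.
Qed.

Lemma ge0_torus_fun_cgap f g : cmeasurable f -> cmeasurable g ->
  torus_periodic f -> torus_periodic g -> ge0_torus_fun (cgap f g).
Proof.
move=> mf mg pf pg; split; [exact: measurable_cgap|exact: cgap_ge0|].
by move=> x j; rewrite /cgap pf pg.
Qed.

Lemma torus_ae_eq_integral f g : cmeasurable f -> cmeasurable g ->
  torus_ae_eq f g <-> \int[lam]_(t in torus) cgap f g t = 0.
Proof.
move=> mf mg; have mG : measurable_fun torus (cgap f g).
  by apply: measurable_funS (measurable_cgap mf mg).
have := ae_eq_integral_abs (lebesgue_rV n) (@measurable_torus R n) mG.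
under eq_integral => t _ do rewrite gee0_abs ?cgap_ge0 //.
move=> [h1 h2]; split.
  move=> fg; apply: h2; apply: filterS fg => t /= h tt.
  by apply/eqP; rewrite cgap_eq0 h.
move=> /h1; apply: filterS => t /= h tt.
by apply/eqP; rewrite -cgap_eq0 h.
Qed.

Lemma cmeasurable_translation x f : cmeasurable f -> cmeasurable (translation x f).
Proof. by move=> [f1 f2]; split; [apply: (measurableT_comp f1)|apply: (measurableT_comp f2)];
  exact: measurable_subr. Qed.

Lemma torus_periodic_translation x f : torus_periodic f -> torus_periodic (translation x f).
Proof. by move=> pf t j; rewrite /translation addrAC pf. Qed.

Lemma torus_ae_eq_translation x f g : cmeasurable f -> cmeasurable g ->
  torus_periodic f -> torus_periodic g ->
  torus_ae_eq f g -> torus_ae_eq (translation x f) (translation x g).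
Proof.
move=> mf mg pf pg /(torus_ae_eq_integral mf mg) h.
apply/torus_ae_eq_integral; [exact: cmeasurable_translation..|].
by rewrite -h; apply: integral_torus_translate; exact: ge0_torus_fun_cgap.
Qed.

Lemma lebesgue_torus : lam torus = ((2 * pi) ^+ n)%:E.
Proof.
rewrite (_ : torus = [set x | forall i, [set` `[- pi, pi]%R] (x ord0 i)]); last first.
  by apply/seteqP; split => x /= h i; have := h i; rewrite /= in_itv.
rewrite (lebesgue_rV_box (A := fun=> [set` `[- pi, pi]%R])) //.
rewrite lebesgue_measure_itv /= lte_fin gtrN ?pi_gt0 // -EFinB opprK.
by rewrite prodEFin prodr_const card_ord mulr_natl.
Qed.

(** The torus has positive measure. *)
Lemma torus_ae_ex (P : set 'rV[R]_n) : {ae lebesgue_rV n, forall t, torus t -> P t} ->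
  exists2 t, torus t & P t.
Proof.
move=> [N [mN N0 hN]]; apply: contrapT => hP.
have : lam torus <= lam N.
  apply: le_measure; rewrite ?inE //; first exact: measurable_torus.
  by move=> t tt; apply: hN => /= h; apply: hP; exists t => //; exact: h.
rewrite N0 lebesgue_torus lee_fin leNgt exprn_gt0 //.
by rewrite mulr_gt0 // pi_gt0.
Qed.

(** An almost everywhere translation invariant function is almost everywhere
    constant: by Fubini some point [t0] has [h (t0 + x) = h t0] for almost all
    [x], and null sets are translation invariant. *)
Lemma torus_invariant_cst h : cmeasurable h -> torus_periodic h ->
  (forall x, torus_ae_eq (translation x h) h) -> exists c, torus_ae_eq h (cst c).
Proof.
move=> mh ph hh.
have mcst c : cmeasurable (cst c : 'rV[R]_n -> R[i]) by split; exact: measurable_cst.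
pose D (p : 'rV[R]_n * 'rV[R]_n) : \bar R :=
  (`|complex.Re (h (p.1 + p.2)) - complex.Re (h p.1)| +
   `|complex.Im (h (p.1 + p.2)) - complex.Im (h p.1)|)%:E%R.
have mtt : measurable (torus `*` torus : set ('rV[R]_n * 'rV[R]_n)).
  by apply: measurableX; exact: measurable_torus.
have madd : measurable_fun setT (fun p : 'rV[R]_n * 'rV[R]_n => (p.1 + p.2)%R).
  apply: measurable_fun_rV => i; under eq_fun do rewrite mxE.
  by apply: measurable_funD; apply: (measurableT_comp (measurable_coord i));
    [exact: measurable_fst|exact: measurable_snd].
have mD : measurable_fun setT D.
  case: mh => h1 h2; apply/measurable_EFinP.
  have mfst := @measurable_fst _ _ 'rV[R]_n 'rV[R]_n.
  apply: measurable_funD; apply: measurableT_comp => //.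
    exact: measurable_funB (measurableT_comp h1 madd) (measurableT_comp h1 mfst).
  exact: measurable_funB (measurableT_comp h2 madd) (measurableT_comp h2 mfst).
have mDp : measurable_fun setT (D \_ (torus `*` torus)).
  by apply/(measurable_restrictT _ mtt); exact: measurable_funS mD.
have D0 p : 0 <= D p by rewrite lee_fin addr_ge0.
have Dp0 p : 0 <= (D \_ (torus `*` torus)) p by rewrite patchE; case: ifP.
have := fubini_tonelli (m1 := lebesgue_rV n) (m2 := lebesgue_rV n) _ mDp Dp0.
have -> : \int[lebesgue_rV n]_y fubini_G (lebesgue_rV n) (D \_ (torus `*` torus)) y = 0.
  apply: integral0_eq => x _; rewrite /fubini_G.
  have [xt|xt] := pselect (torus x); last first.
    by apply: integral0_eq => t _; rewrite patchE ifN //; apply/negP; rewrite inE => -[].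
  have := hh (- x)%R; move/(torus_ae_eq_integral (cmeasurable_translation _ mh) mh).
  move=> e; rewrite -[RHS]e [RHS]integral_mkcond; apply: eq_integral => t _; rewrite !patchE.
  have -> : ((t, x) \in torus `*` torus) = (t \in torus).
    by apply/idP/idP; rewrite !inE; [case|split].
  by case: ifP => // _; rewrite /D /cgap /translation opprK.
have mF := measurable_fun_fubini_tonelli_F (m2 := lebesgue_rV n) _ mDp Dp0.
have F0 t : 0 <= fubini_F (lebesgue_rV n) (D \_ (torus `*` torus)) t.
  by apply: integral_ge0 => x _; exact: Dp0.
move=> IF; have := ae_eq_integral_abs (lebesgue_rV n) measurableT mF.
under eq_integral => t _ do rewrite gee0_abs //.
rewrite IF => -[/(_ erefl) hF _].
have [t0 t0t ht0] : exists2 t, torus t & fubini_F (lebesgue_rV n) (D \_ (torus `*` torus)) t = 0.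
  by apply: torus_ae_ex; apply: filterS hF => t /= h1 _; exact: h1.
exists (h t0); apply/(torus_ae_eq_integral mh (mcst _)).
rewrite -(@integral_torus_translate _ _ _ (- t0)%R); last first.
  exact: ge0_torus_fun_cgap.
rewrite -[RHS]ht0 /fubini_F [LHS]integral_mkcond; apply: eq_integral => x _; rewrite !patchE.
have -> : ((t0, x) \in torus `*` torus) = (x \in torus).
  by apply/idP/idP; rewrite !inE; [case|split].
by case: ifP => // _; rewrite /cgap opprK [(x + t0)%R]addrC.
Qed.

End torus_null_sets.

(** * Fourier coefficients *)

Section fourier_coefficients.
Context {R : realType} {n : nat}.
Implicit Types (f g h : 'rV[R]_n -> R[i]) (x t : 'rV[R]_n) (k : 'rV[int]_n).
Local Notation lam := (lebesgue_rV n : set 'rV[R]_n -> \bar R).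

Definition tintegrable f := cmeasurable f /\ (torus_norm1 f < +oo)%E.

Let mtorus : measurable (torus : set 'rV[R]_n) := @measurable_torus R n.

Lemma normr_Re_le (z : R[i]) : `|complex.Re z| <= cabs z.
Proof.
rewrite -(ler_pXn2r (n := 2)) ?nnegrE ?cabs_ge0 // sqr_cabsE real_normK ?num_real //.
by rewrite lerDl sqr_ge0.
Qed.

Lemma normr_Im_le (z : R[i]) : `|complex.Im z| <= cabs z.
Proof.
rewrite -(ler_pXn2r (n := 2)) ?nnegrE ?cabs_ge0 // sqr_cabsE real_normK ?num_real //.
by rewrite lerDr sqr_ge0.
Qed.

Lemma cabs_le_ReIm (z : R[i]) : cabs z <= `|complex.Re z| + `|complex.Im z|.
Proof.
have a := normr_ge0 (complex.Re z); have b := normr_ge0 (complex.Im z).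
rewrite -(ler_pXn2r (n := 2)) ?nnegrE ?cabs_ge0 ?addr_ge0 // sqr_cabsE.
rewrite -(real_normK (num_real (complex.Re z))) -(real_normK (num_real (complex.Im z))).
by nra.
Qed.

Lemma measurable_cabs f : cmeasurable f -> measurable_fun setT (fun x => cabs (f x)).
Proof.
move=> [f1 f2].
have -> : (fun x => cabs (f x)) =
    (fun x => Num.sqrt (complex.Re (f x) ^+ 2 + complex.Im (f x) ^+ 2)).
  by apply/funext => x; rewrite -sqr_cabsE sqrtr_sqr ger0_norm ?cabs_ge0.
apply: measurableT_comp; first exact: (continuous_measurable_fun (@sqrt_continuous R)).
by apply: measurable_funD; exact: measurable_funX.
Qed.

Lemma tintegrable_cabs f : tintegrable f ->
  (lebesgue_rV n).-integrable torus (EFin \o (fun x => cabs (f x))).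
Proof.
move=> [mf fi]; apply/integrableP; split.
  by apply/measurable_EFinP; apply: measurable_funS (measurable_cabs mf).
under eq_integral => t _ do rewrite gee0_abs ?lee_fin ?cabs_ge0 //.
exact: fi.
Qed.

Lemma tintegrable_Re f : tintegrable f ->
  (lebesgue_rV n).-integrable torus (EFin \o (fun x => complex.Re (f x))).
Proof.
move=> fi; apply: le_integrable (tintegrable_cabs fi) => //.
  by case: fi => -[f1 f2] _; apply/measurable_EFinP; exact: measurable_funS f1.
by move=> t _ /=; rewrite lee_fin (le_trans (normr_Re_le _)) // ler_norm.
Qed.

Lemma tintegrable_Im f : tintegrable f ->
  (lebesgue_rV n).-integrable torus (EFin \o (fun x => complex.Im (f x))).
Proof.
move=> fi; apply: le_integrable (tintegrable_cabs fi) => //.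
  by case: fi => -[f1 f2] _; apply/measurable_EFinP; exact: measurable_funS f2.
by move=> t _ /=; rewrite lee_fin (le_trans (normr_Im_le _)) // ler_norm.
Qed.

Lemma complex_ReM (a z : R[i]) : complex.Re (a * z) =
  complex.Re a * complex.Re z - complex.Im a * complex.Im z.
Proof. by case: a z => a b [c e]. Qed.

Lemma complex_ImM (a z : R[i]) : complex.Im (a * z) =
  complex.Re a * complex.Im z + complex.Im a * complex.Re z.
Proof. by case: a z => a b [c e]. Qed.

Lemma complex_ReD (a z : R[i]) : complex.Re (a + z) = complex.Re a + complex.Re z.
Proof. by case: a z => a b [c e]. Qed.

Lemma complex_ImD (a z : R[i]) : complex.Im (a + z) = complex.Im a + complex.Im z.
Proof. by case: a z => a b [c e]. Qed.

Lemma torus_integralP (a : R[i]) f g : tintegrable f -> tintegrable g ->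
  torus_integral (fun x => a * f x + g x) = a * torus_integral f + torus_integral g.
Proof.
move=> fi gi; have fr := tintegrable_Re fi; have fm := tintegrable_Im fi.
have gr := tintegrable_Re gi; have gm := tintegrable_Im gi.
have Zi c (u : 'rV[R]_n -> R) : (lebesgue_rV n).-integrable torus (EFin \o u) ->
    (lebesgue_rV n).-integrable torus (EFin \o (fun x => c * u x)).
  by move=> ui; apply: (integrableZl mtorus c ui).
rewrite /torus_integral; apply/eqP; rewrite eq_complex; apply/andP; split; apply/eqP.
  rewrite [RHS]complex_ReD complex_ReM /= -!RintegralZl // -RintegralB //; [|exact: Zi..].
  rewrite -RintegralD //; last exact: integrableB (Zi _ _ _) (Zi _ _ _).
  by apply: eq_Rintegral => x _; rewrite complex_ReD complex_ReM.
rewrite [RHS]complex_ImD complex_ImM /= -!RintegralZl // -RintegralD //; [|exact: Zi..].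
rewrite -RintegralD //; last exact: integrableD (Zi _ _ _) (Zi _ _ _).
by apply: eq_Rintegral => x _; rewrite complex_ImD complex_ImM.
Qed.

Lemma torus_integral_cst (c : R[i]) :
  torus_integral (fun _ : 'rV[R]_n => c) = ((2 * pi) ^+ n)%:C * c.
Proof.
have e (a : R) : \int[lebesgue_rV n]_(x in torus) a = a * (2 * pi) ^+ n.
  by rewrite Rintegral_cst //; congr (_ * _); exact: (congr1 fine lebesgue_torus).
rewrite /torus_integral !e.
by case: c => a b; apply/eqP; rewrite eq_complex /= !mul0r subr0 addr0 ![_ * (_ ^+ _)]mulrC !eqxx.
Qed.

Lemma cabs_torus_integral f (C : R) : tintegrable f -> (torus_norm1 f <= C%:E)%E ->
  cabs (torus_integral f) <= 2 * C.
Proof.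
move=> fi fC.
have key (u : 'rV[R]_n -> R) : (lebesgue_rV n).-integrable torus (EFin \o u) ->
    (forall x, `|u x| <= cabs (f x)) -> `|\int[lebesgue_rV n]_(x in torus) u x| <= C.
  move=> ui uf; apply: le_trans (le_normr_Rintegral mtorus ui) _.
  have uin := integrable_norm ui.
  rewrite -lee_fin; apply: le_trans fC.
  rewrite fineK; last exact: integrable_fin_num uin.
  apply: ge0_le_integral => //.
  - by have /integrableP[] := uin.
  - by have /integrableP[] := tintegrable_cabs fi.
  - by move=> x _; rewrite lee_fin uf.
apply: le_trans (cabs_le_ReIm _) _; rewrite mulr_natl mulr2n; apply: lerD.
  by apply: key (tintegrable_Re fi) _ => x; exact: normr_Re_le.
by apply: key (tintegrable_Im fi) _ => x; exact: normr_Im_le.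
Qed.

Lemma torus_integral_ae f g : cmeasurable f -> cmeasurable g -> torus_ae_eq f g ->
  torus_integral f = torus_integral g.
Proof.
move=> [f1 f2] [g1 g2] fg.
have key (u v : 'rV[R]_n -> R) : measurable_fun setT u -> measurable_fun setT v ->
    ae_eq (lebesgue_rV n) torus u v ->
    \int[lebesgue_rV n]_(x in torus) u x = \int[lebesgue_rV n]_(x in torus) v x.
  move=> mu mv uv; congr fine; apply: ae_eq_integral => //.
  - by apply/measurable_EFinP; exact: measurable_funS mu.
  - by apply/measurable_EFinP; exact: measurable_funS mv.
  - by apply: filterS uv => t /= h tt; rewrite h.
rewrite /torus_integral; congr (_ +i* _); apply: key => //.
  by apply: filterS fg => t /= h tt; rewrite h.
by apply: filterS fg => t /= h tt; rewrite h.
Qed.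

Lemma Rintegral_torus_translate (u : 'rV[R]_n -> R) x : measurable_fun setT u ->
  (forall t j, u (t + (2 * pi) *: delta_mx ord0 j) = u t) ->
  \int[lebesgue_rV n]_(t in torus) u (t - x) = \int[lebesgue_rV n]_(t in torus) u t.
Proof.
move=> mu pu; congr fine; rewrite [LHS]integralE [RHS]integralE.
have mE : measurable_fun setT (EFin \o u) by exact/measurable_EFinP.
congr (_ - _)%E.
  transitivity (\int[lebesgue_rV n]_(t in torus) ((EFin \o u)^\+) (t - x)%R)%E.
    by apply: eq_integral => t _; rewrite !funeposE.
  apply: integral_torus_translate; split=> // [|t j].
    exact: measurable_funepos.
  by rewrite !funeposE /= pu.
transitivity (\int[lebesgue_rV n]_(t in torus) ((EFin \o u)^\-) (t - x)%R)%E.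
    by apply: eq_integral => t _; rewrite !funenegE.
  apply: integral_torus_translate; split=> // [|t j].
  exact: measurable_funeneg.
by rewrite !funenegE /= pu.
Qed.

Lemma torus_integral_translation f x : cmeasurable f -> torus_periodic f ->
  torus_integral (translation x f) = torus_integral f.
Proof.
move=> [f1 f2] pf; rewrite /torus_integral; congr (_ +i* _).
  by rewrite -(@Rintegral_torus_translate (fun t => complex.Re (f t)) x) // => t j; rewrite pf.
by rewrite -(@Rintegral_torus_translate (fun t => complex.Im (f t)) x) // => t j; rewrite pf.
Qed.

Lemma measurable_dotZ k : measurable_fun setT (dotZ k : 'rV[R]_n -> R).
Proof.
apply: measurable_sum => j; apply: measurable_funM; first exact: measurable_cst.
exact: measurable_coord.
Qed.

Lemma cmeasurable_cisM f (u : 'rV[R]_n -> R) : measurable_fun setT u -> cmeasurable f ->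
  cmeasurable (fun x => f x * cis (u x)).
Proof.
move=> mu [f1 f2].
have mc : measurable_fun setT (fun x => cos (u x)).
  by apply: measurableT_comp mu; exact: (continuous_measurable_fun (@continuous_cos R)).
have ms : measurable_fun setT (fun x => sin (u x)).
  by apply: measurableT_comp mu; exact: (continuous_measurable_fun (@continuous_sin R)).
split; [under eq_fun do rewrite complex_ReM /=|under eq_fun do rewrite complex_ImM /=].
  by apply: measurable_funB; exact: measurable_funM.
by apply: measurable_funD; exact: measurable_funM.
Qed.

Lemma torus_norm1_cisM f (u : 'rV[R]_n -> R) :
  torus_norm1 (fun x => f x * cis (u x)) = torus_norm1 f.
Proof.
apply: eq_integral => x _; congr EFin.
by rewrite -/(cabs _) -/(cabs _) cabsM cabs_cis mulr1.
Qed.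

Lemma tintegrable_cisM f (u : 'rV[R]_n -> R) : measurable_fun setT u -> tintegrable f ->
  tintegrable (fun x => f x * cis (u x)).
Proof.
by move=> mu [mf fi]; split; [exact: cmeasurable_cisM|rewrite torus_norm1_cisM].
Qed.

Let mN k : measurable_fun setT (fun x : 'rV[R]_n => - dotZ k x).
Proof. by apply: measurable_funN; exact: measurable_dotZ. Qed.

Lemma fourier_coef_ae f g k : cmeasurable f -> cmeasurable g -> torus_ae_eq f g ->
  fourier_coef f k = fourier_coef g k.
Proof.
move=> mf mg fg; congr (_ * _); apply: torus_integral_ae; [exact: cmeasurable_cisM..|].
by apply: filterS fg => t /= h tt; rewrite h.
Qed.

Lemma fourier_coefP (a : R[i]) f g k : tintegrable f -> tintegrable g ->
  fourier_coef (fun x => a * f x + g x) k = a * fourier_coef f k + fourier_coef g k.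
Proof.
move=> fi gi; rewrite /fourier_coef.
have -> : (fun x => (a * f x + g x) * cis (- dotZ k x)) =
    (fun x => a * (f x * cis (- dotZ k x)) + g x * cis (- dotZ k x)).
  by apply/funext => x; ring.
by rewrite torus_integralP; [ring|exact: tintegrable_cisM..].
Qed.

Lemma cis_dotZ_periodic k x j : cis (dotZ k (x + (2 * pi) *: delta_mx ord0 j)) = cis (dotZ k x) :> R[i].
Proof. by rewrite dotZD dotZ_delta cisD [_ * (2 * pi)]mulrC cis2piz mulr1. Qed.

Lemma fourier_coef_translation f k x : tintegrable f -> torus_periodic f ->
  fourier_coef (translation x f) k = cis (- dotZ k x) * fourier_coef f k.
Proof.
move=> fi pf; rewrite /fourier_coef mulrCA; congr (_ * _).
pose g t := f t * cis (- dotZ k t).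
have gi : tintegrable g by exact: tintegrable_cisM.
have pg : torus_periodic g.
  by move=> t j; rewrite /g pf -!conj_cis cis_dotZ_periodic.
rewrite -(torus_integral_translation x gi.1 pg).
have gx : tintegrable (translation x g).
  split; first exact: cmeasurable_translation gi.1.
  have -> : torus_norm1 (translation x g) = torus_norm1 g; last exact: gi.2.
  apply: (@integral_torus_translate R n (fun t => (complex.Re `|g t|)%:E) x); split.
  - by apply/measurable_EFinP; exact: measurable_cabs gi.1.
  - by move=> t; rewrite lee_fin cabs_ge0.
  - by move=> t j; rewrite pg.
have z0 : tintegrable (fun=> 0).
  split; first by split; exact: measurable_cst.
  by rewrite /torus_norm1 integral0_eq ?ltry // => t _; rewrite normr0.
have := torus_integralP (cis (- dotZ k x)) gx z0.
rewrite (torus_integral_cst 0) mulr0 addr0 => <-; congr torus_integral; apply/funext => t.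
rewrite addr0 /translation /g mulrCA -cisD; congr (_ * cis _).
have -> : dotZ k t = dotZ k (t - x) + dotZ k x by rewrite -dotZD subrK.
by rewrite opprD addrC.
Qed.

Lemma fourier_coef_char (c : R[i]) k : fourier_coef (fun x => c * cis (dotZ k x)) k = c.
Proof.
rewrite /fourier_coef (_ : (fun x => _) = fun _ : 'rV[R]_n => c); last first.
  by apply/funext => x; rewrite -mulrA -cisD subrr cis0 mulr1.
rewrite torus_integral_cst mulrA -rmorphM /= mulVf ?mul1r //.
by rewrite gt_eqF // exprn_gt0 // mulr_gt0 // pi_gt0.
Qed.

Lemma cabs_fourier_coef f k (C : R) : tintegrable f -> (torus_norm1 f <= C%:E)%E ->
  cabs (fourier_coef f k) <= 2 / (2 * pi) ^+ n * C.
Proof.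
move=> fi fC; have p0 : 0 <= ((2 * pi) ^+ n)^-1 :> R.
  by rewrite invr_ge0 exprn_ge0 // mulr_ge0 // pi_ge0.
rewrite /fourier_coef cabsM cabs_real ger0_norm // [2 / _]mulrC -mulrA ler_wpM2l //.
apply: cabs_torus_integral; first exact: tintegrable_cisM.
by rewrite torus_norm1_cisM.
Qed.

End fourier_coefficients.

(** * Homogeneous Banach spaces *)

Section homogeneous_space.
Context {R : realType} {d : nat} (B : homogeneousBanach R d).
Implicit Types (f g : B) (x y : 'rV[R]_d) (k : 'rV[int]_d).

Lemma hb_tintegrable f : tintegrable (hb_fun f).
Proof.
split; first exact: hb_measurable.
have [C hC] := hb_norm1 B.
exact: le_lt_trans (hC f) (ltry _).
Qed.

Lemma torus_ae_eq_trans (u v w : 'rV[R]_d -> R[i]) :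
  torus_ae_eq u v -> torus_ae_eq v w -> torus_ae_eq u w.
Proof. exact: ae_eq_trans. Qed.

Lemma torus_ae_eq_sym (u v : 'rV[R]_d -> R[i]) : torus_ae_eq u v -> torus_ae_eq v u.
Proof. exact: ae_eq_sym. Qed.

Lemma torus_ae_eq_lin (a : R[i]) (u u' v v' : 'rV[R]_d -> R[i]) :
  torus_ae_eq u u' -> torus_ae_eq v v' ->
  torus_ae_eq (fun x => a * u x + v x) (fun x => a * u' x + v' x).
Proof. by apply: filterS2 => x h1 h2 tx; rewrite h1 // h2. Qed.

Lemma cmeasurable_lin (a : R[i]) (u v : 'rV[R]_d -> R[i]) :
  cmeasurable u -> cmeasurable v -> cmeasurable (fun x => a * u x + v x).
Proof.
move=> [u1 u2] [v1 v2]; split.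
  under eq_fun do rewrite complex_ReD complex_ReM; apply: measurable_funD => //.
  by apply: measurable_funB; apply: measurable_funM.
under eq_fun do rewrite complex_ImD complex_ImM; apply: measurable_funD => //.
by apply: measurable_funD; apply: measurable_funM.
Qed.

Lemma hb_transP x (a : R[i]) f g :
  hb_trans x (a *: f + g) = a *: hb_trans x f + hb_trans x g.
Proof.
apply: hb_inj; apply: torus_ae_eq_trans (hb_transE x _) _.
apply: torus_ae_eq_trans (_ : torus_ae_eq _
   (translation x (fun t => a * hb_fun f t + hb_fun g t))) _.
  apply: torus_ae_eq_translation (hb_linear a f g).
  - exact: hb_measurable.
  - by apply: cmeasurable_lin; exact: hb_measurable.
  - exact: hb_periodic.
  - by move=> t j; rewrite !hb_periodic.
apply: torus_ae_eq_sym; apply: torus_ae_eq_trans (hb_linear _ _ _) _.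
by apply: torus_ae_eq_lin; exact: hb_transE.
Qed.

Lemma hb_transD x y f : hb_trans (x + y) f = hb_trans x (hb_trans y f).
Proof.
apply: hb_inj; apply: torus_ae_eq_trans (hb_transE _ _) _.
apply: torus_ae_eq_sym; apply: torus_ae_eq_trans (hb_transE _ _) _.
rewrite (_ : translation (x + y) _ = translation x (translation y (hb_fun f))); last first.
  by apply/funext => t; rewrite /translation opprD addrA.
apply: torus_ae_eq_translation (hb_transE y f).
- exact: hb_measurable.
- exact: cmeasurable_translation (hb_measurable f).
- exact: hb_periodic.
- exact: torus_periodic_translation (hb_periodic f).
Qed.

Lemma hb_trans_period j f : hb_trans ((2 * pi) *: delta_mx ord0 j) f = f.
Proof.
apply: hb_inj; apply: torus_ae_eq_trans (hb_transE _ _) _.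
rewrite (_ : translation _ _ = hb_fun f); first exact: ae_eq_refl.
by apply/funext => t; rewrite /translation -(hb_periodic f (t - _) j) subrK.
Qed.

Lemma hb_trans0 f : hb_trans 0 f = f.
Proof.
apply: hb_inj; apply: torus_ae_eq_trans (hb_transE _ _) _.
rewrite (_ : translation _ _ = hb_fun f); first exact: ae_eq_refl.
by apply/funext => t; rewrite /translation subr0.
Qed.

Lemma hb_trans_near0 f (e : R) : 0 < e -> exists2 r : R, 0 < r &
  forall x : 'rV[R]_d, (forall j, `|x ord0 j| <= r) -> rnorm (hb_trans x f - f) <= e.
Proof.
move=> e0; have /cvg_rnormP /(_ _ e0) := @hb_trans_continuous R d B f 0.
move=> /nbhs_ballP[r /= r0 hr]; exists (r / 2); first by rewrite divr_gt0.
move=> x hx; rewrite rdistC -{1}(hb_trans0 f); apply/ltW/hr.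
split=> // i j; rewrite mxE -ball_normE /ball_ /= sub0r normrN (ord1 i).
by apply: le_lt_trans (hx j) _; rewrite ltr_pdivrMr // ltr_pMr // ltr1n.
Qed.

Lemma hb_action : torus_action (@hb_trans R d B).
Proof.
exact: TorusAction hb_transP (@hb_trans_norm _ _ B) hb_transD hb_trans_period hb_trans_near0.
Qed.

Lemma hb_fourierP (a : R[i]) f g k : fourier_coef (hb_fun (a *: f + g)) k =
  a * fourier_coef (hb_fun f) k + fourier_coef (hb_fun g) k.
Proof.
rewrite -fourier_coefP; [|exact: hb_tintegrable..].
apply: fourier_coef_ae (hb_linear _ _ _); first exact: hb_measurable.
by apply: cmeasurable_lin; exact: hb_measurable.
Qed.

Lemma hb_fourier_trans x f k : fourier_coef (hb_fun (hb_trans x f)) k =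
  cis (- dotZ k x) * fourier_coef (hb_fun f) k.
Proof.
rewrite -fourier_coef_translation; [|exact: hb_tintegrable|exact: hb_periodic].
apply: fourier_coef_ae (hb_transE _ _); first exact: hb_measurable.
exact: cmeasurable_translation (hb_measurable f).
Qed.

Lemma hb_fun0 : torus_ae_eq (hb_fun (0 : B)) (cst 0).
Proof.
have := hb_linear (-1) (0 : B) 0; rewrite scaler0 addr0.
by apply: filterS => t h tt; rewrite h //= mulN1r addNr.
Qed.

Lemma hb_fun_sum (s : seq 'rV[int]_d) (c : 'rV[int]_d -> R[i]) (F : 'rV[int]_d -> B) :
  torus_ae_eq (hb_fun (\sum_(k <- s) c k *: F k)) (fun x => \sum_(k <- s) c k * hb_fun (F k) x).
Proof.
elim: s => [|k s IH].
  rewrite big_nil; apply: torus_ae_eq_trans hb_fun0 _.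
  by apply: aeW => x _; rewrite big_nil.
rewrite big_cons; apply: torus_ae_eq_trans (hb_linear _ _ _) _.
by apply: filterS IH => x h tx; rewrite h // big_cons.
Qed.

Local Notation P := (freq_proj (@hb_trans R d B)).

(** A simultaneous eigenvector of the translations is, up to its character, a
    translation invariant function; hence the spectral projections compute the
    terms of the Fourier series. *)
Lemma hb_fun_freq_proj k f : torus_ae_eq (hb_fun (P k f))
  (fun x => fourier_coef (hb_fun f) k * cis (dotZ k x)).
Proof.
have [C hC] := hb_norm1 B.
set g := P k f.
have ge : eigen (@hb_trans R d B) k g :=
  eigen_proj hb_action k f.
have cg : fourier_coef (hb_fun g) k = fourier_coef (hb_fun f) k.
  have f0 u : fourier_coef (hb_fun (0 : B)) u = 0.
    have := hb_fourierP (-1) 0 0 u; rewrite scaler0 addr0 => e.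
    by rewrite {1}e mulN1r addNr.
  apply: (proj_functional hb_action (phi := fun u => fourier_coef (hb_fun u) k) (K := 2 / (2 * pi) ^+ d * C)).
  - by move=> u v; rewrite -[u in LHS]scale1r hb_fourierP mul1r.
  - by move=> a u; rewrite -[a *: u]addr0 hb_fourierP f0 addr0.
  - move=> u; rewrite -[leRHS]mulrA; exact: (cabs_fourier_coef k (hb_tintegrable u) (hC u)).
  - by move=> x; exact: hb_fourier_trans.
pose h x := hb_fun g x * cis (- dotZ k x).
have mN : measurable_fun setT (fun x : 'rV[R]_d => - dotZ k x).
  by apply: measurable_funN; exact: measurable_dotZ.
have mh : cmeasurable h by apply: cmeasurable_cisM => //; exact: hb_measurable.
have ph : torus_periodic h.
  by move=> x j; rewrite /h hb_periodic -!conj_cis cis_dotZ_periodic.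
have [c hc] : exists c, torus_ae_eq h (cst c).
  apply: torus_invariant_cst => // x.
  have h1 := hb_transE x g; rewrite ge in h1.
  have h2 := hb_linear (cis (- dotZ k x)) g 0; rewrite addr0 in h2.
  apply: filterS3 h1 h2 hb_fun0 => t h1 h2 h3 tt.
  have {}h1 := h1 tt; rewrite h2 // h3 //= addr0 in h1.
  rewrite /translation /h; rewrite /translation in h1; rewrite -h1.
  rewrite mulrAC -cisD mulrC; congr (_ * cis _).
  have -> : dotZ k t = dotZ k (t - x) + dotZ k x by rewrite -dotZD subrK.
  by rewrite opprD addrC.
have gc : torus_ae_eq (hb_fun g) (fun x => c * cis (dotZ k x)).
  apply: filterS hc => x hx tx; rewrite -[c](hx tx) /h -mulrA -cisD addNr cis0 mulr1 //.
suff -> : fourier_coef (hb_fun f) k = c by [].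
rewrite -cg -(fourier_coef_char c k); apply: fourier_coef_ae gc; first exact: hb_measurable.
apply: (cmeasurable_cisM (f := cst c)); first exact: measurable_dotZ.
by split; exact: measurable_cst.
Qed.

End homogeneous_space.

(** * The Riesz means *)

Section frequency_box.
Context {d : nat}.

Definition freq_box (n : nat) : seq 'rV[int]_d :=
  [seq \row_j ((f j : nat)%:Z - n%:Z) | f : {ffun 'I_d -> 'I_(2 * n).+1} <- enum {ffun 'I_d -> 'I_(2 * n).+1}].

Lemma freq_box_uniq n : uniq (freq_box n).
Proof.
rewrite map_inj_uniq ?enum_uniq // => f g /rowP fg; apply/ffunP => j; apply/val_inj.
by have := fg j; rewrite !mxE => /addIr[].
Qed.

Lemma mem_freq_box n (k : 'rV[int]_d) : (forall j, `|k ord0 j| <= n)%N -> k \in freq_box n.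
Proof.
move=> kn; have h j : exists i : 'I_(2 * n).+1, (i : nat)%:Z - n%:Z = k ord0 j.
  have lt : (absz (k ord0 j + n%:Z)%R < (2 * n).+1)%N by have := kn j; lia.
  by exists (Ordinal lt) => /=; have := kn j; lia.
have [f hf] := choice h; apply/mapP; exists [ffun j => f j]; first by rewrite mem_enum.
by apply/rowP => j; rewrite !mxE ffunE hf.
Qed.

End frequency_box.

Section riesz_means.
Context {R : realType} {d : nat} (B : homogeneousBanach R d).
Variables (gamma alpha : R) (q : \bar R).
Hypothesis gamma1 : 1 <= gamma.
Hypothesis alpha0 : 0 < alpha.
Hypothesis q1 : q = +oo%E \/ exists2 r : R, 1 <= r & q = r%:E.

Lemma lq_normZ_ge0 k : 0 <= lq_normZ q (k : 'rV[int]_d) :> R.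
Proof.
case: q1 => [->|[r r1 ->]]; last exact: powR_ge0.
by rewrite lq_normZ_infty.
Qed.

(** This makes the set of frequencies of a Riesz mean finite. *)
Lemma lq_normZ_coord (k : 'rV[int]_d) j : `|k ord0 j|%N%:R <= lq_normZ q k :> R.
Proof.
case: q1 => [->|[r r1 ->]].
  rewrite lq_normZ_infty ler_nat.
  have -> : k ord0 j = idot (delta_mx ord0 j) k.
    rewrite /idot (bigD1 j) //= mxE !eqxx mul1r big1 ?addr0 // => i ij.
    by rewrite mxE (negbTE ij) mul0r.
  exact: (leq_bigmax (F := fun i => `|idot (delta_mx ord0 i) k|%N)).
have r0 : 0 < r by exact: lt_le_trans r1.
rewrite /lq_normZ /lq_norm (bigD1 j) //=.
apply: le_trans (_ : (`|(map_mx intr k : 'rV[R]_d) ord0 j| `^ r) `^ r^-1 <= _).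
  by rewrite -powRrM mulfV ?gt_eqF // powRr1 // mxE natr_absz intr_norm.
apply: ge0_ler_powR; rewrite ?nnegrE ?invr_ge0 ?(ltW r0) ?powR_ge0 //.
  by rewrite addr_ge0 ?powR_ge0 // sumr_ge0 // => i _; exact: powR_ge0.
by rewrite lerDl sumr_ge0 // => i _; exact: powR_ge0.
Qed.

Local Notation M := (riesz_multiplier gamma alpha q).

Lemma riesz_multiplier_outside n (k : 'rV[int]_d) : (0 < n)%N ->
  n%:R <= lq_normZ q k :> R -> M n k = 0.
Proof.
move=> n0 h; apply: riesz_profile_eq0 => //.
by rewrite ler_pdivlMr ?ltr0n // mul1r.
Qed.

Lemma riesz_multiplier_box n (k : 'rV[int]_d) : (0 < n)%N -> k \notin freq_box n -> M n k = 0.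
Proof.
move=> n0 kn; apply: riesz_multiplier_outside => //.
have [j hj] : exists j, (n < `|k ord0 j|)%N.
  apply: contrapT => h; move: kn; rewrite mem_freq_box // => j; rewrite leqNgt.
  by apply/negP => hj; apply: h; exists j.
by apply: le_trans (lq_normZ_coord k j); rewrite ler_nat ltnW.
Qed.

Lemma riesz_multiplier_cvg (k : 'rV[int]_d) : M n k @[n --> \oo] --> (1 : R).
Proof.
have [m [gm am]] := nat_above_both (le_trans ler01 gamma1) (ltW alpha0).
apply/cvgrPdist_le => e e0; pose c : R := m%:R * lq_normZ q k.
have c0 : 0 <= c by rewrite mulr_ge0 ?lq_normZ_ge0.
exists (Num.bound (c / e)).+1 => // n /= hn.
have n0 : 0 < n%:R :> R by rewrite ltr0n (leq_trans _ hn).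
rewrite distrC; apply: le_trans (riesz_profile_near1 gamma1 alpha0 gm am _) _.
  by rewrite divr_ge0 ?lq_normZ_ge0.
rewrite mulrA ler_pdivrMr // -ler_pdivrMl // mulrC.
apply: ltW; apply: lt_le_trans (archi_boundP _) _; first by rewrite divr_ge0 // ltW.
by rewrite ler_nat ltnW.
Qed.

Lemma riesz_meanE n (f : 'rV[R]_d -> R[i]) x : (0 < n)%N ->
  riesz_mean q gamma alpha n f x =
  \sum_(k <- freq_box n) (M n k)%:C * (fourier_coef f k * cis (dotZ k x)).
Proof.
move=> n0; have np : 0 < n%:R :> R by rewrite ltr0n.
rewrite fsbig_seq; last exact: freq_box_uniq.
rewrite /riesz_mean -(fsbig_widen [set k | lq_normZ q k <= n%:R] [set` freq_box n]).
- apply: eq_fsbigr => k; rewrite inE /= => kn; rewrite -mulrA; congr (_%:C * _).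
  rewrite /riesz_multiplier /riesz_profile riesz_gapE //.
  by rewrite divr_ge0 ?lq_normZ_ge0 //= ler_pdivrMr // mul1r.
- move=> k /= kn; apply: mem_freq_box => j; rewrite -(ler_nat R).
  exact: le_trans (lq_normZ_coord k j) kn.
move=> k [_ /= /negP]; rewrite -ltNge => kn; rewrite riesz_multiplier_outside ?mul0r //.
exact: ltW.
Qed.

Lemma riesz_means_bounded_cvg :
  (exists C : R, forall n (F : seq 'rV[int]_d), (0 < n)%N -> mass_bound C F (M n)) ->
  exists S : nat -> B -> B,
    [/\ forall (n : nat) (f : B), (1 <= n)%N ->
          torus_ae_eq (hb_fun (S n f)) (riesz_mean q gamma alpha n (hb_fun f)),
        exists C : R, forall (f : B) (n : nat), (1 <= n)%N ->
          rnorm (S n f) <= C * rnorm f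
      & forall f : B, S n f @[n --> \oo] --> f].
Proof.
move=> [C hC]; have box n := @freq_box_uniq d n.
exists (fun n => multiplier_op (@hb_trans R d B) (freq_box n) (M n)); split.
- move=> n f n0; apply: torus_ae_eq_trans (hb_fun_sum _ _ _) _.
  rewrite (_ : riesz_mean _ _ _ _ _ = fun x => \sum_(k <- freq_box n)
      (M n k)%:C * (fourier_coef (hb_fun f) k * cis (dotZ k x))); last first.
    by apply/funext => x; exact: riesz_meanE.
  elim: (freq_box n) => [|k s IH]; first by apply: aeW => x _; rewrite !big_nil.
  apply: filterS2 (hb_fun_freq_proj k f) IH => x h1 h2 tx.
  by rewrite !big_cons h1 // h2.
- exists C => f n n0.
  apply: (multiplier_op_bound (hb_action B) (box n)).
    by move=> k; exact: riesz_multiplier_box.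
  by move=> F; exact: hC.
move=> f; apply: (multiplier_op_cvg (hb_action B) (C := C)) => //.
- by move=> n k n0; exact: riesz_multiplier_box.
- exact: riesz_multiplier_cvg.
Qed.

End riesz_means.

Local Close Scope complex_scope.

(* [S n f] is the element of B whose function is the Riesz mean of f. *)
Theorem theorem6p2 (R : realType) (d : nat) (B : homogeneousBanach R d)
    (q : \bar R) (gamma alpha : R) :
  (1 <= d)%N ->
  1 <= gamma ->
  ((q = 1%:E \/ q = +oo%E) /\ 0 < alpha) \/
  [/\ q = 2%:E, gamma \is a Num.nat & (d%:R - 1) / 2 < alpha] ->
  exists S : nat -> B -> B,
    [/\ forall (n : nat) (f : B), (1 <= n)%N ->
          torus_ae_eq (hb_fun (S n f)) (riesz_mean q gamma alpha n (hb_fun f)),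
        exists C : R, forall (f : B) (n : nat), (1 <= n)%N ->
          rnorm (S n f) <= C * rnorm f
      & forall f : B, S n f @[n --> \oo] --> f].
Proof.
move=> d0 gamma1 [[q1 alpha0]|[-> _ alphad]].
  apply: riesz_means_bounded_cvg => //.
    by case: q1 => ->; [right; exists 1|left].
  by case: q1 => ->; [exact: mass_bound_l1|exact: mass_bound_linfty].
have alpha0 : 0 < alpha.
  by apply: le_lt_trans alphad; rewrite divr_ge0 // subr_ge0 ler1n.
apply: riesz_means_bounded_cvg => //; first by right; exists 2; rewrite ?ler1n.
exact: mass_bound_l2.
Qed.
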